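(* Let $\mathcal{G}$ be a locally compact, $\sigma$-compact and (topologically) amenable groupoid with a Haar system. Then there exists a strong inverse approximation $\{\mathcal{G}_\alpha,q^\beta_\alpha,A\}$ of $\mathcal{G}$ by locally compact, second countable, (topologically) amenable and metrisable groupoids with Haar systems such that each quotient map $q_\alpha:\mathcal{G}\to\mathcal{G}_\alpha$ is Haar system preserving. Moreover, for the induced direct system of topological $*$-algebras $\{C_c(\mathcal{G}_\alpha),(q^\beta_\alpha)^*,A\}$ one has $$C_c(\mathcal{G})=\bigcup_\alpha (q_\alpha)^*C_c(\mathcal{G}_\alpha)\quad\text{and}\quad C^*_{\max}(\mathcal{G})=\bigcup_\alpha (q_\alpha)^*C^*_{\max}(\mathcal{G}_\alpha).$$
   Context: A locally compact groupoid $\mathcal{G}$ (unit space $\mathcal{G}^{(0)}$, source $s$, range $r$, $\mathcal{G}_x=s^{-1}(x)$) carries a locally compact Hausdorff topology for which composition and inversion are continuous and $r$ is open. A (right) Haar system is a family $\{\mu_x:x\in\mathcal{G}^{(0)}\}$ of positive regular Radon measures on $\mathcal{G}$ with $\mathrm{supp}\,\mu_x=\mathcal{G}_x$, $x\mapsto\int f\,d\mu_x$ continuous for $f\in C_c(\mathcal{G})$, and $\int f(\gamma'\gamma)\,d\mu_{r(\gamma)}(\gamma')=\int f(\gamma')\,d\mu_{s(\gamma)}(\gamma')$ for all $\gamma\in\mathcal{G}$, $f\in C_c(\mathcal{G})$. A groupoid morphism $q:\mathcal{G}\to\mathcal{H}$ between locally compact groupoids with Haar systems $\{\mu_x\}$,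 $\{\nu_z\}$ is Haar system preserving if it is proper, continuous, and $q_*\mu_x=\nu_z$ for every $z\in\mathcal{H}^{(0)}$ and $x\in q^{-1}(z)$ a unit. $C_c(\mathcal{G})$ is a $*$-algebra with $(f*g)(\gamma)=\int_{\mathcal{G}_{s(\gamma)}}f(\gamma\alpha^{-1})g(\alpha)\,d\mu_{s(\gamma)}(\alpha)$, $f^*(\gamma)=\overline{f(\gamma^{-1})}$. With $\|f\|_I=\max\{\sup_x\int|f|\,d\mu_x,\sup_x\int|f^*|\,d\mu_x\}$ and $L^1(\mathcal{G})$ the $\|\cdot\|_I$-completion, $C^*_{\max}(\mathcal{G})$ is the completion of $C_c(\mathcal{G})$ in the norm $\sup_\pi\|\pi(f)\|$ over contractive $*$-representations $\pi$ of $L^1(\mathcal{G})$. For a surjective Haar system preserving $q$, $q^*(f)=f\circ q$ defines a $*$-homomorphism $C_c(\mathcal{H})\to C_c(\mathcal{G})$ that extends to a norm-preserving $*$-homomorphism $q^*:C^*_{\max}(\mathcal{H})\to C^*_{\max}(\mathcal{G})$. Topological amenability: there is a sequence of families $m^{(n)}=\{m^{(n)}_x:x\in\mathcal{G}^{(0)}\}$ of positive finite Radon measures on $\mathcal{G}$ such that: $\|m^{(n)}_x\|_1\le1$ and $m^{(n)}_x(\mathcal{G}\setminus s^{-1}(x))=0$; $x\mapsto\int f\,dm^{(n)}_x$ is continuous for all $f\in C_c(\mathcal{G})$; $\|m^{(n)}_x\|_1\to1$ uniformly on compact subsets of $\mathcal{G}^{(0)}$; $\|m^{(n)}_{s(\gamma)}-\gamma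 m^{(n)}_{r(\gamma)}\|_1\to0$ uniformly on compact subsets of $\mathcal{G}$, where $\gamma m$ is the push-forward under $\alpha\mapsto\alpha\gamma$, $\mathcal{G}_{r(\gamma)}\to\mathcal{G}_{s(\gamma)}$. Inverse approximation of $\mathcal{G}$: an inverse system of locally compact groupoids $\mathcal{G}_\alpha$ over a directed set $A$ whose connecting maps are proper continuous surjective groupoid morphisms (compatible under composition, identity when the indices coincide), with $\varprojlim_\alpha\mathcal{G}_\alpha=\mathcal{G}$ in the category of topological groupoids with proper continuous morphisms; $q_\alpha:\mathcal{G}\to\mathcal{G}_\alpha$ are the canonical projections. Covers. For covers $\mathcal{U},\mathcal{V}$ of a set, $\mathcal{U}$ star refines $\mathcal{V}$ ($\mathcal{U}\le\mathcal{V}$) if for each $U\in\mathcal{U}$ the set $\bigcup\{U'\in\mathcal{U}:U'\cap U\neq\emptyset\}$ lies in some element of $\mathcal{V}$. A normal sequence is a sequence of covers $\mathcal{U}_0\ge\mathcal{U}_1\ge\mathcal{U}_2\ge\cdots$. A sequence $\{\mathcal{V}_n\}$ cofinally refines $\{\mathcal{U}_n\}$ if for every $m$ there is $k$ with $\mathcal{V}_k\le\mathcal{U}_m$. The $\sigma$-compact locally compact space $\mathcal{G}$ is regarded as a uniform space whose uniform structure is based on all open covers. The inverse approximation, with each $\mathcal{G}_\alpha$ a metric space, is strong if for every countable family $\{\{\mathcal{W}^l_n\}_n:l\in\mathbb{N}\}$ of normal sequences of uniform covers of $\mathcal{G}$ there is $\alpha\in A$ such that $\{\mathcal{V}^\alpha_n\}_n$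 cofinally refines $\{\mathcal{W}^l_n\}_n$ for every $l$, where $\mathcal{V}^\alpha_n$ is the cover of $\mathcal{G}$ by the $q_\alpha$-preimages of the balls of radius $1/2^n$ in $\mathcal{G}_\alpha$. *)

(* Defs.v *)
From HB Require Import structures.
From mathcomp Require Import all_boot all_order all_algebra.
From mathcomp Require Import all_classical all_reals all_analysis.
From mathcomp Require Import complex.

Set Implicit Arguments.
Unset Strict Implicit.
Unset Printing Implicit Defensive.

Import Order.TTheory GRing.Theory Num.Theory.
Import numFieldNormedType.Exports.

Local Open Scope classical_set_scope.
Local Open Scope ring_scope.

(* Units are identified with identity arrows, so that source and range are    *)
(* maps [T -> T].  The product [gmul a b] is total, but it is meaningful only *)
(* when [gsrc a = grng b]; its other values are unconstrained.                *)
HB.mixin Record isGroupoid T := {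
  gsrc : T -> T ;
  grng : T -> T ;
  gmul : T -> T -> T ;
  ginv : T -> T ;
  gsrc_src : forall a, gsrc (gsrc a) = gsrc a ;
  grng_src : forall a, grng (gsrc a) = gsrc a ;
  gsrc_rng : forall a, gsrc (grng a) = grng a ;
  grng_rng : forall a, grng (grng a) = grng a ;
  gsrc_mul : forall a b, gsrc a = grng b -> gsrc (gmul a b) = gsrc b ;
  grng_mul : forall a b, gsrc a = grng b -> grng (gmul a b) = grng a ;
  gmulA : forall a b c, gsrc a = grng b -> gsrc b = grng c ->
    gmul a (gmul b c) = gmul (gmul a b) c ;
  gmul_src : forall a, gmul a (gsrc a) = a ;
  gmul_rng : forall a, gmul (grng a) a = a ;
  gsrc_inv : forall a, gsrc (ginv a) = grng a ;
  grng_inv : forall a, grng (ginv a) = gsrc a ;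
  gmulV : forall a, gmul a (ginv a) = grng a ;
  gmulVl : forall a, gmul (ginv a) a = gsrc a
}.

#[short(type="groupoidType")]
HB.structure Definition Groupoid := {T of isGroupoid T}.

HB.mixin Record Groupoid_isTopological T & Topological T & Groupoid T := {
  gmul_continuous :
    {within [set p : T * T | gsrc p.1 = grng p.2],
      continuous (fun p : T * T => gmul p.1 p.2)} ;
  ginv_continuous : continuous (ginv : T -> T)
}.

#[short(type="topGroupoidType")]
HB.structure Definition TopologicalGroupoid :=
  {T of Topological T & Groupoid T & Groupoid_isTopological T}.

(* The measurable structures of the library live on pointed types.            *)
#[short(type="ptopGroupoidType")]
HB.structure Definition PointedTopologicalGroupoid :=
  {T of TopologicalGroupoid T & Pointed T}.

#[short(type="pmetricGroupoidType")]
HB.structure Definition PointedMetricGroupoid (K : numDomainType) :=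
  {T of TopologicalGroupoid T & Pointed T & Metric K T}.

Definition units (G : groupoidType) : set G := [set x | gsrc x = x].

(* [gfiber x] is the source fibre of [x]. *)
Definition gfiber (G : groupoidType) (x : G) : set G := [set a | gsrc a = x].

Definition lc_groupoid (G : topGroupoidType) : Prop :=
  [/\ hausdorff_space G,
      locally_compact [set: G] &
      forall U : set G, open U ->
        exists2 V : set G, open V & grng @` U = V `&` @units G].

Definition sigma_compact (X : topologicalType) : Prop :=
  exists2 K : nat -> set X, (forall n, compact (K n)) & \bigcup_n K n = setT.

Definition groupoid_morphism (G H : groupoidType) (q : G -> H) : Prop :=
  [/\ forall a, gsrc (q a) = q (gsrc a),
      forall a, grng (q a) = q (grng a) &
      forall a b, gsrc a = grng b -> q (gmul a b) = gmul (q a) (q b)].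

Definition proper_map (X Y : topologicalType) (q : X -> Y) : Prop :=
  forall K : set Y, compact K -> compact (q @^-1` K).

Definition pc_morphism (G H : topGroupoidType) (q : G -> H) : Prop :=
  [/\ groupoid_morphism q, continuous q & proper_map q].

Notation borel T := (g_sigma_algebraType (@open T)).

Section Measures.
Variables (R : realType) (T : ptopologicalType).
Implicit Types (m : {measure set (borel T) -> \bar R}) (D : set T)
  (f g : T -> R[i]).

Definition Cc : set (T -> R[i]) :=
  [set f | continuous (f : T -> R[i]^o) /\
           compact (closure [set x | f x != 0])].

Definition cintegral m D f : R[i] :=
  Complex (Rintegral m D (fun x => complex.Re (f x)))
          (Rintegral m D (fun x => complex.Im (f x))).

Definition radon m : Prop :=
  [/\ forall K : set T, compact K -> (m K < +oo)%E,
      forall B : set (borel T), measurable B ->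
        m B = ereal_inf [set m U | U in [set U | @open T U /\ B `<=` U]] &
      forall U : set T, open U ->
        m U = ereal_sup [set m K | K in [set K | @compact T K /\ K `<=` U]]].

Definition msupport m : set T :=
  [set x | forall U : set T, open U -> U x -> (0 < m U)%E].

(* Total variation norm of a signed measure: supremum over finite families of *)
(* disjoint Borel sets.                                                       *)
Definition tv_norm (nu : set (borel T) -> \bar R) : \bar R :=
  ereal_sup [set r | exists n (B : nat -> set (borel T)),
    [/\ forall i, measurable (B i), trivIset setT B &
        r = (\sum_(i < n) `|nu (B i)|)%E]].

End Measures.

Section Haar.
Variables (R : realType) (G : ptopGroupoidType).
Implicit Types (mu : G -> {measure set (borel G) -> \bar R}) (f g : G -> R[i]).

(* Families indexed by units are functions on [G] used on [units G] only. *)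
Definition haar_system mu : Prop :=
  [/\ forall x, units x -> radon (mu x) /\ msupport (mu x) = gfiber x,
      forall f, Cc f -> {within @units G,
        continuous (fun x => cintegral (mu x) setT f : R[i]^o)} &
      forall a f, Cc f ->
        cintegral (mu (grng a)) (gfiber (grng a)) (fun b => f (gmul b a)) =
        cintegral (mu (gsrc a)) (gfiber (gsrc a)) f].

(* Push-forward under [b |-> gmul b a], from the source fibre of [grng a] to  *)
(* the source fibre of [gsrc a].                                              *)
Definition translate (a : G) (m : set (borel G) -> \bar R)
    (B : set (borel G)) : \bar R :=
  m (gfiber (grng a) `&` [set b | B (gmul b a)]).

Definition top_amenable : Prop :=
  exists m : nat -> G -> {measure set (borel G) -> \bar R},
  [/\ forall n x, units x ->
        [/\ radon (m n x), (m n x setT < +oo)%E,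
            (tv_norm (m n x) <= 1)%E & m n x (~` gfiber x) = 0%E],
      forall n f, Cc f -> {within @units G,
        continuous (fun x => cintegral (m n x) setT f : R[i]^o)},
      forall K : set G, compact K -> K `<=` @units G ->
        forall e : R, 0 < e -> exists n0, forall n x, (n0 <= n)%N -> K x ->
          (`|tv_norm (m n x) - 1| < e%:E)%E &
      forall K : set G, compact K ->
        forall e : R, 0 < e -> exists n0, forall n a, (n0 <= n)%N -> K a ->
          (tv_norm (fun B => m n (gsrc a) B - translate a (m n (grng a)) B)
             < e%:E)%E].

Definition convolution mu f g : G -> R[i] := fun a =>
  cintegral (mu (gsrc a)) (gfiber (gsrc a))
    (fun b => f (gmul a (ginv b)) * g b).

Definition involution f : G -> R[i] := fun a => Num.conj (f (ginv a)).

Definition I_norm mu f : \bar R :=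
  let N h := ereal_sup [set (\int[mu x]_a (Normc.normc (h a))%:E)%E
                       | x in @units G] in
  maxe (N f) (N (involution f)).

End Haar.

Definition haar_preserving (R : realType) (G H : ptopGroupoidType)
    (mu : G -> {measure set (borel G) -> \bar R})
    (nu : H -> {measure set (borel H) -> \bar R}) (q : G -> H) : Prop :=
  pc_morphism q /\
  forall z x, units z -> units x -> q x = z ->
    forall B : set (borel H), measurable B -> mu x (q @^-1` B) = nu z B.

(* The completion of a subspace [X] of [V] for a (semi)norm [N] is the set of *)
(* equivalence classes of [N]-Cauchy sequences in [X].  Operations on [X]     *)
(* that are uniformly continuous on bounded sets are extended to classes by   *)
(* applying them termwise to representatives.                                 *)
Section Completion.
Variables (R : realType) (V : zmodType) (N : V -> \bar R) (X : set V).

Definition ncauchy : set (nat -> V) := [set u | (forall n, X (u n)) /\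
  forall e : R, 0 < e -> exists n0, forall m n, (n0 <= m)%N -> (n0 <= n)%N ->
    (N (u m - u n)%R < e%:E)%E].

Definition nclass (u : nat -> V) : set (nat -> V) :=
  [set v | ncauchy v /\
    forall e : R, 0 < e -> exists n0, forall n, (n0 <= n)%N ->
      (N (u n - v n)%R < e%:E)%E].

Definition completion : set (set (nat -> V)) := [set nclass u | u in ncauchy].

Definition completion_in (v : V) : set (nat -> V) := nclass (fun=> v).

Definition completion_map (W : Type) (op : W -> V) (c : set (nat -> W)) :
  set (nat -> V) := \bigcup_(u in c) nclass (fun n => op (u n)).

Definition completion_op2 (op : V -> V -> V) (c d : set (nat -> V)) :
  set (nat -> V) := \bigcup_(u in c) \bigcup_(v in d)
    nclass (fun n => op (u n) (v n)).

Definition completion_norm (c : set (nat -> V)) : \bar R :=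
  limn (fun n => N (xget (fun=> 0) c n)).

End Completion.

Section Hilbert.
Variable R : realType.

Definition dot_norm (V : lmodType R[i]) (d : {dot V for Num.conj}) (x : V) : R :=
  Num.sqrt (complex.Re (d x x)).

Record hilbert := Hilbert {
  hilbert_car :> lmodType R[i] ;
  hilbert_dot : {dot hilbert_car for Num.conj} ;
  hilbert_complete : forall u : nat -> hilbert_car,
    (forall e : R, 0 < e -> exists n0, forall m n, (n0 <= m)%N -> (n0 <= n)%N ->
       dot_norm hilbert_dot (u m - u n) < e) ->
    exists l, forall e : R, 0 < e -> exists n0, forall n, (n0 <= n)%N ->
       dot_norm hilbert_dot (u n - l) < e
}.

Definition hnorm (H : hilbert) (x : H) : R := dot_norm (@hilbert_dot H) x.

Definition op_norm (H : hilbert) (T : H -> H) : \bar R :=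
  ereal_sup [set (hnorm (T x))%:E | x in [set x | hnorm x <= 1]].

End Hilbert.

Section Cstar.
Variables (R : realType) (G : ptopGroupoidType).
Variable mu : G -> {measure set (borel G) -> \bar R}.
Implicit Types c d : set (nat -> G -> R[i]).

Let N1 := I_norm mu.
Let X := @Cc R G.

Definition L1 : set (set (nat -> G -> R[i])) := completion N1 X.

Definition contractive_star_rep (H : hilbert R)
    (pi : set (nat -> G -> R[i]) -> H -> H) : Prop :=
  [/\ forall c, L1 c -> forall (a : R[i]) x y,
        pi c (a *: x + y) = a *: pi c x + pi c y,
      forall c d, L1 c -> L1 d -> forall (a : R[i]) x,
        pi (completion_op2 N1 X (fun f g => a *: f + g) c d) x =
        a *: pi c x + pi d x,
      forall c d, L1 c -> L1 d -> forall x,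
        pi (completion_op2 N1 X (convolution mu) c d) x = pi c (pi d x),
      forall c, L1 c -> forall x y,
        hilbert_dot H (pi c x) y =
        hilbert_dot H x (pi (completion_map N1 X (@involution R G) c) y) &
      forall c, L1 c -> (op_norm (pi c) <= completion_norm N1 c)%E].

Definition max_norm (f : G -> R[i]) : \bar R :=
  ereal_sup [set r | exists (H : hilbert R) pi,
    @contractive_star_rep H pi /\ r = op_norm (pi (completion_in N1 X f))].

Definition Cstar_max : set (set (nat -> G -> R[i])) := completion max_norm X.

End Cstar.

Definition pullback (R : realType) (S T : Type) (q : S -> T) (f : T -> R[i]) :
  S -> R[i] := fun a => f (q a).

(* The continuous extension of [pullback q] to the maximal C*-algebras. *)
Definition pullback_Cstar (R : realType) (G H : ptopGroupoidType)
    (mu : G -> {measure set (borel G) -> \bar R}) (q : G -> H) :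
    set (nat -> H -> R[i]) -> set (nat -> G -> R[i]) :=
  completion_map (max_norm mu) (@Cc R G) (pullback q).

(* Neighbourhoods of 0 for the inductive limit topology on [Cc T], the finest *)
(* locally convex topology inducing on the functions supported in each        *)
(* compact set a topology coarser than that of uniform convergence.           *)
Definition Cc_nbhs0 (R : realType) (T : ptopologicalType) :
    set (set (T -> R[i])) :=
  [set U | exists W : set (T -> R[i]),
    [/\ W `<=` U,
        forall f g (a b : R[i]), Normc.normc a + Normc.normc b <= 1 ->
          W f -> W g -> W (a *: f + b *: g) &
        forall K : set T, compact K -> exists2 e : R, 0 < e &
          forall f, @Cc R T f -> (forall x, ~ K x -> f x = 0) ->
            (forall x, Normc.normc (f x) < e) -> W f]].

Definition Cc_continuous_star_hom (R : realType) (G H : ptopGroupoidType)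
    (mu : G -> {measure set (borel G) -> \bar R})
    (nu : H -> {measure set (borel H) -> \bar R})
    (T : (H -> R[i]) -> (G -> R[i])) : Prop :=
  [/\ forall f, Cc f -> Cc (T f),
      forall f g (a : R[i]), Cc f -> Cc g -> T (a *: f + g) = a *: T f + T g,
      forall f g, Cc f -> Cc g ->
        T (convolution nu f g) = convolution mu (T f) (T g),
      forall f, Cc f -> T (involution f) = involution (T f) &
      forall U, Cc_nbhs0 U -> exists2 U', Cc_nbhs0 U' &
        forall f, Cc f -> U' f -> U (T f)].

Definition directed_set (A : Type) (le : A -> A -> Prop) : Prop :=
  [/\ inhabited A, forall a, le a a,
      forall a b c, le a b -> le b c -> le a c &
      forall a b, exists c, le a c /\ le b c].

Section InverseApproximation.
Variables (G : topGroupoidType) (A : Type) (le : A -> A -> Prop).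
Variables (GA : A -> topGroupoidType) (p : forall a b : A, GA b -> GA a).

Definition inverse_system : Prop :=
  [/\ directed_set le,
      forall a b, le a b -> pc_morphism (@p a b) /\
        forall y, exists x, @p a b x = y,
      forall a, @p a a = id &
      forall a b c, le a b -> le b c -> @p a b \o @p b c = @p a c].

Definition pc_cone (H : topGroupoidType) (h : forall a, H -> GA a) : Prop :=
  (forall a, pc_morphism (h a)) /\
  forall a b, le a b -> @p a b \o h b = h a.

(* [q] exhibits [G] as the limit of the system in the category of topological *)
(* groupoids and proper continuous morphisms.                                 *)
Definition is_inverse_limit (q : forall a, G -> GA a) : Prop :=
  pc_cone q /\
  forall (H : topGroupoidType) (h : forall a, H -> GA a), pc_cone h ->
    exists! k : H -> G, pc_morphism k /\ forall a, q a \o k = h a.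

Definition inverse_approximation (q : forall a, G -> GA a) : Prop :=
  inverse_system /\ is_inverse_limit q.

End InverseApproximation.

Section Covers.
Variable T : Type.
Implicit Types U V : set (set T).

Definition is_cover U : Prop := \bigcup_(B in U) B = setT.

Definition star U (B : set T) : set T :=
  \bigcup_(B' in [set B' | U B' /\ B' `&` B !=set0]) B'.

Definition star_refines U V : Prop :=
  forall B, U B -> exists2 B', V B' & star U B `<=` B'.

Definition normal_sequence (U : nat -> set (set T)) : Prop :=
  (forall n, is_cover (U n)) /\ forall n, star_refines (U n.+1) (U n).

Definition cofinally_refines (V U : nat -> set (set T)) : Prop :=
  forall m, exists k, star_refines (V k) (U m).

End Covers.

(* The uniform covers of the uniformity based on all open covers. *)
Definition uniform_cover (T : topologicalType) (U : set (set T)) : Prop :=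
  is_cover U /\
  exists O : set (set T), [/\ forall B, O B -> open B, is_cover O &
    forall B, O B -> exists2 B', U B' & B `<=` B'].

Definition ball_preimages (R : realType) (G : Type) (M : metricType R)
    (q : G -> M) (n : nat) : set (set G) :=
  [set q @^-1` ball y (2^-1 ^+ n : R) | y in [set: M]].

Definition strong_approximation (R : realType) (G : topologicalType) (A : Type)
    (GA : A -> metricType R) (q : forall a, G -> GA a) : Prop :=
  forall W : nat -> nat -> set (set G),
    (forall l, normal_sequence (W l)) ->
    (forall l n, uniform_cover (W l n)) ->
    exists a, forall l, cofinally_refines (ball_preimages (q a)) (W l).

(* Main.v *)
Require Import Defs.
From HB Require Import structures.
From mathcomp Require Import all_boot all_order all_algebra.
From mathcomp Require Import all_classical all_reals all_analysis.
From mathcomp Require Import measurable_realfun complex ring lra.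

Set Implicit Arguments.
Unset Strict Implicit.
Unset Printing Implicit Defensive.

Import Order.TTheory GRing.Theory Num.Theory.
Import numFieldNormedType.Exports.

Local Open Scope classical_set_scope.
Local Open Scope ring_scope.

(** The index set consists of the continuous pseudometrics on [G], capped at
    [1], whose unit balls are relatively compact and whose null relation is
    compatible with the groupoid operations, with the Haar system and with the
    measures witnessing amenability.  Closing up countably often, every
    continuous pseudometric is dominated by such a one, so that the index set is
    countably directed for the inclusion of null relations.  The quotients by
    the null relations are metrisable groupoids, the push-forwards of the Haar
    measures are well defined on them because equivalent units give equal
    push-forwards, and their projective limit is [G].  A compactly supported
    function is constant on the classes of some pseudometric, hence descends.

    On norms, pulling back along a projection is contractive since
    representations of [Cc G] restrict.  Conversely, if all the quotient norms
    of a function [f] exceed [c], an ultraproduct of representations witnessing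
    this is a representation of [Cc G] in which [f] has norm at least [c].  Thus
    the norm of [f] is the infimum of its quotient norms, and by countable
    directedness a Cauchy sequence in [Cc G] is Cauchy already in one quotient. *)

(** * Covers, Urysohn functions and continuous pseudometrics *)

(** The obstacle is composability: arrows with composable classes need not be equivalent to
    composable arrows, so a compatible null relation alone does not give a groupoid. The Haar system
    repairs this. Equivalent units have measures that agree on saturated open sets, and each such
    measure has a whole source fibre as its support; hence an arrow starting at one unit is
    equivalent to an arrow starting at the other ([haar_lift]). Relative compactness of the unit
    balls makes the projections proper and closed, so that the metric topology of a quotient is its
    quotient topology and continuity can be checked on [G]. Indices are ordered by their null
    relations and not by size: this suffices for the connecting maps, while strength of the
    approximation comes from pointwise domination in [gidx_exists]. Saturated open sets are tested
    by integrals of functions, of which a countable family suffices because every continuous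
    pseudometric on a sigma-compact space is separable; this is why countably many rounds of closing
    up are enough. *)

(** The near-covering form of compactness is applied to the filter of finite sequences of points of
    [K], ordered by inclusion. The sets [U x] need only be neighbourhoods. *)
Lemma compact_seq_cover (T : topologicalType) (K : set T) (U : T -> set T) :
  compact K -> (forall x, K x -> nbhs x (U x)) ->
  exists2 s : seq T, (forall x, x \in s -> K x) &
    forall y, K y -> exists2 x, x \in s & U x y.
Proof.
move=> /compact_near_coveringP cK KU.
pose F : set_system (seq T) := filter_from
  [set s : seq T | forall x, x \in s -> K x]
  (fun s => [set t : seq T | (forall x, x \in t -> K x) /\ {subset s <= t}]).
have FF : Filter F.
  apply: filter_from_filter; first by exists [::].
  move=> s t sK tK; exists (s ++ t).
    by move=> x; rewrite mem_cat => /orP[/sK|/tK].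
  by move=> u [uK stu]; split; split => // x xs; apply: stu; rewrite mem_cat xs ?orbT.
have [x Kx|s sK sP] := cK _ F (fun s y => exists2 x, x \in s & U x y) FF.
  exists (U x, [set t : seq T | x \in t]) => /=; last by move=> [y t] [] /= ? ?; exists x.
  split; first exact: KU.
  exists [:: x]; first by move=> y; rewrite inE => /eqP ->.
  by move=> t [_]; apply; rewrite inE.
by exists s => // y Ky; apply: (sP s) => //; split.
Qed.

Section Urysohn_lc.
Variables (R : realType) (T : topologicalType).
Hypotheses (hT : hausdorff_space T) (lT : locally_compact [set: T]).

Lemma lc_nbhs_compact (x : T) : exists2 C, nbhs x C & compact C /\ closed C.
Proof.
have := lT; rewrite /locally_compact /locally_of => /(_ x I)[C xC cC]; exists C => //.
by apply: filterS (xC : nbhs x _) => y /(_ I).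
Qed.

Lemma compact_nbhs_compact (K : set T) : compact K ->
  exists2 C, compact C & K `<=` C°.
Proof.
move=> cK; pose U x := projT1 (cid2 (lc_nbhs_compact x)).
have UP x : nbhs x (U x) /\ compact (U x) by rewrite /U; case: cid2 => /= C ? [].
have [//|x _|s _ sP] := @compact_seq_cover _ K (fun x => (U x)°).
  by apply: nbhs_interior; case: (UP x).
exists (\big[setU/set0]_(x <- s) U x).
  by apply: bigsetU_compact => x _; case: (UP x).
move=> y /sP[x xs]; apply: filterS => z Uz.
by rewrite -bigcup_seq; exists x.
Qed.

Lemma urysohn_point (x : T) (U : set T) : nbhs x U ->
  exists f : T -> R, [/\ continuous f, forall y, 0 <= f y <= 1, f x = 1 &
    forall y, ~ U y -> f y = 0].
Proof.
rewrite nbhsE => -[V [oV Vx] VU].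
have /(@uniform_separatorP _ R)[f [cf f01 f0 f1]] :
    uniform_separator [set x] (~` V).
  apply: (@locally_compact_completely_regular T R lT hT); first exact: open_closedC.
  by move=> /(_ Vx).
exists (fun y => 1 - f y); split.
- by move=> y; apply: cvgB; [exact: cvg_cst|exact: cf].
- move=> y; have /f01 : range f (f y) by exists y.
  by rewrite /= in_itv /= => /andP[? ?]; rewrite subr_ge0 lerBlDr lerDl; apply/andP.
- have /= -> : [set 0] (f x) by apply: f0; exists x.
  by rewrite subr0.
- move=> y nU; have /= -> : [set 1] (f y) by apply: f1; exists y => // /VU.
  by rewrite subrr.
Qed.

(* [2 f] capped at [1] equals [1] on a neighbourhood of each point where      *)
(* [f = 1]; finitely many of these are combined by a maximum.                 *)
Lemma urysohn_compact (K U : set T) : compact K -> open U -> K `<=` U ->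
  exists f : T -> R, [/\ continuous f, forall y, 0 <= f y <= 1,
    forall y, K y -> f y = 1 & forall y, ~ U y -> f y = 0].
Proof.
move=> cK oU KU.
have /choice[f fP] (x : T) : exists f : T -> R, K x ->
    [/\ continuous f, forall y, 0 <= f y <= 1, f x = 1 &
    forall y, ~ U y -> f y = 0].
  have [Kx|nK] := pselect (K x); last by exists (fun=> 0).
  have [|f fP] := @urysohn_point x U; first by apply: open_nbhs_nbhs; split => //; exact: KU.
  by exists f.
have [//|x Kx|s sK sP] := @compact_seq_cover _ K (fun x => [set y | 1/2 < f x y]).
  have [cf _ fx _] := fP _ Kx; apply: (cvgr_gt _ (cf x)).
  by rewrite fx; lra.
have mx_cont : continuous (fun y => \big[Num.max/0]_(x <- s) f x y : R).
  move=> y; elim: s sK {sP} => [|x s IH] sK.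
    by under eq_fun do rewrite big_nil; exact: cvg_cst.
  rewrite (_ : (fun y => _) = (f x) \max (fun y => \big[Num.max/0]_(x <- s) f x y));
    last by apply/funext => z; rewrite big_cons.
  have [cf _ _ _] := fP x (sK _ (mem_head _ _)).
  apply: continuous_max; first exact: cf.
  by apply: IH => z zs; apply: sK; rewrite inE zs orbT.
have mx_ge (y x : T) : x \in s -> f x y <= \big[Num.max/0]_(x <- s) f x y.
  elim: s {sK sP mx_cont} => // z s IH; rewrite inE big_cons le_max => /predU1P[->|/IH ->].
    by rewrite lexx.
  by rewrite orbT.
have mx_0 y : ~ U y -> \big[Num.max/0]_(x <- s) f x y = 0.
  move=> nUy; elim: s sK {sP mx_cont mx_ge} => [|x s IH] sK; first by rewrite big_nil.
  have [_ _ _ /(_ _ nUy) f0] := fP x (sK _ (mem_head _ _)).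
  rewrite big_cons f0 IH ?maxxx// => z zs.
  by apply: sK; rewrite inE zs orbT.
have mx_ge0 y : 0 <= \big[Num.max/0]_(x <- s) f x y.
  by elim: (s) => [|x t IH]; rewrite ?big_nil// big_cons le_max IH orbT.
exists (fun y => Num.min 1 (2 * \big[Num.max/0]_(x <- s) f x y)); split.
- move=> y; apply: (@continuous_min R T (fun=> 1)); first exact: cst_continuous.
  by apply: cvgM; [exact: cvg_cst|exact: mx_cont].
- by move=> y; rewrite ge_min lexx le_min ler01 mulr_ge0.
- move=> y /sP[x xs /= fxy]; apply/min_idPl.
  by have := mx_ge y _ xs; lra.
- by move=> y /mx_0 ->; rewrite mulr0; apply/min_idPr; rewrite ler01.
Qed.

End Urysohn_lc.

Section Exhaustion.
Variables (T : topologicalType).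

Definition exhaustion (K : nat -> set T) : Prop :=
  [/\ forall n, compact (K n), forall n, K n `<=` (K n.+1)° &
      \bigcup_n K n = setT].

Lemma exhaustion_exists : locally_compact [set: T] -> sigma_compact T ->
  exists K, exhaustion K.
Proof.
move=> lT [C cC CT].
have /choice[f fP] (A : set T) : exists B : set T, compact A -> compact B /\ A `<=` B°.
  have [cA|nA] := pselect (compact A); last by exists set0.
  by have [B cB AB] := compact_nbhs_compact lT cA; exists B.
pose K := fix K n := if n is n'.+1 then f (K n' `|` C n) else C 0%N.
have cK n : compact (K n).
  elim: n => [|n IH] /=; first exact: cC.
  by have [] := fP (K n `|` C n.+1) (compactU IH (cC _)).
have Kf n : K n `|` C n.+1 `<=` (K n.+1)°.
  by have [] := fP (K n `|` C n.+1) (compactU (cK n) (cC _)).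
exists K; split => //.
  by move=> n x Kx; apply: Kf; left.
rewrite -subTset => x _; have [n _ Cx] : (\bigcup_n C n) x by rewrite CT.
case: n Cx => [|n] Cx; first by exists 0%N.
by exists n.+1 => //; apply: interior_subset; apply: Kf; right.
Qed.

Variables (K : nat -> set T) (eK : exhaustion K).

Lemma exhaustion_le m n : (m <= n)%N -> K m `<=` K n.
Proof.
case: eK => _ Ki _ /subnK <-; elim: (n - m)%N => [|k IH]; first exact: subset_refl.
by rewrite addSn; apply: (subset_trans IH) => x /Ki; exact: interior_subset.
Qed.

End Exhaustion.

(** * Capped pseudometrics, countable suprema and open covers *)

Section Pseudometrics.
Variables (R : realType) (T : topologicalType).
Implicit Types d : T -> T -> R.

(* Capping pseudometrics at [1] makes countable suprema exist.  In [cpm],     *)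
(* continuity is only required at the diagonal, which implies joint           *)
(* continuity.                                                                *)
Definition pm d : Prop :=
  [/\ forall x, d x x = 0, forall x y, d x y = d y x,
      forall x y z, d x z <= d x y + d y z & forall x y, d x y <= 1].

Definition cpm d : Prop :=
  pm d /\ forall x e, 0 < e -> \forall y \near x, d x y < e.

Lemma pm_ge0 d x y : pm d -> 0 <= d x y.
Proof.
case=> d0 ds dt _; have := dt x y x; rewrite d0 (ds y x); lra.
Qed.

Lemma cpm_cvg d : cpm d -> forall x, continuous (d x).
Proof.
move=> [[d0 ds dt d1] dc] x y; apply/cvgrPdist_lt => e e0.
apply: filterS (dc y e e0) => z; apply: le_lt_trans.
by rewrite ler_norml; have := dt x y z; have := dt x z y; rewrite (ds z y); lra.
Qed.

Lemma cpm_fun (f : T -> R) : continuous f ->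
  cpm (fun x y => Num.min 1 `|f x - f y|).
Proof.
move=> cf; split; last first.
  move=> x e e0; have /cvgrPdist_lt/(_ e e0) := cf x.
  by apply: filterS => y h; rewrite gt_min h orbT.
split.
- by move=> x; rewrite subrr normr0; apply/min_idPr; rewrite ler01.
- by move=> x y; rewrite distrC.
- move=> x y z.
  have [h1|h1] := leP 1 `|f x - f y|.
    by rewrite ge_min lerDl le_min ler01 normr_ge0.
  have [h2|h2] := leP 1 `|f y - f z|; first by rewrite ge_min lerDr normr_ge0.
  by rewrite ge_min [in X in _ || X](le_trans (ler_distD (f y) _ _))// orbT.
- by move=> x y; rewrite ge_min lexx.
Qed.

Lemma pm0 : cpm (fun _ _ => 0).
Proof.
by split; [split => // *; rewrite ?addr0 ?ler01|move=> x e e0; exact: nearW].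
Qed.

Lemma cpm_max d1 d2 : cpm d1 -> cpm d2 -> cpm (fun x y => Num.max (d1 x y) (d2 x y)).
Proof.
move=> [[a1 b1 c1 e1] f1] [[a2 b2 c2 e2] f2]; split; last first.
  move=> x e e0; near=> y; rewrite gt_max; apply/andP; split.
    by near: y; exact: f1.
  by near: y; exact: f2.
split.
- by move=> x; rewrite a1 a2 maxxx.
- by move=> x y; rewrite b1 b2.
- move=> x y z; rewrite ge_max; apply/andP; split.
    by rewrite (le_trans (c1 x y z))// lerD// le_max lexx.
  by rewrite (le_trans (c2 x y z))// lerD// le_max lexx orbT.
- by move=> x y; rewrite ge_max e1 e2.
Unshelve. all: by end_near. Qed.

Lemma cpm_bigmax (I : eqType) (s : seq I) (D : I -> T -> T -> R) :
  (forall x, x \in s -> cpm (D x)) ->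
  cpm (fun y z => \big[Num.max/0]_(x <- s) D x y z).
Proof.
elim: s => [|x s IH] sP.
  by under eq_fun do (under eq_fun do rewrite big_nil); exact: pm0.
under eq_fun do (under eq_fun do rewrite big_cons).
apply: cpm_max; first by apply: sP; rewrite inE eqxx.
by apply: IH => y ys; apply: sP; rewrite inE ys orbT.
Qed.

Lemma bigmax_ge_seq (I : eqType) (s : seq I) (F : I -> R) (i : I) : i \in s ->
  F i <= \big[Num.max/0]_(x <- s) F x.
Proof.
elim: s => // z s IH; rewrite inE big_cons le_max => /predU1P[->|/IH ->].
  by rewrite lexx.
by rewrite orbT.
Qed.

Lemma cpm_comp d (g : T -> T) : cpm d -> continuous g -> cpm (fun x y => d (g x) (g y)).
Proof.
move=> [[d0 ds dt d1] dc] cg; split; first by split => // x y z; exact: dt.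
by move=> x e e0; exact: (cg x _ (dc (g x) e e0)).
Qed.

Section Sup.
Variable D : nat -> T -> T -> R.
Hypothesis pmD : forall k, pm (D k).

Definition pmsup x y := sup [set D k x y | k in [set: nat]].

Lemma pmsup_ge k x y : D k x y <= pmsup x y.
Proof.
apply: ub_le_sup; last by exists k.
by exists 1 => _ [j _ <-]; case: (pmD j) => _ _ _.
Qed.

Lemma pmsup_le x y (b : R) : (forall k, D k x y <= b) -> pmsup x y <= b.
Proof.
move=> h; apply: ge_sup; first by exists (D 0%N x y), 0%N.
by move=> _ [k _ <-].
Qed.

Lemma pmsup_pm : pm pmsup.
Proof.
split.
- move=> x; apply/eqP; rewrite eq_le; apply/andP; split.
    by apply: pmsup_le => k; case: (pmD k) => ->.
  by apply: le_trans (pmsup_ge 0%N x x); case: (pmD 0%N) => ->.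
- move=> x y; rewrite /pmsup; congr sup; apply/seteqP.
  by split => _ [k _ <-]; exists k => //; case: (pmD k).
- move=> x y z; apply: pmsup_le => k; case: (pmD k) => _ _ /(_ x y z) h _.
  by apply: (le_trans h); apply: lerD; exact: pmsup_ge.
- by move=> x y; apply: pmsup_le => k; case: (pmD k).
Qed.

End Sup.

(** The weights make the supremum continuous: all terms are capped at 1, so those with large [k] are
    uniformly small. They do not change the common null relation. *)
Definition csup (D : nat -> T -> T -> R) := pmsup (fun k x y => 2^-1 ^+ k * D k x y).

Section Csup.
Variable D : nat -> T -> T -> R.
Hypothesis cD : forall k, cpm (D k).

Let pw k : 0 < 2^-1 ^+ k :> R. Proof. by rewrite exprn_gt0// invr_gt0. Qed.

Let pw1 k : 2^-1 ^+ k <= 1 :> R.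
Proof. by apply: exprn_ile1; lra. Qed.

Let pmk k : pm (fun x y => 2^-1 ^+ k * D k x y).
Proof.
have [[d0 ds dt d1] _] := cD k; split.
- by move=> x; rewrite d0 mulr0.
- by move=> x y; rewrite ds.
- by move=> x y z; rewrite -mulrDr ler_pM2l.
- move=> x y; apply: mulr_ile1; rewrite ?(ltW (pw k))//.
  by apply: pm_ge0; case: (cD k).
Qed.

Lemma csup_ge k x y : D k x y <= 2 ^+ k * csup D x y.
Proof.
rewrite -ler_pdivrMl ?exprn_gt0// -exprVn.
exact: (pmsup_ge pmk).
Qed.

Lemma csup_eq0 k x y : csup D x y = 0 -> D k x y = 0.
Proof.
move=> h; apply/eqP; rewrite eq_le pm_ge0 ?andbT; last by case: (cD k).
by apply: (le_trans (csup_ge k x y)); rewrite h mulr0.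
Qed.

Lemma csup_cpm : cpm (csup D).
Proof.
split; first exact: pmsup_pm.
move=> x e e0.
have [N NP] : exists N, 2^-1 ^+ N < e / 2.
  have : (fun n => 2^-1 ^+ n : R) @ \oo --> 0.
    by apply: cvg_expr; rewrite ger0_norm ?invr_ge0// invf_lt1// ltr1n.
  move=> /cvgrPdist_lt/(_ (e / 2)) []; first by rewrite divr_gt0.
  move=> N _ /(_ N (leqnn N)); rewrite sub0r normrN ger0_norm ?(ltW (pw _))//.
  by exists N.
have : \forall y \near x, forall k, (k < N)%N -> D k x y < e / 2.
  elim: N {NP} => [|N IH]; first exact: nearW.
  have [_ /(_ x (e / 2))] := cD N; rewrite divr_gt0// => /(_ isT) DN.
  near=> y => k; rewrite ltnS leq_eqVlt => /predU1P[->|kN].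
    by near: y.
  by move: k kN; near: y.
apply: filterS => y h; apply: (@le_lt_trans _ _ (e / 2)); last by lra.
apply: pmsup_le => // k; have dk0 : 0 <= D k x y by apply: pm_ge0; case: (cD k).
have [kN|Nk] := ltnP k N.
  by apply: le_trans (ltW (h _ kN)); rewrite ler_piMl.
have [[_ _ _ d1] _] := cD k.
apply: (@le_trans _ _ (2^-1 ^+ k)); first by rewrite ler_piMr// ltW.
apply/ltW/le_lt_trans/NP; by apply: ler_wiXn2l => //; lra.
Unshelve. all: by end_near. Qed.

End Csup.

(** Finitely many bump functions per layer of the exhaustion suffice, each vanishing outside a
    member of [O]. Damping those of level [n] to 0 on [L n] makes the unweighted supremum locally
    finite, hence continuous. *)
Lemma cover_cpm (O : set (set T)) (K : nat -> set T) :
  hausdorff_space T -> locally_compact [set: T] -> exhaustion K ->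
  (forall B, O B -> open B) -> is_cover O ->
  exists2 d, cpm d & forall x, exists2 B, O B & [set y | d x y < 1] `<=` B.
Proof.
move=> hT lT eK oO cO.
(* With two empty layers in front, the first layer containing a point has the form [L n.+2], and
   level [n] is undamped there. *)
pose L n := if n is n'.+2 then K n' else set0.
have cL n : compact (L n).
  case: n => [|[|n]]; [exact: compact0|exact: compact0|].
  by case: eK => h _ _; exact: h.
have LS n : L n `<=` (L n.+1)°.
  case: n => [|[|n]]; [exact: sub0set|exact: sub0set|].
  by case: eK => _ h _; exact: h.
have Lle m n : (m <= n)%N -> L m `<=` L n.
  move=> /subnK <-; elim: (n - m)%N => [|k IH]; first exact: subset_refl.
  by rewrite addSn; apply: (subset_trans IH) => x /LS; exact: interior_subset.
have Lx x : exists2 n, L n.+2 x & ~ L n.+1 x.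
  have : exists n, `[< L n x >].
    have [n _ Kx] : (\bigcup_n K n) x by case: eK => _ _ ->.
    by exists n.+2; apply/asboolP.
  move=> h; case: (ex_minnP h) => -[|[|n]] /asboolP //= Kx hm.
  by exists n => // Ln1; have := hm n.+1; rewrite ltnn => /(_ (asboolT Ln1)).
have /choice[psi psiP] n : exists f : T -> R, [/\ continuous f, forall y, 0 <= f y <= 1,
    forall y, L n y -> f y = 1 & forall y, ~ (L n.+1)° y -> f y = 0].
  by apply: urysohn_compact => //; exact: open_interior.
have /choice[B BP] x : exists B, O B /\ B x.
  by have [B ? ?] : (\bigcup_(B in O) B) x by [rewrite cO]; exists B.
have /choice[g gP] x : exists f : T -> R, [/\ continuous f, forall y, 0 <= f y <= 1, f x = 1 &
    forall y, ~ B x y -> f y = 0].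
  by apply: urysohn_point => //; apply: open_nbhs_nbhs; have [? ?] := BP x; split => //; exact: oO.
(* The first factor is 0 on [L n] and 1 outside the interior of [L n.+1]; the second reaches 1 as
   soon as [g x y] exceeds 1/2. *)
pose F n x y : R := (1 - psi n y) * Num.min 1 (2 * g x y).
have cF n x : continuous (F n x).
  move=> y; apply: cvgM.
    by apply: cvgB; [exact: cvg_cst|have [h _ _ _] := psiP n; exact: h].
  apply: (@continuous_min R T (fun=> 1)); first exact: cst_continuous.
  by apply: cvgM; [exact: cvg_cst|have [h _ _ _] := gP x; exact: h].
have /choice[s sP] n : exists s : seq T,
    forall y, L n y -> exists2 x, x \in s & 1/2 < g x y.
  have [//|x _|s _ sP] := @compact_seq_cover _ (L n) (fun x => [set y | 1/2 < g x y]).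
    by have [cg _ gx _] := gP x; apply: (cvgr_gt _ (cg x)); rewrite gx; lra.
  by exists s.
pose D n y z := \big[Num.max/0]_(x <- s n.+2) Num.min 1 `|F n x y - F n x z|.
have cD n : cpm (D n) by apply: cpm_bigmax => x _; exact: cpm_fun.
have pD n : pm (D n) by case: (cD n).
have F0 n x y : L n y -> F n x y = 0.
  by move=> Ly; rewrite /F; have [_ _ -> // _] := psiP n; rewrite subrr mul0r.
have D0 n y z : L n y -> L n z -> D n y z = 0.
  move=> Ly Lz; rewrite /D (eq_bigr (fun=> 0)) => [|x _].
    by elim: (s _) => [|a t IH]; rewrite ?big_nil// big_cons IH maxxx.
  by rewrite !F0// subrr normr0; apply/min_idPr; exact: ler01.
(* Near a point of [L n.+2] all levels from [n.+3] on vanish, so only finitely many terms matter. *)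
exists (pmsup D).
  split; first exact: pmsup_pm.
  move=> x e e0; have [n Ln _] := Lx x.
  have : \forall y \near x, forall k, (k < n.+3)%N -> D k x y < e / 2.
    elim: n.+3 => [|N IH]; first exact: nearW.
    have [_ /(_ x (e / 2))] := cD N; rewrite divr_gt0// => /(_ isT) DN.
    near=> y => k; rewrite ltnS leq_eqVlt => /predU1P[->|kN].
      by near: y.
    by move: k kN; near: y.
  move=> h; near=> y; apply: (@le_lt_trans _ _ (e / 2)); last by lra.
  apply: pmsup_le => // k; have [kn|nk] := ltnP k n.+3.
    by apply: ltW; move: k kn; near: y.
  rewrite D0//; [lra|exact: (Lle n.+2 k (ltnW nk))|].
  apply: (Lle n.+3 k nk); near: y.
  by move/LS: Ln.
move=> x; have [n Ln Ln1] := Lx x.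
have [z zs gz] := sP n.+2 x Ln.
(* Leaving [B z] makes [F n z] drop from 1 to 0, which costs a distance of at least 1. *)
exists (B z); first by case: (BP z).
move=> y /= dxy; apply: contrapT => nBy.
have [_ _ _ g0] := gP z.
have Fy : F n z y = 0.
  by rewrite /F g0// mulr0 (_ : Num.min 1 0 = 0) ?mulr0//; apply/min_idPr; exact: ler01.
have Fx : F n z x = 1.
  rewrite /F; have [_ _ _ ->] := psiP n; last first.
    by move=> /interior_subset.
  by rewrite subr0 mul1r; apply/min_idPl; lra.
suff : 1 <= pmsup D x y by rewrite leNgt dxy.
apply: le_trans (pmsup_ge pD n x y).
apply: le_trans (bigmax_ge_seq _ zs).
by rewrite Fx Fy subr0 normr1 minxx.
Unshelve. all: by end_near. Qed.

Definition pm_proper d : Prop :=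
  forall x, exists2 L : set T, compact L & forall y, d x y < 1 -> L y.

Lemma pm_proper_le d d' : pm_proper d -> (forall x y, d x y <= d' x y) -> pm_proper d'.
Proof.
move=> dP dd' x; have [L cL LP] := dP x; exists L => // y h.
by apply: LP; exact: le_lt_trans h.
Qed.

(** Tube lemma for the null class of [x]: on the part of the compact set around the unit ball that
    lies outside [U], the distance to [x] is positive, hence bounded below. *)
Lemma fibre_open_ball d (U : set T) x : cpm d -> pm_proper d -> open U ->
  (forall y, d x y = 0 -> U y) ->
  exists2 e, 0 < e & forall y, d x y < e -> U y.
Proof.
move=> cd pd oU sU; have [[d0 ds dt d1] dc] := cd.
have [L cL LP] := pd x.
have cLU : compact (L `&` ~` U) by apply: compact_closedI => //; exact: open_closedC.
have dpos y : ~ U y -> 0 < d x y.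
  move=> nUy; rewrite lt_neqAle pm_ge0 ?andbT; last by case: cd.
  by apply/eqP => /esym /sU.
have [y [Ly nUy]|s sL sP] := compact_seq_cover cLU (U := fun y => [set z | d x y / 2 < d x z]).
  have /cvgr_gt h := @cpm_cvg d cd x y; apply: h.
  by have := dpos y nUy; lra.
have [e e0 eP] : exists2 e, 0 < e & forall y, y \in s -> e <= d x y / 2.
  elim: s sL {sP} => [|z s IH] sL; first by exists 1.
  have [|e e0 eP] := IH; first by move=> y ys; apply: sL; rewrite inE ys orbT.
  exists (Num.min e (d x z / 2)).
    by rewrite lt_min e0 divr_gt0// dpos//; case: (sL z (mem_head _ _)).
  move=> y; rewrite inE => /predU1P[->|ys]; rewrite ge_min ?lexx ?orbT// eP//.
exists (Num.min 1 e); first by rewrite lt_min ltr01.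
move=> y; rewrite lt_min => /andP[/LP Ly ye]; apply: contrapT => nUy.
have [z zs /= dz] := sP y (conj Ly nUy).
by have := eP z zs; lra.
Qed.

End Pseudometrics.

(** * Complex-valued functions *)

Section Complex.
Variable R : realType.
Implicit Types z w : R[i].
Local Notation normc := (@Normc.normc R).
Local Open Scope complex_scope.

Lemma normcR z : `|z| = (normc z)%:C.
Proof. by rewrite normc_def; case: z. Qed.

Lemma normc_ge0 z : 0 <= normc z.
Proof. by case: z => a b; exact: sqrtr_ge0. Qed.

Lemma normc_real (r : R) : normc r%:C = `|r|.
Proof. by rewrite /= expr0n addr0 sqrtr_sqr. Qed.

Lemma normc_Re z : `|complex.Re z| <= normc z.
Proof. by rewrite -lecR -normcR; exact: normc_ge_Re. Qed.

Lemma normc_Im z : `|complex.Im z| <= normc z.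
Proof.
by case: z => a b /=; rewrite -sqrtr_sqr ler_wsqrtr// lerDr sqr_ge0.
Qed.

Lemma normc_le z : normc z <= `|complex.Re z| + `|complex.Im z|.
Proof.
case: z => a b /=; rewrite -[leRHS]ger0_norm ?addr_ge0// -sqrtr_sqr.
rewrite ler_wsqrtr// sqrrD !real_normK ?num_real//.
by rewrite lerD2r lerDl mulrn_wge0// mulr_ge0.
Qed.

Lemma normc_conj z : normc (Num.conj z) = normc z.
Proof. by case: z => a b /=; rewrite sqrrN. Qed.

Lemma Rec_conj z : complex.Re (Num.conj z) = complex.Re z.
Proof. by case: z. Qed.

Lemma Imc_conj z : complex.Im (Num.conj z) = - complex.Im z.
Proof. by case: z. Qed.

Lemma Re_add z w : complex.Re (z + w) = complex.Re z + complex.Re w.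
Proof. by case: z w => ? ? []. Qed.

Lemma Im_add z w : complex.Im (z + w) = complex.Im z + complex.Im w.
Proof. by case: z w => ? ? []. Qed.

Lemma Re_opp z : complex.Re (- z) = - complex.Re z.
Proof. by case: z. Qed.

Lemma Im_opp z : complex.Im (- z) = - complex.Im z.
Proof. by case: z. Qed.

Lemma Re_mul z w : complex.Re (z * w) =
  complex.Re z * complex.Re w - complex.Im z * complex.Im w.
Proof. by case: z w => ? ? []. Qed.

Lemma Im_mul z w : complex.Im (z * w) =
  complex.Re z * complex.Im w + complex.Im z * complex.Re w.
Proof. by case: z w => ? ? []. Qed.

Lemma complex_eqP z w :
  complex.Re z = complex.Re w -> complex.Im z = complex.Im w -> z = w.
Proof. by case: z w => ? ? [? ?] /= -> ->. Qed.

Lemma normc_eq0 z : (normc z == 0) = (z == 0).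
Proof.
by apply/eqP/eqP => [/Normc.eq0_normc|->] //; rewrite Normc.normc0.
Qed.

Lemma cvgC_normP (T : Type) (F : set_system T) (f : T -> R[i]) (l : R[i]) :
  Filter F ->
  (f @ F --> (l : R[i]^o)) <->
  (forall e : R, 0 < e -> \forall x \near F, normc (f x - l) < e).
Proof.
move=> FF; split=> [/(iffLR (@cvgrPdist_lt R[i] R[i]^o T F FF f l)) h e e0|h].
  have : 0 < e%:C by rewrite ltcR.
  move=> /h; apply: filterS => x; rewrite distrC normcR ltcR//.
apply/(@cvgrPdist_lt R[i] R[i]^o T F FF f l) => e; rewrite ltcE /= => /andP[/eqP ie re].
apply: filterS (h _ re) => x; rewrite distrC normcR ltcE /= => ->.
by rewrite ie eqxx.
Qed.

Lemma cvgC_Re (T : Type) (F : set_system T) (f : T -> R[i]) (l : R[i]) :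
  Filter F -> f @ F --> (l : R[i]^o) ->
  (fun x => complex.Re (f x)) @ F --> complex.Re l.
Proof.
move=> FF /cvgC_normP h; apply/cvgrPdist_lt => e e0.
apply: filterS (h _ e0) => x; apply: le_lt_trans.
by rewrite distrC -Re_opp -Re_add normc_Re.
Qed.

Lemma cvgC_Im (T : Type) (F : set_system T) (f : T -> R[i]) (l : R[i]) :
  Filter F -> f @ F --> (l : R[i]^o) ->
  (fun x => complex.Im (f x)) @ F --> complex.Im l.
Proof.
move=> FF /cvgC_normP h; apply/cvgrPdist_lt => e e0.
apply: filterS (h _ e0) => x; apply: le_lt_trans.
by rewrite distrC -Im_opp -Im_add normc_Im.
Qed.

Lemma cvgC_ReIm (T : Type) (F : set_system T) (f : T -> R[i]) (l : R[i]) :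
  Filter F -> (fun x => complex.Re (f x)) @ F --> complex.Re l ->
  (fun x => complex.Im (f x)) @ F --> complex.Im l ->
  f @ F --> (l : R[i]^o).
Proof.
move=> FF /cvgrPdist_lt hr /cvgrPdist_lt hi; apply/cvgC_normP => e e0.
have e2 : 0 < e / 2 by rewrite divr_gt0.
near=> x; apply: le_lt_trans (normc_le _) _.
rewrite Re_add Im_add Re_opp Im_opp [e]splitr distrC (distrC (complex.Im _)).
by apply: ltrD; near: x; [exact: hr|exact: hi].
Unshelve. all: by end_near. Qed.

Lemma continuousC_comp (T : topologicalType) (f : T -> R[i]) :
  continuous (f : T -> R[i]^o) <->
  continuous (fun x => complex.Re (f x)) /\ continuous (fun x => complex.Im (f x)).
Proof.
split=> [cf|[cr ci] x]; last by apply: cvgC_ReIm; [exact: cr|exact: ci].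
by split=> x; [apply: cvgC_Re|apply: cvgC_Im]; exact: cf.
Qed.

Lemma continuous_normc (T : topologicalType) (f : T -> R[i]) :
  continuous (f : T -> R[i]^o) -> continuous (fun x => normc (f x)).
Proof.
move=> cf x; have /cvgC_normP h := cf x; apply/cvgrPdist_lt => e e0.
apply: filterS (h _ e0) => y; apply: le_lt_trans.
have h1 : normc (f y) <= normc (f y - f x) + normc (f x).
  by rewrite -{1}(subrK (f x) (f y)) le_normcD.
have h2 : normc (f x) <= normc (f y - f x) + normc (f y).
  by rewrite -(normcN (f y - f x)) opprB -{1}(subrK (f y) (f x)) le_normcD.
by rewrite ler_norml; lra.
Qed.

End Complex.

(** * Borel measurability and compactly supported functions *)

Section BorelFun.
Variables (R : realType) (T : ptopologicalType).
Implicit Types (D U K : set T) (f : T -> R).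

Lemma open_borel U : open U -> measurable (U : set (borel T)).
Proof. exact: sub_sigma_algebra. Qed.

Lemma closed_borel D : closed D -> measurable (D : set (borel T)).
Proof.
by move=> cD; rewrite -(setCK D); apply: measurableC; apply: open_borel; exact: closed_openC.
Qed.

Lemma within_cont_borel D f : measurable (D : set (borel T)) ->
  {within D, continuous f} -> measurable_fun (D : set (borel T)) f.
Proof.
move=> mD /continuousP cf; apply: (measurability _ (RGenOpens.measurableE R)).
move=> _ [_ [a [b ->] <-]].
have oab : open `]a, b[%classic by exact: interval_open.
have /open_subspaceP[V oV VP] := cf _ oab.
by rewrite setIC -VP; apply: measurableI => //; exact: open_borel.
Qed.

Lemma cont_borel D f : measurable (D : set (borel T)) -> continuous f ->
  measurable_fun (D : set (borel T)) f.
Proof. by move=> mD cf; apply: within_cont_borel => //; exact: continuous_subspaceT. Qed.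

End BorelFun.

Section ContinuousMap.
Variables (S T : ptopologicalType).

Lemma cont_map_borel (D : set S) (q : S -> T) : measurable (D : set (borel S)) ->
  {within D, continuous q} ->
  measurable_fun (D : set (borel S)) (q : borel S -> borel T).
Proof.
move=> mD /continuousP cq; apply: (@measurability _ _ (borel S) (borel T) D q (@open T) erefl).
move=> _ [V oV <-]; have /open_subspaceP[W oW WP] := cq _ oV.
by rewrite setIC -WP; apply: measurableI => //; exact: open_borel.
Qed.

End ContinuousMap.

Section CompactSupport.
Variables (R : realType) (T : ptopologicalType).
Hypothesis hT : hausdorff_space T.
Local Open Scope complex_scope.

(** In a Hausdorff space this amounts to compactness of the support, in a form that pulls back
    directly along proper maps and serves real and complex values alike. *)
Definition vanish (V : zmodType) (f : T -> V) : Prop :=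
  exists2 K : set T, compact K & forall x, ~ K x -> f x = 0.

Lemma CcP (f : T -> R[i]) :
  Cc f <-> continuous (f : T -> R[i]^o) /\ vanish f.
Proof.
split=> [[cf cK]|[cf [K cK fK]]]; split => //.
  exists (closure [set x | f x != 0]) => // x nx; apply/eqP; apply: contrapT.
  by move=> /negP fx; apply: nx; exact: subset_closure.
apply: (subclosed_compact _ cK); first exact: closed_closure.
have /closure_id -> : closed K by exact: compact_closed.
by apply: closureS => x /= /eqP fx; apply: contrapT => /fK.
Qed.

Definition Crc : set (T -> R) := [set f | continuous f /\ vanish f].

Lemma Cc_normc (f : T -> R[i]) : Cc f -> Crc (fun x => Normc.normc (f x)).
Proof.
move=> /CcP[cf [K cK fK]]; split; first exact: continuous_normc.
by exists K => // x /fK ->; rewrite Normc.normc0.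
Qed.

Lemma Crc_Cc (f : T -> R) : Crc f -> Cc (fun x => (f x)%:C : R[i]).
Proof.
move=> [cf [K cK fK]]; apply/CcP; split; last by exists K => // x /fK ->.
by apply/continuousC_comp; split => //=; exact: cst_continuous.
Qed.

Lemma Crc_bounded f : Crc f -> exists2 M : R, 0 <= M & forall x, `|f x| <= M.
Proof.
move=> [cf [K cK fK]].
have [//|x _|s _ sP] := @compact_seq_cover T K (fun x => [set y | `|f y| < `|f x| + 1]).
  have cn : continuous (fun y => `|f y|) by move=> y; apply: cvg_norm; exact: cf.
  by apply: (cvgr_lt _ (cn x)); rewrite ltrDl.
exists (\big[Num.max/0]_(x <- s) (`|f x| + 1)) => [|x].
  by elim: (s) => [|a t IH]; rewrite ?big_nil// big_cons le_max IH orbT.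
have [Kx|/fK ->] := pselect (K x); last first.
  by rewrite normr0; elim: (s) => [|a t IH]; rewrite ?big_nil// big_cons le_max IH orbT.
have [y ys h] := sP x Kx; apply: (le_trans (ltW h)).
exact: (bigmax_ge_seq (fun x => `|f x| + 1) ys).
Qed.

Lemma Cc_lin (f g : T -> R[i]) (a : R[i]) : Cc f -> Cc g -> Cc (a *: f + g).
Proof.
move=> /CcP[cf [K cK fK]] /CcP[cg [L cL gL]]; apply/CcP; split.
  move=> x; apply: (@cvgD R[i] R[i]^o); last exact: cg.
  by apply: (@cvgZl_tmp R[i] R[i]^o); exact: cf.
exists (K `|` L); first exact: compactU.
by move=> x /not_orP[nK nL]; rewrite !fctE fK// gL// scaler0 addr0.
Qed.

Lemma Cc0 : Cc (0 : T -> R[i]).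
Proof.
apply/CcP; split; first by move=> x; exact: (@cvg_cst R[i]^o).
by exists set0; first exact: compact0.
Qed.

Lemma CcB (f g : T -> R[i]) : Cc f -> Cc g -> Cc (f - g).
Proof.
by move=> cf cg; have := Cc_lin (-1) cg cf; rewrite scaleN1r addrC.
Qed.

Variable m : {measure set (borel T) -> \bar R}.
Hypothesis mK : forall K : set T, compact K -> (m K < +oo)%E.

Lemma bounded_vanish_integrable (D : set T) (f : T -> R) (M : R) :
  measurable (D : set (borel T)) ->
  measurable_fun (D : set (borel T)) f ->
  (exists2 K : set T, compact K & forall x, D x -> ~ K x -> f x = 0) -> 0 <= M ->
  (forall x, D x -> `|f x| <= M) -> m.-integrable D (EFin \o f).
Proof.
move=> mD mf [K cK fK] M0 fM.
have mKs : measurable (K : set (borel T)) by apply: closed_borel; exact: compact_closed.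
apply/integrableP; split; first exact/measurable_EFinP.
apply: (@le_lt_trans _ _ (\int[m]_(x in D) (M%:E * (\1_K x)%:E))%E).
  apply: ge0_le_integral => //=.
  - by apply/measurable_EFinP; apply: measurableT_comp.
  - apply: emeasurable_funM => //; apply/measurable_EFinP.
    exact: measurable_indic.
  - move=> x Dx; rewrite -EFinM lee_fin indicE.
    have [Kx|nKx] := boolP (x \in K); first by rewrite mulr1 fM.
    by rewrite fK ?normr0 ?mulr0//; move/negP: nKx; rewrite inE.
rewrite ge0_integralZl//=.
- rewrite integral_indic//; apply: lte_mul_pinfty => //.
  apply: (@le_lt_trans _ _ (m K)); last exact: mK.
  by apply: le_measure; rewrite ?inE//; exact: measurableI.
- by apply/measurable_EFinP; exact: measurable_indic.
Qed.

Lemma Crc_integrable (D : set T) (f : T -> R) : measurable (D : set (borel T)) ->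
  Crc f -> m.-integrable D (EFin \o f).
Proof.
move=> mD cf; have [M M0 fM] := Crc_bounded cf; have [cf' [K cK fK]] := cf.
by apply: (@bounded_vanish_integrable D f M) => //; [exact: cont_borel|exists K => // x _ /fK].
Qed.

(** Test functions lying between two indicators turn equalities of integrals into inequalities of
    measures; this is how invariance passes from functions to sets. *)
Lemma Rintegral_squeeze (D L V : set T) (f : T -> R) :
  measurable (D : set (borel T)) -> measurable (L : set (borel T)) ->
  measurable (V : set (borel T)) -> m.-integrable D (EFin \o f) ->
  (forall x, D x -> 0 <= f x <= 1) -> (forall x, D x -> L x -> f x = 1) ->
  (forall x, D x -> ~ V x -> f x = 0) ->
  (m (L `&` D) <= (Rintegral m D f)%:E <= m (V `&` D))%E.
Proof.
move=> mD mL mV fi f01 fL fV.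
have iE : ((Rintegral m D f)%:E = \int[m]_(x in D) (f x)%:E)%E.
  by rewrite /Rintegral fineK//; exact: integrable_fin_num.
have mf : measurable_fun (D : set (borel T)) f.
  by apply/measurable_EFinP; case/integrableP : fi.
rewrite iE; apply/andP; split.
  rewrite -integral_indic//; apply: ge0_le_integral => //=.
  - by apply/measurable_EFinP; exact: measurable_indic.
  - exact/measurable_EFinP.
  - move=> x Dx; rewrite lee_fin indicE.
    have [Lx|nLx] := boolP (x \in L); last by case/andP: (f01 x Dx).
    by rewrite fL//; exact: set_mem.
rewrite -integral_indic//; apply: ge0_le_integral => //=.
- by move=> x Dx; rewrite lee_fin; case/andP: (f01 x Dx).
- exact/measurable_EFinP.
- by apply/measurable_EFinP; exact: measurable_indic.
- move=> x Dx; rewrite lee_fin indicE.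
  have [Vx|nVx] := boolP (x \in V); first by case/andP: (f01 x Dx).
  by rewrite fV//; move/negP: nVx; rewrite inE.
Qed.

Lemma Crc_squeeze (f : T -> R) (K U : set T) : Crc f ->
  (forall x, 0 <= f x <= 1) -> compact K -> open U ->
  (forall x, K x -> f x = 1) -> (forall x, ~ U x -> f x = 0) ->
  (m K <= (Rintegral m setT f)%:E <= m U)%E.
Proof.
move=> cf f01 cK oU fK fU; rewrite -(setIT K) -(setIT U).
apply: Rintegral_squeeze => //.
- by apply: closed_borel; exact: compact_closed.
- exact: open_borel.
- exact: Crc_integrable.
- by move=> x _ /fK.
- by move=> x _ /fU.
Qed.

End CompactSupport.

(** * Topology of groupoids *)

Section GroupoidTopology.
Variable G : ptopGroupoidType.
Hypothesis hG : hausdorff_space G.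

Definition composable : set (G * G) := [set p | gsrc p.1 = grng p.2].

Lemma mul_cvg (p : G * G) : composable p ->
  (fun p => gmul p.1 p.2) @ within composable (nbhs p) --> gmul p.1 p.2.
Proof. by move=> cp; apply: (iffLR (subspace_continuousP _ _) (@gmul_continuous G)). Qed.

Lemma mul_cvg_comp (T : topologicalType) (f g : T -> G) (x : T) :
  {for x, continuous f} -> {for x, continuous g} ->
  (forall y, gsrc (f y) = grng (g y)) ->
  {for x, continuous (fun y => gmul (f y) (g y))}.
Proof.
move=> cf cg fg; rewrite /prop_for /continuous_at.
apply: (@cvg_trans _ ((fun p => gmul p.1 p.2) @ within composable (nbhs (f x, g x)))).
  move=> A /= hA; have h : nbhs (f x, g x) [set p | composable p -> A (gmul p.1 p.2)] := hA.
  have cfg : (fun y => (f y, g y)) @ x --> (f x, g x) by apply: cvg_pair.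
  have h2 : \forall y \near x, composable (f y, g y) -> A (gmul (f y) (g y)) := cfg _ h.
  by apply: filterS h2 => y hy; apply: hy; exact: fg.
exact: (@mul_cvg (f x, g x) (fg x)).
Qed.

Lemma gsrc_continuous : continuous (@gsrc G).
Proof.
have -> : @gsrc G = (fun a => gmul (ginv a) a) by apply/funext => a; rewrite gmulVl.
by move=> a; apply: mul_cvg_comp; [exact: ginv_continuous|exact: cvg_id|exact: gsrc_inv].
Qed.

Lemma grng_continuous : continuous (@grng G).
Proof.
have -> : @grng G = (fun a => gmul a (ginv a)) by apply/funext => a; rewrite gmulV.
move=> a; apply: mul_cvg_comp; [exact: cvg_id|exact: ginv_continuous|].
by move=> y; rewrite grng_inv.
Qed.

Lemma closed_eq_fun (T : topologicalType) (f g : T -> G) :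
  continuous f -> continuous g -> closed [set x | f x = g x].
Proof.
move=> cf cg x clx; apply: hG => A B nA nB.
have [] := clx (f @^-1` A `&` g @^-1` B).
  by apply: filterI; [exact: cf|exact: cg].
by move=> y /= [fgy [Ay By]]; exists (f y); split => //; rewrite fgy.
Qed.

Lemma composable_closed : closed composable.
Proof.
apply: (@closed_eq_fun (G * G)%type (fun p => gsrc p.1) (fun p => grng p.2)) => x.
  by apply: continuous_comp; [exact: cvg_fst|exact: gsrc_continuous].
by apply: continuous_comp; [exact: cvg_snd|exact: grng_continuous].
Qed.

Lemma units_closed : closed (@units G).
Proof. by apply: closed_eq_fun; [exact: gsrc_continuous|move=> x; exact: cvg_id]. Qed.

Lemma gfiber_closed (x : G) : closed (gfiber x).
Proof. by apply: closed_eq_fun; [exact: gsrc_continuous|move=> y; exact: cvg_cst]. Qed.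

Lemma units_src (a : G) : units (gsrc a).
Proof. exact: gsrc_src. Qed.

Lemma units_rng (a : G) : units (grng a).
Proof. exact: gsrc_rng. Qed.

Lemma ginvK (a : G) : ginv (ginv a) = a.
Proof.
rewrite -[LHS]gmul_src gsrc_inv grng_inv -gmulVl gmulA ?gsrc_inv ?grng_inv//.
by rewrite gmulVl gsrc_inv gmul_rng.
Qed.

Lemma gmulK (a b : G) : gsrc a = grng b -> gmul (gmul a b) (ginv b) = a.
Proof. by move=> ab; rewrite -gmulA ?grng_inv// gmulV -ab gmul_src. Qed.

Lemma gmulVK (a b : G) : gsrc a = gsrc b -> gmul (gmul a (ginv b)) b = a.
Proof. by move=> ab; rewrite -gmulA ?gsrc_inv ?grng_inv// gmulVl -ab gmul_src. Qed.

Lemma ginvM (a b : G) : gsrc a = grng b -> ginv (gmul a b) = gmul (ginv b) (ginv a).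
Proof.
move=> ab; have ba : gsrc (ginv b) = grng (ginv a) by rewrite gsrc_inv grng_inv ab.
have e : gmul (gmul (ginv b) (ginv a)) (gmul a b) = gsrc b.
  have va : gsrc (gmul (ginv b) (ginv a)) = grng a by rewrite gsrc_mul// gsrc_inv.
  rewrite (gmulA _ _ _ va ab) -(gmulA _ _ _ ba (gsrc_inv a)) gmulVl ab -(gsrc_inv b) gmul_src.
  exact: gmulVl.
have sv : gsrc (gmul (ginv b) (ginv a)) = grng (gmul a b).
  by rewrite gsrc_mul// gsrc_inv grng_mul.
have := gmul_src (gmul (ginv b) (ginv a)).
by rewrite sv -gmulV (gmulA _ _ _ sv) ?grng_inv// e -(gsrc_mul _ _ ab) -grng_inv gmul_rng => <-.
Qed.

End GroupoidTopology.

(** * Countable families of test functions *)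

Section Closing.
Variables (R : realType) (G : ptopGroupoidType).
Hypotheses (hG : hausdorff_space G) (lG : locally_compact [set: G]).
Variables (K : nat -> set G) (eK : exhaustion K).
Implicit Types d : G -> G -> R.

(** For the cover by the interiors of the exhaustion, [cover_cpm] puts each unit ball inside a
    compact set. *)
Lemma pm_proper_exists : exists2 d : G -> G -> R, cpm d & pm_proper d.
Proof.
have [||d cd dP] := @cover_cpm R G [set (K n)° | n in [set: nat]] K hG lG eK.
- by move=> _ [n _ <-]; exact: open_interior.
- rewrite /is_cover -subTset => x _.
  have [n _ Kx] : (\bigcup_n K n) x by case: eK => _ _ ->.
  by exists (K n.+1)°; [exists n.+1|case: eK => _ h _; exact: h].
exists d => // x; have [_ [n _ <-] dB] := dP x.
exists (K n); first by case: eK.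
by move=> y dxy; apply: interior_subset; exact: dB.
Qed.

Lemma cpm_dense d : cpm d -> exists c : nat -> G, forall x e, 0 < e -> exists i, d (c i) x < e.
Proof.
move=> cd; have [[d0 ds dt d1] dc] := cd.
have /choice[s sP] (p : nat * nat) : exists s : seq G,
    forall y, K p.1 y -> exists2 x, x \in s & d x y < p.2.+1%:R^-1.
  have [|x _|s _ sP] := @compact_seq_cover G (K p.1) (fun x => [set y | d x y < p.2.+1%:R^-1]).
  - by case: eK.
  - by apply: dc; rewrite invr_gt0.
  - by exists s.
exists (fun i => if unpickle i is Some (p, j) then nth point (s p) j else point).
move=> x e e0; have [n _ Kx] : (\bigcup_n K n) x by case: eK => _ _ ->.
have [m me] : exists m : nat, m.+1%:R^-1 < e.
  have [m _ h] := [elaborate near_infty_natSinv_lt (PosNum e0)].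
  by exists m; exact: (h m (leqnn m)).
have [y ys yx] := sP (n, m) x Kx.
exists (pickle ((n, m), index y (s (n, m)))); rewrite pickleK nth_index//.
exact: lt_trans me.
Qed.

(** Finite maxima of bumps around a [d]-dense sequence, with radii from a sequence tending to 0,
    form a countable family. Countability lets one [csup] record the integrals of all of them. *)
Lemma test_family d : cpm d -> pm_proper d -> exists f : nat -> G -> R,
  [/\ forall i, Crc (f i), forall i x, 0 <= f i x <= 1 &
      forall (L : set G) e, compact L -> 0 < e -> exists i,
        (forall x, L x -> f i x = 1) /\
        forall y, f i y != 0 -> exists2 x, L x & d x y < e].
Proof.
move=> cd pd; have [[d0 ds dt d1] dc] := cd.
have [c cP] := cpm_dense cd.
(* This bump is 1 within [1 / m.+2] of [c i] and 0 from distance [2 / m.+2] on. That distance is at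
   most 1, so the bump vanishes outside a compact set. *)
pose g m i y : R := Num.max 0 (Num.min 1 (2 - m.+2%:R * d (c i) y)).
pose F (p : nat * seq nat) y : R := \big[Num.max/0]_(i <- p.2) g p.1 i y.
have g01 m i y : 0 <= g m i y <= 1.
  by rewrite /g le_max lexx /= ge_max ler01 ge_min lexx.
have F01 p y : 0 <= F p y <= 1.
  rewrite /F; elim: p.2 => [|i s IH]; first by rewrite big_nil lexx ler01.
  rewrite big_cons le_max ge_max; case/andP: IH => -> ->.
  by rewrite orbT; case/andP: (g01 p.1 i y) => _ ->.
have cg m i : continuous (g m i).
  move=> y; apply: (@continuous_max R G (fun=> 0)); first exact: cst_continuous.
  apply: (@continuous_min R G (fun=> 1)); first exact: cst_continuous.
  by apply: cvgB; [exact: cvg_cst|apply: cvgM; [exact: cvg_cst|exact: cpm_cvg]].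
have cF p : continuous (F p).
  move=> y; rewrite /F; elim: p.2 => [|i s IH].
    by under eq_fun do rewrite big_nil; exact: cvg_cst.
  rewrite (_ : (fun y => _) = (g p.1 i) \max (fun y => \big[Num.max/0]_(x <- s) g p.1 x y));
    last by apply/funext => z; rewrite big_cons.
  by apply: continuous_max => //; exact: cg.
have gn0 m i y : g m i y != 0 -> d (c i) y < 2 / m.+2%:R.
  apply: contraNlt => h; rewrite /g; apply/eqP/max_idPl.
  rewrite ge_min; apply/orP; right; rewrite subr_le0.
  by rewrite -ler_pdivrMl// mulrC.
have Fn0 p y : F p y != 0 -> exists2 i, i \in p.2 & g p.1 i y != 0.
  rewrite /F; elim: p.2 => [|i s IH]; first by rewrite big_nil eqxx.
  rewrite big_cons; have [gi|gi] := eqVneq (g p.1 i y) 0.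
    rewrite gi => Fy; have [|j js gj] := IH.
      apply: contra_neq Fy => ->; exact: maxxx.
    by exists j => //; rewrite inE js orbT.
  by move=> _; exists i => //; rewrite inE eqxx.
have cptF p : vanish (F p).
  have /choice[L LP] i : exists L : set G, compact L /\ forall y, d i y < 1 -> L y.
    by have [L ? ?] := pd i; exists L.
  exists (\big[setU/set0]_(i <- p.2) L (c i)).
    by apply: bigsetU_compact => i _; case: (LP (c i)).
  move=> y ny; apply/eqP; apply: contrapT => /negP /Fn0[i ip gi]; apply: ny.
  rewrite -bigcup_seq; exists i => //=; apply: (LP (c i)).2.
  apply: lt_le_trans (gn0 _ _ _ gi) _.
  by rewrite ler_pdivrMr// mul1r ler_nat.
exists (fun j => if unpickle j is Some p then F p else fun=> 0); split.
- move=> j; case: unpickle => [p|]; first by split.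
  by split; [exact: cst_continuous|exists set0 => //; exact: compact0].
- by move=> j x; case: unpickle => [p|] //; rewrite lexx ler01.
move=> L e cL e0.
(* Three units of [1 / m.+2]: one from a point of [L] to a centre, two from the centre to the end of
   its bump. *)
have [m me] : exists m : nat, 3 / m.+2%:R < e.
  have e3 : 0 < e / 3 by rewrite divr_gt0.
  have [m _ h] := [elaborate near_infty_natSinv_lt (PosNum e3)].
  exists m; rewrite mulrC -ltr_pdivlMr//; apply: le_lt_trans (h m (leqnn m)).
  by rewrite lef_pV2 ?posrE// ler_nat.
have /choice[i iP] x : exists i, d (c i) x < m.+2%:R^-1 by apply: cP; rewrite invr_gt0.
have [//|x Lx|s sL sP] := @compact_seq_cover G L (fun x => [set y | d (c (i x)) y < m.+2%:R^-1]).
  have /cvgr_lt h := @cpm_cvg R G d cd (c (i x)) x.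
  by apply: h; exact: iP.
exists (pickle (m, [seq i x | x <- s])); rewrite pickleK; split.
  move=> y Ly; have [x xs /= dxy] := sP y Ly.
  apply/eqP; rewrite eq_le; case/andP: (F01 (m, [seq i x | x <- s]) y) => _ -> /=.
  have is_ : i x \in [seq i x | x <- s] by apply: map_f.
  apply: le_trans (bigmax_ge_seq (fun j => g m j y) is_).
  rewrite /g le_max le_min lexx /=; apply/orP; right.
  rewrite lerBrDr -lerBrDl (_ : 2 - 1 = 1); last by ring.
  by rewrite -ler_pdivlMl// mulr1 ltW.
move=> y /Fn0[_ /mapP[x xs ->] /= /gn0 gy].
exists x; first exact: sL.
apply: (le_lt_trans (dt x (c (i x)) y)); apply: le_lt_trans me.
rewrite ds; have := iP x; move: gy; set u := d _ y; set v := d _ x.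
have -> : 3 / m.+2%:R = 2 / m.+2%:R + m.+2%:R^-1 :> R by field.
by move=> h1 h2; rewrite addrC ltW// ltrD.
Qed.

End Closing.

(** * Pseudometrics compatible with the groupoid structure *)

(* [M] collects the Haar system, at index [0], and the measures witnessing    *)
(* amenability.  Agreement on saturated open sets is what makes push-forwards *)
(* to the quotient independent of the chosen unit.                            *)
Record good (R : realType) (G : ptopGroupoidType)
    (M : nat -> G -> {measure set (borel G) -> \bar R}) (d : G -> G -> R) : Prop := Good {
  good_cpm : cpm d ;
  good_proper : pm_proper d ;
  good_src : forall a b, d a b = 0 -> d (gsrc a) (gsrc b) = 0 ;
  good_rng : forall a b, d a b = 0 -> d (grng a) (grng b) = 0 ;
  good_inv : forall a b, d a b = 0 -> d (ginv a) (ginv b) = 0 ;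
  good_mul : forall a b a' b', gsrc a = grng b -> gsrc a' = grng b' ->
    d a a' = 0 -> d b b' = 0 -> d (gmul a b) (gmul a' b') = 0 ;
  good_meas : forall k x y, units x -> units y -> d x y = 0 ->
    forall U : set G, open U -> (forall a b, d a b = 0 -> U a -> U b) ->
    M k x U = M k y U }.

Lemma min1_eq0 (R : realType) (u : R) : Num.min 1 `|u| = 0 -> u = 0.
Proof.
rewrite /Num.min; case: ifP => _ /eqP; first by rewrite oner_eq0.
by rewrite normr_eq0 => /eqP.
Qed.

Section Closing.
Variables (R : realType) (G : ptopGroupoidType).
Hypotheses (hG : hausdorff_space G) (lG : locally_compact [set: G]).
Variables (K : nat -> set G) (eK : exhaustion K).
Variable M : nat -> G -> {measure set (borel G) -> \bar R}.
Hypothesis MR : forall k x, units x -> radon (M k x).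
Hypothesis MC : forall k f, Cc f ->
  {within @units G, continuous (fun x => cintegral (M k x) setT f : R[i]^o)}.
Implicit Types d : G -> G -> R.

(* Separation of products: on the compact set of pairs of composable pairs    *)
(* from [K n] whose products are [1/n]-apart, either the first or the second  *)
(* components differ, and finitely many Urysohn functions detect this.        *)
Lemma mul_separating d : cpm d -> exists2 d' : G -> G -> R, cpm d' &
  forall a b a' b', gsrc a = grng b -> gsrc a' = grng b' ->
    d' a a' = 0 -> d' b b' = 0 -> d (gmul a b) (gmul a' b') = 0.
Proof.
move=> cd; have [[d0 ds dt d1] dc] := cd.
have sep (x y : G) : x <> y -> exists2 g : G -> R, continuous g & g x = 1 /\ g y = 0.
  move=> xy; have [|g [cg _ gx g0]] := @urysohn_point R G hG lG x (~` [set y]).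
    apply: open_nbhs_nbhs; split => //; apply: closed_openC.
    exact: (accessible_closed_set1 (hausdorff_accessible hG)).
  by exists g => //; split => //; apply: g0 => /=; apply.
have key n : exists2 d' : G -> G -> R, cpm d' & forall a b a' b', gsrc a = grng b -> gsrc a' = grng b' ->
    K n a -> K n b -> K n a' -> K n b' ->
    d' a a' = 0 -> d' b b' = 0 -> d (gmul a b) (gmul a' b') < n.+1%:R^-1.
  pose Q := (K n `*` K n) `&` @composable G.
  have cQ : compact Q.
    have cK : compact (K n) by case: eK.
    by apply: compact_closedI; [exact: compact_setX|exact: composable_closed].
  have cQQ : compact (Q `*` Q) by exact: compact_setX.
  pose far (g : G -> R) (w : (G * G) * (G * G)) : Prop :=
    g w.1.1 <> g w.2.1 \/ g w.1.2 <> g w.2.2.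
  have /choice[g gP] (z : (G * G) * (G * G)) : exists g : G -> R, continuous g /\
    ((Q `*` Q) z -> nbhs z [set w | (Q `*` Q) w ->
      d (gmul w.1.1 w.1.2) (gmul w.2.1 w.2.2) < n.+1%:R^-1 \/ far g w]).
    have [[Qz1 Qz2]|nQ] := pselect ((Q `*` Q) z); last first.
      by exists (fun=> 0); split => //; exact: cst_continuous.
    have [lt|ge] := ltP (d (gmul z.1.1 z.1.2) (gmul z.2.1 z.2.2)) n.+1%:R^-1.
      exists (fun=> 0); split; first exact: cst_continuous.
      move=> _; pose e := (n.+1%:R^-1 - d (gmul z.1.1 z.1.2) (gmul z.2.1 z.2.2)) / 2.
      have e0 : 0 < e by rewrite divr_gt0// subr_gt0.
      have h (p : G * G) : composable p ->
          nbhs p [set p' | composable p' -> d (gmul p.1 p.2) (gmul p'.1 p'.2) < e].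
        by move=> cp; exact: (mul_cvg cp (dc (gmul p.1 p.2) e e0)).
      have h1 := h _ Qz1.2; have h2 := h _ Qz2.2.
      exists ([set p' | composable p' -> d (gmul z.1.1 z.1.2) (gmul p'.1 p'.2) < e],
              [set p' | composable p' -> d (gmul z.2.1 z.2.2) (gmul p'.1 p'.2) < e]) => //=.
      move=> w [/= w1 w2] [[_ /w1 c1] [_ /w2 c2]]; left.
      have := dt (gmul w.1.1 w.1.2) (gmul z.1.1 z.1.2) (gmul w.2.1 w.2.2).
      have := dt (gmul z.1.1 z.1.2) (gmul z.2.1 z.2.2) (gmul w.2.1 w.2.2).
      rewrite (ds _ (gmul z.1.1 z.1.2)); move: c1 c2; rewrite /e; move: (n.+1%:R^-1) => N; lra.
    have : z.1.1 <> z.2.1 \/ z.1.2 <> z.2.2.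
      apply: contrapT => /not_orP[/contrapT e1 /contrapT e2].
      by move: ge; rewrite e1 e2 d0 leNgt invr_gt0 ltr0n.
    move=> zz.
    have nb (g : G -> R) (u v : ((G * G) * (G * G)) -> G) : continuous g ->
        continuous u -> continuous v -> g (u z) = 1 -> g (v z) = 0 ->
        nbhs z [set w | g (u w) <> g (v w)].
      move=> cg cu cv g1 g0.
      have cgu : {for z, continuous (fun w => g (u w))} by apply: continuous_comp; [exact: cu|exact: cg].
      have cgv : {for z, continuous (fun w => g (v w))} by apply: continuous_comp; [exact: cv|exact: cg].
      have h1 : \forall w \near z, 1/2 < g (u w) by apply: (cvgr_gt _ cgu); rewrite g1; lra.
      have h2 : \forall w \near z, g (v w) < 1/2 by apply: (cvgr_lt _ cgv); rewrite g0; lra.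
      by apply: filterS2 h1 h2 => w h1 h2 e; move: h1; rewrite e; lra.
    case: zz => /sep[g cg [g1 g0]]; exists g; split => // _.
    - apply: (@filterS _ _ _ [set w | g w.1.1 <> g w.2.1]); first by move=> w ? _; right; left.
      apply: (nb g (fun w => w.1.1) (fun w => w.2.1)) => // w.
        by apply: continuous_comp; exact: cvg_fst.
      by apply: continuous_comp; [exact: cvg_snd|exact: cvg_fst].
    - apply: (@filterS _ _ _ [set w | g w.1.2 <> g w.2.2]); first by move=> w ? _; right; right.
      apply: (nb g (fun w => w.1.2) (fun w => w.2.2)) => // w.
        by apply: continuous_comp; [exact: cvg_fst|exact: cvg_snd].
      by apply: continuous_comp; exact: cvg_snd.
  have [z Qz|s _ sP] := compact_seq_cover cQQ (U := fun z => [set w | (Q `*` Q) w ->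
      d (gmul w.1.1 w.1.2) (gmul w.2.1 w.2.2) < n.+1%:R^-1 \/ far (g z) w]).
    exact: (gP z).2.
  exists (fun x y => \big[Num.max/0]_(z <- s) Num.min 1 `|g z x - g z y|).
    by apply: cpm_bigmax => z _; apply: cpm_fun; case: (gP z).
  move=> a b a' b' ab ab' Ka Kb Ka' Kb' e1 e2.
  have Qw : (Q `*` Q) ((a, b), (a', b')) by [].
  have [z zs /(_ Qw)[//|]] := sP _ Qw.
  have g0 x y : \big[Num.max/0]_(z <- s) Num.min 1 `|g z x - g z y| = 0 -> g z x = g z y.
    move=> e; have := bigmax_ge_seq (fun z => Num.min 1 `|g z x - g z y|) zs.
    rewrite e ge_min => /orP[|]; first by rewrite leNgt ltr01.
    by rewrite normr_le0 subr_eq0 => /eqP.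
  by case=> h; exfalso; apply: h; exact: g0.
have /choice[D DP] n : exists d' : G -> G -> R, cpm d' /\ forall a b a' b', gsrc a = grng b -> gsrc a' = grng b' ->
    K n a -> K n b -> K n a' -> K n b' ->
    d' a a' = 0 -> d' b b' = 0 -> d (gmul a b) (gmul a' b') < n.+1%:R^-1.
  by have [d' ? ?] := key n; exists d'.
have cD n : cpm (D n) by case: (DP n).
exists (csup D); first exact: csup_cpm.
move=> a b a' b' ab ab' e1 e2; apply/eqP; rewrite eq_le pm_ge0 ?andbT; last by case: cd.
apply/ler_addgt0Pl => e e0; rewrite addr0.
have Kx x : exists n, K n x.
  by have [n _ ?] : (\bigcup_n K n) x by [case: eK => _ _ ->]; exists n.
have [[n1 k1] [n2 k2]] := (Kx a, Kx b).
have [[n3 k3] [n4 k4]] := (Kx a', Kx b').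
have [m _ h] := [elaborate near_infty_natSinv_lt (PosNum e0)].
(* Large enough for the four arrows to lie in [K n] and for the bound of level [n] to be below
   [e]. *)
pose n := maxn m (maxn (maxn n1 n2) (maxn n3 n4)).
have hn : n.+1%:R^-1 < e by apply: (h n); rewrite /= leq_maxl.
apply: ltW; apply: lt_trans hn.
apply: (DP n).2 => //.
- by apply: (exhaustion_le eK _ k1); rewrite !leq_max leqnn !orbT.
- by apply: (exhaustion_le eK _ k2); rewrite !leq_max leqnn !orbT.
- by apply: (exhaustion_le eK _ k3); rewrite !leq_max leqnn !orbT.
- by apply: (exhaustion_le eK _ k4); rewrite !leq_max leqnn !orbT.
- exact: csup_eq0 e1.
- exact: csup_eq0 e2.
Qed.

Lemma units_src_continuous (V : topologicalType) (h : G -> V) :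
  {within @units G, continuous h} -> continuous (fun a => h (gsrc a)).
Proof.
move=> /subspace_continuousP ch a.
apply: (@cvg_trans _ (h @ within (@units G) (nbhs (gsrc a)))); last by apply: ch; exact: units_src.
move=> A /= hA.
have h1 : \forall x \near gsrc a, units x -> A (h x) := hA.
have h2 : \forall y \near a, units (gsrc y) -> A (h (gsrc y)) := @gsrc_continuous G a _ h1.
by apply: filterS h2 => y; apply; exact: units_src.
Qed.

(** One round of closing up. It is deliberately asymmetric: nullity for [d'] gives compatibility
    only at the level of [d], and [d'] fixes the integrals of test functions adapted to [d]. Along
    an infinite iteration each level is controlled by the next one, and the asymmetry disappears. *)
Definition closing_step d d' : Prop :=
  [/\ cpm d' /\ (forall x y, d x y <= d' x y),
      forall a b, d' a b = 0 -> [/\ d (gsrc a) (gsrc b) = 0, d (grng a) (grng b) = 0 &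
        d (ginv a) (ginv b) = 0],
      forall a b a' b', gsrc a = grng b -> gsrc a' = grng b' ->
        d' a a' = 0 -> d' b b' = 0 -> d (gmul a b) (gmul a' b') = 0 &
      forall (L : set G) e, compact L -> 0 < e -> exists f : G -> R,
        [/\ Crc f, forall x, 0 <= f x <= 1, forall x, L x -> f x = 1,
         forall y, f y != 0 -> exists2 x, L x & d x y < e &
         forall k x y, units x -> units y -> d' x y = 0 ->
           Rintegral (M k x) setT f = Rintegral (M k y) setT f]].

Lemma closing_step_exists d : cpm d -> pm_proper d -> exists d', closing_step d d'.
Proof.
move=> cd pd; have [f [cf f01 fP]] := test_family eK cd pd.
have [dm cdm dmP] := mul_separating cd.
(* The integrals are continuous on units only; precomposition with the source makes them continuous
   on all of [G]. *)
pose I k i a := Rintegral (M k (gsrc a)) setT (f i).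
have cI k i : continuous (I k i).
  have := units_src_continuous (@MC k _ (Crc_Cc hG (cf i))).
  by move=> /continuousC_comp[].
(* The slots 0 to 4 hold [d], its pullbacks along the operations, and the separation of products;
   the slots from 5 on enumerate the integrals. *)
pose D n := match n with
  | 0 => d
  | 1 => fun a b => d (gsrc a) (gsrc b)
  | 2 => fun a b => d (grng a) (grng b)
  | 3 => fun a b => d (ginv a) (ginv b)
  | 4 => dm
  | n'.+4.+1 => if unpickle n' is Some (k, i)
      then fun a b => Num.min 1 `|I k i a - I k i b| else fun _ _ => 0 end.
have cD n : cpm (D n).
  case: n => [|[|[|[|[|n]]]]] //=.
  - by apply: (@cpm_comp _ _ d) => //; exact: gsrc_continuous.
  - by apply: (@cpm_comp _ _ d) => //; exact: grng_continuous.
  - by apply: (@cpm_comp _ _ d) => //; exact: ginv_continuous.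
  - by case: unpickle => [[k i]|]; [exact: cpm_fun|exact: pm0].
exists (csup D); split.
- split; first exact: csup_cpm.
  by move=> x y; have := csup_ge cD 0 x y; rewrite expr0 mul1r.
- move=> a b e.
  by split; [exact: (csup_eq0 cD 1 e)|exact: (csup_eq0 cD 2 e)|exact: (csup_eq0 cD 3 e)].
- move=> a b a' b' ab ab' e1 e2; apply: dmP => //.
    exact: (csup_eq0 cD 4 e1).
  exact: (csup_eq0 cD 4 e2).
- move=> L e cL e0; have [i [fi1 fi0]] := fP L e cL e0.
  exists (f i); split => // k x y ux uy xy.
  have := csup_eq0 cD (pickle (k, i)).+4.+1 xy; rewrite /= pickleK /I ux uy => h.
  by apply/eqP; rewrite -subr_eq0; apply/eqP; exact: min1_eq0.
Qed.

(** Nullity for the weighted supremum of the iterates is nullity for each of them, so every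
    requirement at level [n] follows from nullity at level [n.+1]. The measures are compared through
    a test function squeezed between a compact set and a saturated open set. *)
Lemma good_exists d0 : cpm d0 -> exists2 d, good M d & forall x y, d0 x y <= d x y.
Proof.
move=> cd0; have [dp cdp pdp] := pm_proper_exists R hG lG eK.
pose P d := cpm d /\ pm_proper d.
have /choice[F FP] d : exists d', P d -> closing_step d d'.
  have [[cd pd]|nP] := pselect (P d); last by exists d.
  by have [d' ?] := closing_step_exists cd pd; exists d'.
pose D n := iter n F (fun x y => Num.max (d0 x y) (dp x y)).
have PD n : P (D n).
  elim: n => [|n [cd pd]].
    split; first exact: cpm_max.
    by apply: (pm_proper_le pdp) => x y; rewrite le_max lexx orbT.
  have [[cd' dd'] _ _ _] := FP (D n) (conj cd pd); split => //.
  exact: (pm_proper_le pd dd').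
have cD n : cpm (D n) by case: (PD n).
have SD n : closing_step (D n) (D n.+1) by apply: FP.
have mD m n x y : (m <= n)%N -> D m x y <= D n x y.
  move=> /subnK <-; elim: (n - m)%N => [|k IH]; first exact: lexx.
  by have [[_ h] _ _ _] := SD (k + m)%N; apply: (le_trans IH); exact: h.
have Dle x y : D 0%N x y <= csup D x y by have := csup_ge cD 0 x y; rewrite expr0 mul1r.
have cS : cpm (csup D) by exact: csup_cpm.
have pS : pm_proper (csup D).
  by apply: (pm_proper_le pdp) => x y; apply: le_trans (Dle x y); rewrite le_max lexx orbT.
have S0 x y : (forall n, D n x y = 0) -> csup D x y = 0.
  move=> h; apply/eqP; rewrite eq_le pm_ge0 ?andbT; last by case: cS.
  by apply: pmsup_le => n; rewrite h mulr0.
have [[_ Ss St _] _] := cS.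
exists (csup D); last first.
  by move=> x y; apply: le_trans (Dle x y); rewrite le_max lexx.
split => //.
- move=> a b e; apply: S0 => n; have [_ h _ _] := SD n.
  by have [] := h a b (csup_eq0 cD n.+1 e).
- move=> a b e; apply: S0 => n; have [_ h _ _] := SD n.
  by have [] := h a b (csup_eq0 cD n.+1 e).
- move=> a b e; apply: S0 => n; have [_ h _ _] := SD n.
  by have [] := h a b (csup_eq0 cD n.+1 e).
- move=> a b a' b' ab ab' e1 e2; apply: S0 => n; have [_ _ h _] := SD n.
  by apply: h => //; [exact: (csup_eq0 cD n.+1 e1)|exact: (csup_eq0 cD n.+1 e2)].
move=> k.
suff le x y : units x -> units y -> csup D x y = 0 -> forall U : set G, open U ->
    (forall a b, csup D a b = 0 -> U a -> U b) -> (M k x U <= M k y U)%E.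
  move=> x y ux uy xy U oU sU; apply/eqP; rewrite eq_le le//= le//.
  by rewrite Ss.
move=> ux uy xy U oU sU; have [_ _ ir] := @MR k _ ux.
rewrite (ir U oU); apply: ge_ereal_sup => _ [L [cL LU] <-].
(* [L] has positive distance to the complement of [U]: each point of [L] has a ball inside the
   saturated set [U], and half the radii of finitely many balls serve uniformly. *)
have [e e0 eP] : exists2 e, 0 < e & forall z w, L z -> csup D z w < e -> U w.
  have /choice[e eP] z : exists e, L z -> 0 < e /\ forall w, csup D z w < e -> U w.
    have [Lz|nL] := pselect (L z); last by exists 0.
    by have [e ? ?] := fibre_open_ball cS pS oU (fun y zy => sU z y zy (LU _ Lz)); exists e.
  have [z Lz|s sL sP] := compact_seq_cover cL (U := fun z => [set w | csup D z w < e z / 2]).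
    have [ez _] := eP z Lz; have [_ h] := cS; apply: h.
    by rewrite divr_gt0.
  have [r r0 rP] : exists2 r, 0 < r & forall z, z \in s -> r <= e z / 2.
    elim: s sL {sP} => [|z s IH] sL; first by exists 1.
    have [|r r0 rP] := IH; first by move=> w ws; apply: sL; rewrite inE ws orbT.
    exists (Num.min r (e z / 2)).
      by rewrite lt_min r0 divr_gt0//; case: (eP z (sL z (mem_head _ _))).
    move=> w; rewrite inE => /predU1P[->|ws]; rewrite ge_min ?lexx ?orbT// rP//.
  exists r => // z w Lz zw; have [v vs /= vz] := sP z Lz.
  have [_ h] := eP v (sL v vs); apply: h.
  by have := St v z w; have := rP v vs; move: vz zw; set ev := e v; lra.
(* From level [N] on the weights are below [e / 2], and the lower levels are dominated by [D N].
   Hence a [D N]-distance below [e / 2] bounds [csup D] by [e / 2], and a test function adapted to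
   [D N] vanishes outside [U]. *)
have [N NP] : exists N, 2^-1 ^+ N < e / 2.
  have : (fun n => 2^-1 ^+ n : R) @ \oo --> 0.
    by apply: cvg_expr; rewrite ger0_norm ?invr_ge0// invf_lt1// ltr1n.
  move=> /cvgrPdist_lt/(_ (e / 2)) []; first by rewrite divr_gt0.
  move=> N _ /(_ N (leqnn N)); rewrite sub0r normrN ger0_norm ?exprn_ge0 ?invr_ge0//.
  by exists N.
have [_ _ _ h] := SD N.
have e20 : 0 < e / 2 by rewrite divr_gt0.
have [f [cf f01 f1 f0 fM]] := h L (e / 2) cL e20.
have fU z : ~ U z -> f z = 0.
  move=> nU; apply/eqP; apply: contrapT => /negP /f0[w Lw wz]; apply: nU.
  apply: (eP w) => //; apply: (@le_lt_trans _ _ (e / 2)); last by lra.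
  have w0 j : 0 <= D j w z by apply: pm_ge0; case: (cD j).
  have p0 j : 0 <= 2^-1 ^+ j :> R by rewrite exprn_ge0// invr_ge0.
  have p1 j : 2^-1 ^+ j <= 1 :> R by apply: exprn_ile1; lra.
  apply: ge_sup; first by exists (2^-1 ^+ 0 * D 0%N w z), 0%N.
  move=> _ [j _ <-]; have [jN|Nj] := leqP j N.
    apply: (le_trans _ (ltW wz)); apply: (le_trans _ (mD _ _ w z jN)).
    by rewrite ler_piMl.
  apply: (le_trans _ (ltW NP)); apply: (@le_trans _ _ (2^-1 ^+ j)).
    by rewrite ler_piMr//; have [[_ _ _ ->] _] := cD j.
  by apply: ler_wiXn2l; [lra|lra|exact: ltnW].
have [rx _ _] := @MR k _ ux; have [ry _ _] := @MR k _ uy.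
have /andP[h1 _] := Crc_squeeze hG rx cf f01 cL oU f1 fU.
have /andP[_ h2] := Crc_squeeze hG ry cf f01 cL oU f1 fU.
by apply: (le_trans h1); rewrite (fM k x y)// (csup_eq0 cD N.+1 xy).
Qed.

End Closing.

(** * The quotient groupoid of a pseudometric *)

(* All the properties of [G] on which the structures of the quotient depend   *)
(* are fields, so that the canonical instances on [quo d] have no hypothesis. *)
(* By [gd_lift] composability in the quotient lifts to [G].                   *)
Record gpm (R : realType) (G : ptopGroupoidType) := Gpm {
  gd :> G -> G -> R ;
  gd_haus : hausdorff_space G ;
  gd_cpm : cpm gd ;
  gd_proper : pm_proper gd ;
  gd_src : forall a b, gd a b = 0 -> gd (gsrc a) (gsrc b) = 0 ;
  gd_rng : forall a b, gd a b = 0 -> gd (grng a) (grng b) = 0 ;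
  gd_inv : forall a b, gd a b = 0 -> gd (ginv a) (ginv b) = 0 ;
  gd_mul : forall a b a' b', gsrc a = grng b -> gsrc a' = grng b' ->
    gd a a' = 0 -> gd b b' = 0 -> gd (gmul a b) (gmul a' b') = 0 ;
  gd_lift : forall x a, units x -> gd (gsrc a) x = 0 ->
    exists2 a', gsrc a' = x & gd a a' = 0 }.

Section Quotient.
Variables (R : realType) (G : ptopGroupoidType) (d : gpm R G).

Lemma gdxx x : d x x = 0. Proof. by case: (gd_cpm d) => -[]. Qed.

Lemma gd_sym x y : d x y = d y x. Proof. by case: (gd_cpm d) => -[]. Qed.

Lemma gd_tri x y z : d x z <= d x y + d y z. Proof. by case: (gd_cpm d) => -[]. Qed.

Lemma gd_ge0 x y : 0 <= d x y. Proof. by apply: pm_ge0; case: (gd_cpm d). Qed.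

Lemma gd0_tri x y z : d x y = 0 -> d x z = d y z.
Proof.
move=> xy; have := gd_tri x y z; have := gd_tri y x z.
by rewrite (gd_sym y x) xy; lra.
Qed.

Definition grep (x : G) : G := xget point [set y | d x y = 0].

Lemma grepP x : d x (grep x) = 0.
Proof. by have := @xgetI _ point [set y | d x y = 0] x (gdxx x). Qed.

Lemma grep_eq x y : d x y = 0 -> grep x = grep y.
Proof.
by move=> xy; rewrite /grep; congr xget; apply/funext => z /=; rewrite (gd0_tri _ xy).
Qed.

(** A point is a canonical representative and not a class, so that [d] itself restricts to a metric
    and [qval] is a section of the projection. *)
Record quo := Quo { qval : G ; qvalP : grep qval = qval }.

Lemma grep_idem x : grep (grep x) = grep x.
Proof. by apply: grep_eq; rewrite gd_sym grepP. Qed.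

Definition qmap (x : G) : quo := Quo (grep_idem x).

Lemma qval_inj : injective qval.
Proof.
move=> [x px] [y py] /= xy; move: px py; rewrite xy => px py.
by congr Quo; exact: Prop_irrelevance.
Qed.

Lemma qmapK y : qmap (qval y) = y.
Proof. by apply: qval_inj => /=; exact: qvalP. Qed.

Lemma qval_map x : d x (qval (qmap x)) = 0. Proof. exact: grepP. Qed.

Lemma qmapP x y : qmap x = qmap y <-> d x y = 0.
Proof.
split=> [[e]|xy]; last by apply: qval_inj; exact: grep_eq.
by rewrite (gd0_tri _ (grepP x)) e gd_sym grepP.
Qed.

Lemma qmap_surj y : exists x, qmap x = y. Proof. by exists (qval y); exact: qmapK. Qed.

HB.instance Definition _ := gen_eqMixin quo.
HB.instance Definition _ := gen_choiceMixin quo.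
HB.instance Definition _ := isPointed.Build quo (qmap point).

Definition qdist (x y : quo) : R := d (qval x) (qval y).

Lemma qdistE x y : qdist (qmap x) (qmap y) = d x y.
Proof. by rewrite /qdist -(gd0_tri _ (grepP x)) gd_sym -(gd0_tri _ (grepP y)) gd_sym. Qed.

Lemma qdistxx x : qdist x x = 0. Proof. exact: gdxx. Qed.

Lemma qdist_pos x y : qdist x y = 0 -> x = y.
Proof. by move=> /qmapP; rewrite !qmapK. Qed.

Lemma qdist_sym x y : qdist x y = qdist y x. Proof. exact: gd_sym. Qed.

Lemma qdist_tri y x z : qdist x z <= qdist x y + qdist y z. Proof. exact: gd_tri. Qed.

HB.instance Definition _ := isMetric.Build R quo qdistxx qdist_pos qdist_sym qdist_tri.

Lemma quo_haus : hausdorff_space quo.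
Proof. exact: (@metric_hausdorff R quo). Qed.

Lemma qball x e y : ball (qmap x) e (qmap y) <-> d x y < e.
Proof. by rewrite (ballEmdist (qmap x)) /= -qdistE. Qed.

Lemma qmap_cont : continuous qmap.
Proof.
move=> x A /nbhs_ballP[e e0 eA].
have [_ dc] := gd_cpm d.
apply: filterS (dc x e e0) => y xy; apply: eA.
by apply/qball.
Qed.

(** [fibre_open_ball] read in the quotient; it expresses that the projection is a closed map. *)
Lemma fibre_nbhs x (P : set G) : (forall y, d x y = 0 -> nbhs y P) ->
  \forall z \near qmap x, forall y, qmap y = z -> P y.
Proof.
move=> h; have [y yP|e e0 eP] := fibre_open_ball (U := P°) (gd_cpm d) (@gd_proper _ _ d) (@open_interior _ P) (x := x).
  exact: (h y yP).
apply/nbhs_ballP; exists e => // z xz y yz; apply: interior_subset; apply: eP.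
by apply/qball; rewrite yz.
Qed.

(** By [fibre_nbhs] the metric topology coincides with the quotient topology. *)
Lemma quo_continuous (V : topologicalType) (f : quo -> V) :
  continuous (f \o qmap) -> continuous f.
Proof.
move=> cf y; have [x <-] := qmap_surj y => A nA.
have [y0 /qmapP e|] := @fibre_nbhs x [set z | A (f (qmap z))].
  by apply: (cf y0); rewrite /= -e.
move=> e e0 eP; exists e => // z xz; have [w wz] := qmap_surj z.
by rewrite -wz; exact: (eP z xz).
Qed.

(** Closedness of [C] takes care of the points of a fibre outside [C]: they have neighbourhoods
    missing [C], on which the condition is void. *)
Lemma quo_within_continuous (V : topologicalType) (f : quo -> V) (C : set G) (D : set quo) :
  closed C -> (forall y, D y -> exists2 x, C x & qmap x = y) ->
  {within C, continuous (f \o qmap)} -> {within D, continuous f}.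
Proof.
move=> cC CD /subspace_continuousP cf; apply/subspace_continuousP => y Dy A nA.
have [x Cx xy] := CD _ Dy.
have h : \forall z \near y, forall w, qmap w = z -> C w -> A (f (qmap w)).
  rewrite -xy; apply: fibre_nbhs => w /qmapP xw.
  have [Cw|nC] := pselect (C w).
    have nA' : nbhs ((f \o qmap) w) A by rewrite /= -xw xy.
    exact: (cf w Cw A nA').
  have := closed_openC cC; rewrite openE => /(_ w nC).
  by apply: filterS => v nCv /nCv.
rewrite /nbhs /=; apply: filterS h => z hz Dz.
by have [w Cw wz] := CD z Dz; rewrite -wz; apply: hz.
Qed.

(** A compact set is covered by finitely many unit balls, and their preimages are unit balls of [d],
    which lie in compact sets. *)
Lemma qmap_proper : proper_map qmap.
Proof.
move=> K cK; have KC : closed K by apply: compact_closed => //; exact: quo_haus.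
have [y _|s _ sP] := compact_seq_cover cK (U := fun y => ball y (1 : R)).
  exact: nbhsx_ballx.
have /choice[L LP] x : exists L : set G, compact L /\ forall y, d x y < 1 -> L y.
  by have [L ? ?] := @gd_proper _ _ d x; exists L.
apply: (@subclosed_compact _ _ (\big[setU/set0]_(y <- s) L (qval y))).
- by move/continuous_closedP : qmap_cont; apply.
- by apply: bigsetU_compact => y _; case: (LP (qval y)).
move=> x /= /sP[y ys yx]; rewrite -bigcup_seq; exists y => //=.
by apply: (LP _).2; apply/qball; rewrite qmapK.
Qed.

Lemma qmap_closed (C : set G) : closed C -> closed (qmap @` C).
Proof.
move=> cC; rewrite -openC openE => z; have [x <-] := qmap_surj z => nC.
have : \forall z \near qmap x, forall y, qmap y = z -> (~` C) y.
  apply: fibre_nbhs => y /qmapP xy; apply: open_nbhs_nbhs; split; first exact: closed_openC.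
  by move=> Cy; apply: nC; exists y.
by apply: filterS => w h [y Cy yw]; exact: (h y yw).
Qed.

(** With this pseudometric [fibre_open_ball] also applies to products of fibres, as continuity of
    the multiplication requires. *)
Definition pair_dist (p q : G * G) : R := Num.max (d p.1 q.1) (d p.2 q.2).

Lemma pair_cpm : cpm pair_dist.
Proof.
have [[d0 ds dt d1] dc] := gd_cpm d; split; first split.
- by move=> x; rewrite /pair_dist !d0 maxxx.
- by move=> x y; rewrite /pair_dist !(ds x.1) !(ds x.2).
- move=> x y z; rewrite /pair_dist ge_max; apply/andP; split.
    by rewrite (le_trans (dt x.1 y.1 z.1))// lerD// le_max lexx.
  by rewrite (le_trans (dt x.2 y.2 z.2))// lerD// le_max lexx orbT.
- by move=> x y; rewrite /pair_dist ge_max !d1.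
- move=> x e e0; exists ([set y | d x.1 y < e], [set y | d x.2 y < e]).
    by split; exact: dc.
  by move=> y [/= h1 h2]; rewrite /pair_dist gt_max h1.
Qed.

Lemma pair_proper : pm_proper pair_dist.
Proof.
move=> x; have [L1 c1 h1] := @gd_proper _ _ d x.1.
have [L2 c2 h2] := @gd_proper _ _ d x.2.
exists (L1 `*` L2); first exact: compact_setX.
by move=> y; rewrite /pair_dist gt_max => /andP[/h1 ? /h2 ?].
Qed.

Lemma quo2_within_continuous (V : topologicalType) (f : quo * quo -> V)
    (C : set (G * G)) (D : set (quo * quo)) :
  closed C -> (forall y, D y -> exists2 x, C x & (qmap x.1, qmap x.2) = y) ->
  {within C, continuous (fun x => f (qmap x.1, qmap x.2))} -> {within D, continuous f}.
Proof.
move=> cC CD /subspace_continuousP cf; apply/subspace_continuousP => y Dy A nA.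
have [x Cx xy] := CD _ Dy.
pose P := [set w : G * G | C w -> A (f (qmap w.1, qmap w.2))].
have [w xw|e e0 eP] := fibre_open_ball (U := P°) pair_cpm pair_proper (@open_interior _ P) (x := x).
  have [e1 e2] : d x.1 w.1 = 0 /\ d x.2 w.2 = 0.
    by move: xw; rewrite /pair_dist; have := gd_ge0 x.1 w.1; have := gd_ge0 x.2 w.2;
      rewrite /Num.max; case: ltP; lra.
  rewrite /interior /=; have [Cw|nC] := pselect (C w).
    have nA' : nbhs (f (qmap w.1, qmap w.2)) A.
      by move/qmapP : e1 => <-; move/qmapP : e2 => <-; rewrite xy.
    exact: (cf w Cw A nA').
  have := closed_openC cC; rewrite openE => /(_ w nC).
  by apply: filterS => v nCv /nCv.
have h : \forall z \near y, forall w, (qmap w.1, qmap w.2) = z -> C w -> A (f z).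
  exists (ball y.1 e, ball y.2 e); first by split; exact: nbhsx_ballx.
  move=> z [/= b1 b2] w wz Cw; rewrite -wz.
  have Pw : P w; last exact: Pw.
  apply: interior_subset; apply: eP; rewrite /pair_dist gt_max.
  by apply/andP; split; apply/qball; move: b1 b2; rewrite -xy -wz.
rewrite /nbhs /=; apply: filterS h => z hz Dz.
by have [w Cw wz] := CD z Dz; apply: (hz w).
Qed.

Lemma gd_lift_rng x a : units x -> d (grng a) x = 0 ->
  exists2 a', grng a' = x & d a a' = 0.
Proof.
move=> ux e; have [|a' a'x aa'] := @gd_lift _ _ d x (ginv a) ux; first by rewrite gsrc_inv.
exists (ginv a'); first by rewrite grng_inv.
by have := gd_inv aa'; rewrite ginvK.
Qed.

Definition qsrc (y : quo) : quo := qmap (gsrc (qval y)).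
Definition qrng (y : quo) : quo := qmap (grng (qval y)).
Definition qinv (y : quo) : quo := qmap (ginv (qval y)).
(* A product in the quotient is computed on representatives made composable.  *)
Definition qlift (y z : quo) : G :=
  xget point [set b | qmap b = z /\ grng b = gsrc (qval y)].
Definition qmul (y z : quo) : quo := qmap (gmul (qval y) (qlift y z)).

Lemma qsrcE a : qsrc (qmap a) = qmap (gsrc a).
Proof. by apply/qmapP; apply: gd_src; rewrite gd_sym qval_map. Qed.

Lemma qrngE a : qrng (qmap a) = qmap (grng a).
Proof. by apply/qmapP; apply: gd_rng; rewrite gd_sym qval_map. Qed.

Lemma qinvE a : qinv (qmap a) = qmap (ginv a).
Proof. by apply/qmapP; apply: gd_inv; rewrite gd_sym qval_map. Qed.

Lemma qlift_rng (a : G) (z : quo) : qsrc (qmap a) = qrng z ->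
  exists2 b, qmap b = z & grng b = gsrc a.
Proof.
have [b <-] := qmap_surj z; rewrite qsrcE qrngE => /qmapP e.
have e' : d (grng b) (gsrc a) = 0 by rewrite gd_sym.
have [b' b'a bb'] := gd_lift_rng (units_src a) e'.
by exists b' => //; apply/esym/qmapP.
Qed.

Lemma qmulE a b : gsrc a = grng b -> qmul (qmap a) (qmap b) = qmap (gmul a b).
Proof.
move=> ab; have [|c cb cr] := @qlift_rng (qval (qmap a)) (qmap b).
  by rewrite qmapK qsrcE qrngE ab.
have [e1 e2] : [set b0 | qmap b0 = qmap b /\ grng b0 = gsrc (qval (qmap a))]
    (qlift (qmap a) (qmap b)) by apply: (@xgetI _ point _ c).
apply/qmapP; apply: gd_mul => //.
  by rewrite gd_sym qval_map.
exact/qmapP.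
Qed.

Lemma qgsrc_src y : qsrc (qsrc y) = qsrc y.
Proof. by have [a <-] := qmap_surj y; rewrite !qsrcE gsrc_src. Qed.
Lemma qgrng_src y : qrng (qsrc y) = qsrc y.
Proof. by have [a <-] := qmap_surj y; rewrite !qsrcE qrngE grng_src. Qed.
Lemma qgsrc_rng y : qsrc (qrng y) = qrng y.
Proof. by have [a <-] := qmap_surj y; rewrite !qrngE qsrcE gsrc_rng. Qed.
Lemma qgrng_rng y : qrng (qrng y) = qrng y.
Proof. by have [a <-] := qmap_surj y; rewrite !qrngE grng_rng. Qed.
Lemma qgsrc_mul y z : qsrc y = qrng z -> qsrc (qmul y z) = qsrc z.
Proof.
have [a <-] := qmap_surj y => /qlift_rng[b <- ba].
by rewrite qmulE// !qsrcE gsrc_mul.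
Qed.
Lemma qgrng_mul y z : qsrc y = qrng z -> qrng (qmul y z) = qrng y.
Proof.
have [a <-] := qmap_surj y => /qlift_rng[b <- ba].
by rewrite qmulE// !qrngE grng_mul.
Qed.
Lemma qgmulA x y z : qsrc x = qrng y -> qsrc y = qrng z ->
  qmul x (qmul y z) = qmul (qmul x y) z.
Proof.
have [a <-] := qmap_surj x => /qlift_rng[b <- ba] /qlift_rng[c <- cb].
by rewrite !qmulE ?grng_mul ?gsrc_mul// gmulA.
Qed.
Lemma qgmul_src y : qmul y (qsrc y) = y.
Proof. by have [a <-] := qmap_surj y; rewrite qsrcE qmulE ?grng_src// gmul_src. Qed.
Lemma qgmul_rng y : qmul (qrng y) y = y.
Proof. by have [a <-] := qmap_surj y; rewrite qrngE qmulE ?gsrc_rng// gmul_rng. Qed.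
Lemma qgsrc_inv y : qsrc (qinv y) = qrng y.
Proof. by have [a <-] := qmap_surj y; rewrite qinvE qsrcE qrngE gsrc_inv. Qed.
Lemma qgrng_inv y : qrng (qinv y) = qsrc y.
Proof. by have [a <-] := qmap_surj y; rewrite qinvE qsrcE qrngE grng_inv. Qed.
Lemma qgmulV y : qmul y (qinv y) = qrng y.
Proof. by have [a <-] := qmap_surj y; rewrite qinvE qmulE ?grng_inv// qrngE gmulV. Qed.
Lemma qgmulVl y : qmul (qinv y) y = qsrc y.
Proof. by have [a <-] := qmap_surj y; rewrite qinvE qmulE ?gsrc_inv// qsrcE gmulVl. Qed.

HB.instance Definition _ := isGroupoid.Build quo qgsrc_src qgrng_src qgsrc_rng qgrng_rng
  qgsrc_mul qgrng_mul qgmulA qgmul_src qgmul_rng qgsrc_inv qgrng_inv qgmulV qgmulVl.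

Lemma qgmul_continuous : {within [set p : quo * quo | gsrc p.1 = grng p.2],
      continuous (fun p : quo * quo => gmul p.1 p.2)}.
Proof.
apply: (@quo2_within_continuous _ _ (@composable G)).
- exact: composable_closed (@gd_haus _ _ d).
- move=> [y z] /=; have [a <-] := qmap_surj y => /qlift_rng[b <- ba].
  by exists (a, b).
apply/subspace_continuousP => p cp /=.
apply: (@cvg_trans _ ((fun x => qmap (gmul x.1 x.2)) @ within (@composable G) (nbhs p))).
  apply: near_eq_cvg; apply: filterS (withinT (@composable G) (nbhs_filter p)) => x cx.
  by rewrite [RHS](qmulE cx).
have e : qmul (qmap p.1) (qmap p.2) = qmap (gmul p.1 p.2) := qmulE cp.
change ((fun x => qmap (gmul x.1 x.2)) @ within (@composable G) (nbhs p) -->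
  qmul (qmap p.1) (qmap p.2)); rewrite e.
exact: (cvg_comp _ _ (mul_cvg cp) (@qmap_cont (gmul p.1 p.2))).
Qed.

Lemma qginv_continuous : continuous (ginv : quo -> quo).
Proof.
apply: quo_continuous => x.
rewrite (_ : ginv \o qmap = qmap \o ginv); last by apply/funext => y; exact: qinvE.
by apply: continuous_comp; [exact: ginv_continuous|exact: qmap_cont].
Qed.

HB.instance Definition _ := Groupoid_isTopological.Build quo
  qgmul_continuous qginv_continuous.

Lemma qmap_morphism : groupoid_morphism qmap.
Proof.
split=> [a|a|a b ab]; [exact: qsrcE|exact: qrngE|by apply/esym/qmulE].
Qed.

Lemma qmap_pc : pc_morphism qmap.
Proof. by split; [exact: qmap_morphism|exact: qmap_cont|exact: qmap_proper]. Qed.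

End Quotient.

(** * Change of variables *)

Section Transport.
Local Open Scope ereal_scope.
Context d1 d2 (T1 : measurableType d1) (T2 : measurableType d2) (R : realType).
Variables (m1 : {measure set T1 -> \bar R}) (m2 : {measure set T2 -> \bar R}).
Variables (D1 : set T1) (D2 : set T2) (phi : T1 -> T2).
Hypotheses (mD1 : measurable D1) (mD2 : measurable D2).
Hypothesis mphi : measurable_fun D1 phi.
Hypothesis phiD : forall x, D1 x -> D2 (phi x).
Hypothesis m21 : forall B, measurable B -> B `<=` D2 -> m2 B = m1 (D1 `&` phi @^-1` B).

(** Translations of a groupoid are meaningful on one fibre only, hence a change of variables with
    [phi] controlled on [D1] alone. [phi] is made constant off [D1] and [m1] restricted to [D1]; the
    resulting push-forward agrees with [m2] inside [D2]. *)
Lemma ge0_integral_transport (f : T2 -> \bar R) : measurable_fun D2 f ->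
  (forall y, D2 y -> 0 <= f y) ->
  \int[m2]_(y in D2) f y = \int[m1]_(x in D1) f (phi x).
Proof.
move=> mf f0; pose phi' := phi \_ D1.
have mphi' : measurable_fun setT phi' by apply/(measurable_restrictT _ _).1.
pose r := mrestr m1 mD1.
have phiE x : D1 x -> phi' x = phi x by move=> Dx; rewrite /phi' patchE mem_set.
have mpre : measurable (phi' @^-1` D2) by rewrite -[X in measurable X]setTI; exact: mphi'.
have preE : phi' @^-1` D2 `\` ~` D1 = D1.
  apply/seteqP; split=> [x [_ /= /contrapT]//|x Dx]; split => /=; last by apply.
  by rewrite phiE//; exact: phiD.
have mfphi : measurable_fun (phi' @^-1` D2) (f \o phi').
  apply: (measurable_comp mD2) => //; last exact: measurable_funTS.
  by move=> _ [x Dx <-].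
transitivity (\int[pushforward r phi']_(y in D2) f y).
  apply: eq_measure_integral => B mB BD2; rewrite m21// /pushforward /r /mrestr setIC.
  congr (m1 _); apply/seteqP.
  by split => x /= [h Dx]; split => //; move: h; rewrite phiE.
rewrite (@ge0_integral_pushforward _ _ _ _ _ phi' mphi' r)//; last by move=> y /set_mem; exact: f0.
rewrite (@ge0_negligible_integral _ _ _ _ _ (~` D1))//=; last first.
- by rewrite /r /mrestr setICl measure0.
- by move=> x /= Dx; exact: f0.
- exact: measurableC.
rewrite preE; transitivity (\int[m1]_(x in D1) (f \o phi') x).
  apply: eq_measure_integral => B mB BD; rewrite /r /mrestr /=; congr (m1 _).
  exact: setIidl.
by apply: eq_integral => x /set_mem Dx /=; rewrite phiE.
Qed.

Lemma integral_transport (f : T2 -> \bar R) : measurable_fun D2 f ->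
  \int[m2]_(y in D2) f y = \int[m1]_(x in D1) f (phi x).
Proof.
move=> mf; rewrite [LHS]integralE [RHS]integralE.
by rewrite (ge0_integral_transport (measurable_funepos mf))//
  (ge0_integral_transport (measurable_funeneg mf))// (funepos_comp f phi) (funeneg_comp f phi).
Qed.

End Transport.

Section ComplexIntegral.
Variables (R : realType).

Definition cmeas (T : ptopologicalType) (D : set T) (f : T -> R[i]) : Prop :=
  measurable_fun (D : set (borel T)) (fun x => complex.Re (f x)) /\
  measurable_fun (D : set (borel T)) (fun x => complex.Im (f x)).

Lemma cmeas_within (T : ptopologicalType) (D : set T) (f : T -> R[i]) :
  measurable (D : set (borel T)) ->
  {within D, continuous (f : T -> R[i]^o)} -> cmeas D f.
Proof.
move=> mD cf.
have : continuous (f : subspace D -> R[i]^o) by exact: cf.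
by move/continuousC_comp => [cr ci]; split; apply: within_cont_borel.
Qed.

Lemma Cc_cmeas (T : ptopologicalType) (D : set T) (f : T -> R[i]) :
  measurable (D : set (borel T)) -> Cc f -> cmeas D f.
Proof.
by move=> mD [cf _]; apply: cmeas_within => //; exact: continuous_subspaceT.
Qed.

Lemma cintegral_transport (T1 T2 : ptopologicalType)
    (m1 : {measure set (borel T1) -> \bar R}) (m2 : {measure set (borel T2) -> \bar R})
    (D1 : set T1) (D2 : set T2) (phi : T1 -> T2) (f : T2 -> R[i]) :
  measurable (D1 : set (borel T1)) -> measurable (D2 : set (borel T2)) ->
  measurable_fun (D1 : set (borel T1)) (phi : borel T1 -> borel T2) ->
  (forall x, D1 x -> D2 (phi x)) ->
  (forall B : set (borel T2), measurable B -> B `<=` D2 ->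
    m2 B = m1 (D1 `&` phi @^-1` B)) ->
  cmeas D2 f -> cintegral m2 D2 f = cintegral m1 D1 (fun x => f (phi x)).
Proof.
move=> mD1 mD2 mphi phiD m21 [mr mi]; rewrite /cintegral /Rintegral.
by congr (Complex (fine _) (fine _)); apply: integral_transport => //; apply/measurable_EFinP.
Qed.

Lemma eq_cintegral (T : ptopologicalType) (m : {measure set (borel T) -> \bar R})
    (D : set T) (f g : T -> R[i]) : (forall x, D x -> f x = g x) ->
  cintegral m D f = cintegral m D g.
Proof.
move=> fg; rewrite /cintegral /Rintegral.
by congr (Complex (fine _) (fine _)); apply: eq_integral => x /set_mem /fg ->.
Qed.

Lemma measure_conc d (T : measurableType d) (m : {measure set T -> \bar R})
    (D B : set T) : measurable D -> measurable B -> m (~` D) = 0%E -> m B = m (D `&` B).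
Proof.
move=> mD mB m0.
have mDB : measurable (D `&` B) by exact: measurableI.
have mCB : measurable (~` D `&` B) by apply: measurableI => //; exact: measurableC.
have e : B = (D `&` B) `|` (~` D `&` B) by rewrite -setIUl setUv setTI.
have z : m (~` D `&` B) = 0%E.
  by apply: (subset_measure0 mCB (measurableC mD)) => //; exact: subIsetl.
rewrite {1}e measureU//; last by rewrite setIACA setICr set0I.
by rewrite [X in (_ + X)%E]z adde0.
Qed.

Lemma cintegral_conc (T : ptopologicalType) (m : {measure set (borel T) -> \bar R})
    (D : set T) (f : T -> R[i]) : measurable (D : set (borel T)) -> m (~` D) = 0%E ->
  cmeas setT f -> cintegral m setT f = cintegral m D f.
Proof.
move=> mD m0 mf; apply: (@cintegral_transport T T m m D setT id) => //.
by move=> B mB _; exact: measure_conc.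
Qed.

End ComplexIntegral.

Lemma involution_continuous (R : realType) (K : ptopGroupoidType) (f : K -> R[i]) :
  continuous (f : K -> R[i]^o) -> continuous (involution f : K -> R[i]^o).
Proof.
move=> cf x; have ci : {for x, continuous (fun y => f (ginv y) : R[i]^o)}.
  by apply: continuous_comp; [exact: ginv_continuous|exact: cf].
have /(@cvgC_Re R) h1 := ci; have /(@cvgC_Im R) h2 := ci.
apply: cvgC_ReIm.
  rewrite (_ : (fun y => _) = (fun y => complex.Re (f (ginv y)))).
    rewrite (_ : complex.Re (involution f x) = complex.Re (f (ginv x))); last exact: Rec_conj.
    exact: h1.
  by apply/funext => y; rewrite /involution Rec_conj.
rewrite (_ : (fun y => _) = (fun y => - complex.Im (f (ginv y)))).
  rewrite (_ : complex.Im (involution f x) = - complex.Im (f (ginv x))); last exact: Imc_conj.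
  exact: cvgN.
by apply/funext => y; rewrite /involution Imc_conj.
Qed.

(** * Morphisms that push one family of measures forward to another *)

Section PushMorphism.
Variables (R : realType) (G H : ptopGroupoidType) (h : G -> H).
Hypotheses (hG : hausdorff_space G) (hH : hausdorff_space H).
Hypotheses (mh : groupoid_morphism h) (ch : continuous h).
Variables (m : G -> {measure set (borel G) -> \bar R})
  (n : H -> {measure set (borel H) -> \bar R}).
Hypothesis push : forall x, units x -> forall B : set (borel H), measurable B ->
  n (h x) B = m x (h @^-1` B).
Hypothesis conc : forall x, units x -> m x (~` gfiber x) = 0%E.

Lemma gfiber_borel (K : ptopGroupoidType) (x : K) : hausdorff_space K ->
  measurable (gfiber x : set (borel K)).
Proof. by move=> hK; apply: closed_borel; exact: gfiber_closed. Qed.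

Lemma morphism_units x : units x -> units (h x).
Proof. by case: mh => hs _ _; rewrite /units /= hs => ->. Qed.

Lemma morphism_inv a : h (ginv a) = ginv (h a).
Proof.
case: mh => hs hr hm.
have ha : gsrc (h a) = grng (h (ginv a)) by rewrite hs hr grng_inv.
have e : gmul (h a) (h (ginv a)) = gsrc (ginv (h a)).
  by rewrite -hm ?grng_inv// gmulV -hr gsrc_inv.
have := gmul_rng (h (ginv a)).
by rewrite -ha -gmulVl -gmulA ?gsrc_inv// e gmul_src => <-.
Qed.

Lemma push_measurable D : measurable (D : set (borel G)) ->
  measurable_fun (D : set (borel G)) (h : borel G -> borel H).
Proof. by move=> mD; apply: cont_map_borel => //; exact: continuous_subspaceT. Qed.

Lemma preimage_borel (B : set H) : measurable (B : set (borel H)) ->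
  measurable (h @^-1` B : set (borel G)).
Proof. by move=> mB; rewrite -[X in measurable X]setTI; apply: push_measurable. Qed.

Lemma push_conc x : units x -> n (h x) (~` gfiber (h x)) = 0%E.
Proof.
move=> ux; rewrite push//; last by apply: measurableC; exact: gfiber_borel.
apply: (subset_measure0 _ (measurableC (gfiber_borel x hG))); last exact: conc.
  by apply: preimage_borel; apply: measurableC; exact: gfiber_borel.
move=> a /= na ax; apply: na; case: mh => hs _ _.
by rewrite /gfiber /= hs; congr h.
Qed.

Lemma push_cintegral x (f : H -> R[i]) : units x -> cmeas (gfiber (h x)) f ->
  cintegral (n (h x)) (gfiber (h x)) f = cintegral (m x) (gfiber x) (fun a => f (h a)).
Proof.
move=> ux mf; apply: (@cintegral_transport R G H) => //.
- exact: gfiber_borel.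
- exact: gfiber_borel.
- by apply: push_measurable; exact: gfiber_borel.
- by move=> a ax; case: mh => hs _ _; rewrite /gfiber /= hs; congr h.
- move=> B mB _; rewrite push//; apply: measure_conc; last exact: conc.
    exact: gfiber_borel.
  exact: preimage_borel.
Qed.

Lemma push_cintegralT x (f : H -> R[i]) : units x -> cmeas setT f ->
  cintegral (n (h x)) setT f = cintegral (m x) setT (fun a => f (h a)).
Proof.
move=> ux mf; apply: (@cintegral_transport R G H) => //.
  exact: push_measurable.
by move=> B mB _; rewrite setTI push.
Qed.

Lemma conv_within (K : ptopGroupoidType) (f g : K -> R[i]) (a : K) :
  continuous (f : K -> R[i]^o) -> continuous (g : K -> R[i]^o) ->
  {within gfiber (gsrc a), continuous (fun b => f (gmul a (ginv b)) * g b : R[i]^o)}.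
Proof.
move=> cf cg; apply/subspace_continuousP => b bx.
apply: (@cvgM R[i]); last by apply: cvg_within_filter; exact: cg.
have ab : gsrc a = grng (ginv b) by rewrite grng_inv.
apply: (@cvg_comp _ _ _ (fun b => gmul a (ginv b)) f _ (nbhs (gmul a (ginv b)))); last exact: cf.
apply: (@cvg_trans _ ((fun p => gmul p.1 p.2) @ within (@composable K) (nbhs (a, ginv b)))).
  move=> A /= hA.
  have h1 : nbhs (a, ginv b) [set p | composable p -> A (gmul p.1 p.2)] := hA.
  have cab : (fun y => (a, ginv y)) @ b --> (a, ginv b).
    by apply: cvg_pair; [exact: cvg_cst|exact: ginv_continuous].
  have h2 : \forall y \near b, composable (a, ginv y) -> A (gmul a (ginv y)) := cab _ h1.
  rewrite /nbhs /=; apply: filterS h2 => y hy yx; apply: hy.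
  by rewrite /composable /= grng_inv; move: yx; rewrite /gfiber /= => ->.
exact: (@mul_cvg K (a, ginv b) ab).
Qed.

Lemma pullback_convolution (f g : H -> R[i]) : Cc f -> Cc g ->
  pullback h (convolution n f g) = convolution m (pullback h f) (pullback h g).
Proof.
move=> cf cg; apply/funext => a; rewrite /pullback /convolution.
case: (mh) => hs hr hm.
rewrite hs push_cintegral//; last 2 first.
- exact: units_src.
- apply: cmeas_within; first exact: gfiber_borel.
  by rewrite -hs; apply: conv_within; [case: cf|case: cg].
apply: eq_cintegral => b bx.
by rewrite hm ?morphism_inv// grng_inv.
Qed.

Lemma pullback_involution (f : H -> R[i]) :
  pullback h (involution f) = involution (pullback h f).
Proof. by apply/funext => a; rewrite /pullback /involution morphism_inv. Qed.

Hypothesis ph : proper_map h.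

Lemma pullback_Cc (f : H -> R[i]) : Cc f -> Cc (pullback h f).
Proof.
move=> /(CcP hH)[cf [K cK fK]]; apply/(CcP hG); split.
  by move=> x; apply: continuous_comp; [exact: ch|exact: cf].
by exists (h @^-1` K); [exact: ph|move=> x nK; exact: fK].
Qed.

Lemma push_Nnorm (f : H -> R[i]) : (forall z, units z -> exists2 x, units x & h x = z) ->
  continuous (f : H -> R[i]^o) ->
  ereal_sup [set (\int[m x]_a (Normc.normc (pullback h f a))%:E)%E | x in @units G] =
  ereal_sup [set (\int[n x]_a (Normc.normc (f a))%:E)%E | x in @units H].
Proof.
move=> hsurj cf; congr ereal_sup.
have E x : units x -> (\int[m x]_a (Normc.normc (pullback h f a))%:E)%E =
    (\int[n (h x)]_a (Normc.normc (f a))%:E)%E.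
  move=> ux; apply/esym/(@integral_transport _ _ (borel G) (borel H)) => //.
  - exact: push_measurable.
  - by move=> B mB _; rewrite setTI push.
  - by apply/measurable_EFinP; apply: cont_borel => //; exact: continuous_normc.
apply/seteqP; split=> [_ [x ux <-]|_ [z uz <-]].
  by exists (h x); [exact: morphism_units|rewrite E].
by have [x ux <-] := hsurj _ uz; exists x => //; rewrite E.
Qed.

Lemma push_I_norm (f : H -> R[i]) : (forall z, units z -> exists2 x, units x & h x = z) ->
  continuous (f : H -> R[i]^o) -> I_norm m (pullback h f) = I_norm n f.
Proof.
move=> hsurj cf; have cif := involution_continuous cf.
by rewrite /I_norm -(pullback_involution f) (push_Nnorm hsurj cf) (push_Nnorm hsurj cif).
Qed.

End PushMorphism.

(** * Measures on the quotient groupoid *)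

Section HaarConcentration.
Variables (R : realType) (G : ptopGroupoidType).
Variable mu : G -> {measure set (borel G) -> \bar R}.
Hypotheses (hG : hausdorff_space G) (hmu : haar_system mu).

(** Without a countable base, nullity off the support comes from inner regularity: a compact set
    disjoint from the support is covered by finitely many null open sets. *)
Lemma haar_conc x : units x -> mu x (~` gfiber x) = 0%E.
Proof.
move=> ux; case: hmu => /(_ _ ux)[[_ _ ir] supp] _ _.
have oF : open (~` gfiber x) by apply: closed_openC; exact: gfiber_closed.
rewrite (ir _ oF); apply/eqP; rewrite eq_le; apply/andP; split; last first.
  by apply: ereal_sup_ubound; exists set0; [split => //; exact: compact0|exact: measure0].
apply: ge_ereal_sup => _ [K [cK KF] <-].
have /choice[U UP] a : exists U : set G, K a -> [/\ open U, U a & mu x U = 0%E].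
  have [Ka|nK] := pselect (K a); last by exists set0.
  have /existsNP[U] : ~ msupport (mu x) a by rewrite supp; exact: KF.
  move=> /not_implyP[oU /not_implyP[Ua /negP]]; rewrite -leNgt => h.
  by exists U => _; split => //; apply/eqP; rewrite eq_le h measure_ge0.
have [a Ka|s sK sP] := compact_seq_cover cK (U := U).
  by have [oU Ua _] := UP a Ka; exact: open_nbhs_nbhs.
have [V [oV mV KV]] : exists V : set G, [/\ open V, mu x V = 0%E &
    forall y a, a \in s -> U a y -> V y].
  elim: s sK {sP} => [|a s IH] sK; first by exists set0; split => //; exact: open0.
  have [|V [oV mV KV]] := IH; first by move=> b bs; apply: sK; rewrite inE bs orbT.
  have [oU Ua mU] := UP a (sK a (mem_head _ _)).
  exists (U a `|` V); split; first exact: openU.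
    by apply: null_set_setU => //; exact: open_borel.
  move=> y b; rewrite inE => /predU1P[->|bs] Uy; first by left.
  by right; exact: (KV y b).
rewrite -mV; apply: le_measure; rewrite ?inE.
- by apply: closed_borel; exact: compact_closed.
- exact: open_borel.
- by move=> y /sP[a ]; exact: KV.
Qed.

(* The saturation [S] of the fibre over [x] is closed, and the open saturated *)
(* set [~` S] is null for [mu x]; being equally null for [mu (gsrc a)], it    *)
(* cannot contain the point [a] of the support.                               *)
Lemma haar_lift (M : nat -> G -> {measure set (borel G) -> \bar R}) (d : G -> G -> R) :
  M 0%N = mu -> good M d -> forall x a, units x -> d (gsrc a) x = 0 ->
    exists2 a', gsrc a' = x & d a a' = 0.
Proof.
move=> M0 gd x a ux ax; apply: contrapT => nex.
have [[[d0 ds dt d1] dc] pd] := (good_cpm gd, good_proper gd).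
have dge0 u v : 0 <= d u v by apply: pm_ge0.
have d0t u v w : d u v = 0 -> d v w = 0 -> d u w = 0.
  by move=> uv vw; have := dt u v w; have := dge0 u w; lra.
pose U := [set b | forall c, d b c = 0 -> gsrc c <> x].
have oU : open U.
  rewrite openE => b Ub.
  have [c bc|e e0 eP] := fibre_open_ball (U := ~` gfiber x) (good_cpm gd) pd
      (closed_openC (@gfiber_closed G hG x)) (x := b); first exact: Ub.
  apply: filterS (dc b e e0) => y by_ c yc; apply: eP.
  by have := dt b y c; rewrite yc addr0 => /le_lt_trans; apply.
have sU b c : d b c = 0 -> U b -> U c by move=> bc Ub e ce; apply: Ub; exact: d0t ce.
have := good_meas gd 0 (units_src a) ux ax oU sU; rewrite M0 => e.
have : mu x U = 0%E.
  have cF := @gfiber_closed G hG x.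
  apply: (subset_measure0 (open_borel oU) (open_borel (closed_openC cF)) _ (haar_conc ux)).
  by move=> b Ub; exact: (Ub b (d0 b)).
rewrite -e => mU0; case: hmu => /(_ _ (units_src a))[_ supp] _ _.
have : msupport (mu (gsrc a)) a by rewrite supp.
move=> /(_ U oU); rewrite mU0 ltxx => h; apply/notF/h => c ac cx.
by apply: nex; exists c.
Qed.

End HaarConcentration.

Section QuotientMeasure.
Variables (R : realType) (G : ptopGroupoidType) (d : gpm R G).
Variable m : {measure set (borel G) -> \bar R}.
Notation q := (qmap d).

Definition qpush (B : set (borel (quo d))) : \bar R := m (q @^-1` B).

Lemma qmap_preimage (B : set (quo d)) : measurable (B : set (borel (quo d))) ->
  measurable (q @^-1` B : set (borel G)).
Proof. exact: (preimage_borel (@qmap_cont _ _ d)). Qed.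

Lemma qpush0 : qpush set0 = 0%E. Proof. by rewrite /qpush preimage_set0 measure0. Qed.

Lemma qpush_ge0 B : (0 <= qpush B)%E. Proof. exact: measure_ge0. Qed.

Lemma qpush_sigma_additive : semi_sigma_additive qpush.
Proof.
move=> F mF tF mUF; rewrite /qpush preimage_bigcup.
apply: measure_semi_sigma_additive.
- by move=> n; exact: qmap_preimage.
- apply/trivIsetP => /= i j _ _ ij; rewrite -preimage_setI.
  by move/trivIsetP : tF => /(_ _ _ _ _ ij) ->//; rewrite preimage_set0.
- by rewrite -preimage_bigcup; exact: qmap_preimage.
Qed.

HB.instance Definition _ := isMeasure.Build _ _ _ qpush
  qpush0 qpush_ge0 qpush_sigma_additive.

(** Properness keeps compact sets of finite measure, and images of compact sets give inner
    regularity. Outer regularity needs saturated open sets, which a closed projection provides. *)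
Lemma qpush_radon : radon m -> radon qpush.
Proof.
move=> [mK mo mi]; have hG := @gd_haus _ _ d; split.
- by move=> K cK; apply: mK; exact: qmap_proper.
- move=> B mB; apply/eqP; rewrite eq_le; apply/andP; split.
    apply: le_ereal_inf_tmp => _ [U [oU BU] <-].
    by apply: le_measure; rewrite ?inE//; exact: open_borel.
  rewrite -[X in (_ <= X)%E]/(m (q @^-1` B)) (mo _ (qmap_preimage mB)).
  apply: le_ereal_inf_tmp => _ [U [oU BU] <-].
  (* The points whose whole fibre lies in [U]. *)
  pose V := ~` (q @` (~` U)).
  have oV : open V by apply: closed_openC; apply: qmap_closed; exact: open_closedC.
  apply: (@le_trans _ _ (qpush V)).
    apply: ereal_inf_lbound; exists V => //; split => // y By [x nUx xy].
    by apply: nUx; apply: BU; rewrite /= xy.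
  change (m (q @^-1` V) <= m U)%E.
  apply: le_measure; rewrite ?inE; [|exact: open_borel|].
    by apply: qmap_preimage; exact: open_borel.
  by move=> x Vx; apply: contrapT => nUx; apply: Vx; exists x.
- move=> U oU; apply/eqP; rewrite eq_le; apply/andP; split.
    have oqU : open (q @^-1` U) by move/continuousP : (@qmap_cont _ _ d); apply.
    rewrite -[X in (X <= _)%E]/(m (q @^-1` U)) (mi _ oqU); apply: ge_ereal_sup => _ [K [cK KU] <-].
    have cqK : compact (q @` K).
      by apply: continuous_compact => //; apply: continuous_subspaceT; exact: qmap_cont.
    apply: (@le_trans _ _ (qpush (q @` K))).
      change (m K <= m (q @^-1` (q @` K)))%E.
      apply: le_measure; rewrite ?inE; [by apply: closed_borel; exact: compact_closed| |].
        apply: qmap_preimage; apply: closed_borel; apply: compact_closed cqK.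
        exact: quo_haus.
      by move=> x Kx; exists x.
    by apply: ereal_sup_ubound; exists (q @` K) => //; split => // _ [x /KU ? <-].
  apply: ge_ereal_sup => _ [K [cK KU] <-].
  have mKs : measurable (K : set (borel (quo d))).
    by apply: closed_borel; apply: compact_closed cK; exact: quo_haus.
  by apply: le_measure; rewrite ?inE//; exact: open_borel.
Qed.

End QuotientMeasure.

Section QuotientFamily.
Variables (R : realType) (G : ptopGroupoidType) (d : gpm R G).
Variable m : G -> {measure set (borel G) -> \bar R}.
Hypothesis mR : forall x, units x -> radon (m x).
Hypothesis minv : forall x y, units x -> units y -> d x y = 0 ->
  forall U : set G, open U -> (forall a b, d a b = 0 -> U a -> U b) -> m x U = m y U.
Notation q := (qmap d).
Let hG : hausdorff_space G := @gd_haus _ _ d.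
Let hQ : hausdorff_space (quo d) := @quo_haus _ _ d.

(** The unit chosen above [y] is the source of its representative, since [qval y] need not be a unit
    when [y] is one. *)
Definition qfam (y : quo d) : {measure set (borel (quo d)) -> \bar R} :=
  @qpush R G d (m (gsrc (qval y))).

Lemma quo_unit (y : quo d) : units y -> exists2 x, units x & q x = y.
Proof. by move=> uy; exists (gsrc (qval y)); [exact: units_src|exact: uy]. Qed.

Lemma qfam_radon y : radon (qfam y).
Proof. by apply: qpush_radon; apply: mR; exact: units_src. Qed.

(** Preimages of open sets are open and saturated, so equivalent units give them the same measure;
    outer regularity of both push-forwards extends this to Borel sets. *)
Lemma qfam_push x : units x -> forall B : set (borel (quo d)), measurable B ->
  qfam (q x) B = m x (q @^-1` B).
Proof.
move=> ux B mB; have [_ mo _] := qfam_radon (q x).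
have [_ mo' _] := @qpush_radon R G d _ (mR ux).
rewrite (mo B mB) -[RHS]/(@qpush R G d (m x) B) (mo' B mB); congr ereal_inf.
have E (U : set (quo d)) : open U -> qfam (q x) U = @qpush R G d (m x) U.
  move=> oU; apply: minv => //; first exact: units_src.
  - by rewrite gd_sym -{1}ux; apply: gd_src; exact: qval_map.
  - by move/continuousP : (@qmap_cont _ _ d); apply.
  - by move=> a b /qmapP ab; rewrite /= ab.
by apply/seteqP; split => _ [U [oU BU] <-]; exists U => //; rewrite E.
Qed.

Hypothesis mC : forall f, Cc f ->
  {within @units G, continuous (fun x => cintegral (m x) setT f : R[i]^o)}.

Lemma qmap_Cc (f : quo d -> R[i]) : Cc f -> Cc (fun x => f (q x)).
Proof. exact: (pullback_Cc hG hQ (@qmap_cont _ _ d) (@qmap_proper _ _ d)). Qed.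

Lemma qfam_continuous (f : quo d -> R[i]) : Cc f ->
  {within @units (quo d), continuous (fun y => cintegral (qfam y) setT f : R[i]^o)}.
Proof.
move=> cf; apply: (@quo_within_continuous _ _ _ _ _ (@units G)).
- exact: units_closed.
- exact: quo_unit.
have /subspace_continuousP h := mC (qmap_Cc cf).
have E x : units x -> cintegral (qfam (q x)) setT f = cintegral (m x) setT (fun a => f (q a)).
  move=> ux; apply: (push_cintegralT (@qmap_cont _ _ d) qfam_push) => //.
  by apply: Cc_cmeas => //; exact: measurableT.
apply/subspace_continuousP => x ux.
change ((fun y => cintegral (qfam (q y)) setT f : R[i]^o) @ within (@units G) (nbhs x) -->
  (cintegral (qfam (q x)) setT f : R[i]^o)); rewrite E//.
apply: cvg_trans (h x ux); apply: near_eq_cvg.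
by apply: filterS (withinT (@units G) (nbhs_filter x)) => y uy; exact: esym (E y uy).
Qed.

End QuotientFamily.

Lemma rmul_within (G : ptopGroupoidType) (a : G) :
  {within gfiber (grng a), continuous (fun b => gmul b a)}.
Proof.
apply/subspace_continuousP => b bx.
apply: (@cvg_trans _ ((fun p => gmul p.1 p.2) @ within (@composable G) (nbhs (b, a)))).
  move=> A /= hA.
  have h1 : nbhs (b, a) [set p | composable p -> A (gmul p.1 p.2)] := hA.
  have cab : (fun y => (y, a)) @ b --> (b, a).
    by apply: cvg_pair; [exact: cvg_id|exact: cvg_cst].
  have h2 : \forall y \near b, composable (y, a) -> A (gmul y a) := cab _ h1.
  by rewrite /nbhs /=; apply: filterS h2 => y hy yx; exact: hy.
exact: (@mul_cvg G (b, a) bx).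
Qed.

Section TotalVariation.
Variables (R : realType) (T : ptopologicalType).

Lemma tv_norm_measure (m : {measure set (borel T) -> \bar R}) : tv_norm m = m setT.
Proof.
apply/eqP; rewrite eq_le; apply/andP; split.
  apply: ge_ereal_sup => _ [n [B [mB tB ->]]].
  have -> : (\sum_(i < n) `|m (B i)| = \sum_(i < n) m (B i))%E.
    by apply: eq_bigr => i _; rewrite gee0_abs.
  rewrite -(@measure_bigsetU_ord _ _ _ m n xpredT (fun i => B i))//.
    by apply: le_measure; rewrite ?inE//; apply: bigsetU_measurable.
  apply/trivIsetP => i j _ _ ij; move/trivIsetP : tB => /(_ i j I I); apply.
  by apply: contra_neq ij => /val_inj.
apply: ereal_sup_ubound; exists 1%N, (fun i => if i == 0%N then setT else set0); split.
- by move=> i; case: ifP.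
- apply/trivIsetP => i j _ _ ij; case: ifP => [/eqP i0|_]; last by rewrite set0I.
  by case: ifP => [/eqP j0|_]; [move: ij; rewrite i0 j0 eqxx|rewrite setI0].
- by rewrite big_ord1 /= gee0_abs.
Qed.

End TotalVariation.

(** * Haar system and amenability of the quotient *)

Section QuotientGroupoid.
Variables (R : realType) (G : ptopGroupoidType) (d : gpm R G).
Variables (K : nat -> set G) (eK : exhaustion K).
Notation q := (qmap d).
Let hG : hausdorff_space G := @gd_haus _ _ d.
Let hQ : hausdorff_space (quo d) := @quo_haus _ _ d.

Lemma quo_lc : lc_groupoid G -> lc_groupoid (quo d).
Proof.
move=> [_ lG oG]; split => //.
  move=> y _; have [L cL LP] := @gd_proper _ _ d (qval y).
  have cqL : compact (q @` L).
    by apply: continuous_compact => //; apply: continuous_subspaceT; exact: qmap_cont.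
  exists (q @` L); last by split => //; exact: compact_closed.
  have h : nbhs y (ball y (1 : R)) by exact: nbhsx_ballx.
  change (nbhs y [set z | [set: quo d] z -> (q @` L) z]).
  apply: filterS h => z yz _.
  exists (qval z); last exact: qmapK.
  by apply: LP; apply/qball; rewrite !qmapK.
move=> U oU.
have oqU : open (q @^-1` U) by move/continuousP : (@qmap_cont _ _ d); apply.
have [V oV VE] := oG _ oqU.
(* A unit of the quotient lies in this set when all units above it lie in [V]. By [gd_lift_rng], if
   one unit above it is the range of an arrow from the saturated preimage of [U], so are all the
   others. *)
exists (~` (q @` (@units G `&` ~` V))).
  apply: closed_openC; apply: qmap_closed; apply: closedI; first exact: units_closed.
  exact: open_closedC.
apply/seteqP; split.
  move=> _ [u Uu <-]; have [a au] := qmap_surj u; split; last exact: units_rng.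
  move=> [x [ux nVx] xr]; apply: nVx.
  have e : d (grng a) x = 0 by apply/qmapP; rewrite xr -au; exact/esym/qrngE.
  have [a' a'x aa'] := gd_lift_rng ux e.
  suff : (V `&` @units G) x by case.
  by rewrite -VE; exists a' => //; rewrite /= -(iffRL (qmapP d a a') aa') au.
move=> y [ny uy]; have [x ux xy] := quo_unit uy.
have Vx : V x by apply: contrapT => nVx; apply: ny; exists x.
have : (grng @` (q @^-1` U)) x by rewrite VE.
move=> [a Ua ax]; exists (q a) => //.
by rewrite -xy -ax; exact: qrngE.
Qed.

Lemma quo_second_countable : @second_countable (quo d).
Proof.
have [c cP] := cpm_dense eK (gd_cpm d).
pose f (p : nat * nat) : set (quo d) := (ball (q (c p.1)) (p.2.+1%:R^-1 : R))°.
exists (range f); first by apply: (sub_countable (card_image_le _ _)); exact: countableP.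
split; first by move=> _ [p _ <-]; exact: open_interior.
move=> y V /nbhs_ballP [] _/posnumP[e] eV.
have e2 : 0 < e%:num / 2 by rewrite divr_gt0.
have [N _ hN] := [elaborate near_infty_natSinv_lt (PosNum e2)].
have {hN} Ne := hN N (leqnn N).
have N0 : 0 < N.+1%:R^-1 :> R by rewrite invr_gt0.
have [i iP] := cP (qval y) _ N0.
have yi : ball (q (c i)) (N.+1%:R^-1 : R) y by rewrite -(qmapK y); apply/qball.
exists (f (i, N)).
  split; first by exists (i, N).
  have [N' N'0 hN'] : exists2 e', 0 < e' & ball y e' `<=` ball (q (c i)) (N.+1%:R^-1 : R).
    exists (N.+1%:R^-1 - d (c i) (qval y)); first by rewrite subr_gt0.
    move=> z yz; rewrite -(qmapK z); apply/qball.
    have h : d (qval y) (qval z) < N.+1%:R^-1 - d (c i) (qval y) by apply/qball; rewrite !qmapK.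
    have := gd_tri d (c i) (qval y) (qval z); move: h.
    by move: (N.+1%:R^-1) => r; lra.
  by apply/nbhs_ballP; exists N'.
move=> z /interior_subset /= zi; apply: eV.
rewrite [e%:num]splitr; apply: (@ball_triangle _ _ (q (c i))).
  by apply: ball_sym; apply: le_ball yi; exact: ltW.
by apply: le_ball zi; exact: ltW.
Qed.

Lemma quo_haar (mu : G -> {measure set (borel G) -> \bar R}) : haar_system mu ->
  (forall x y, units x -> units y -> d x y = 0 ->
    forall U : set G, open U -> (forall a b, d a b = 0 -> U a -> U b) -> mu x U = mu y U) ->
  haar_system (qfam (d := d) mu).
Proof.
move=> hmu minv.
have mR x : units x -> radon (mu x) by move=> ux; case: hmu => /(_ x ux)[].
have push := qfam_push mR minv.
have conc := haar_conc hG hmu.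
have qpc := push_conc hG hQ (qmap_morphism d) (@qmap_cont _ _ d) push conc.
split.
- move=> y uy; split; first exact: qfam_radon.
  have [x ux xy] := quo_unit uy; apply/seteqP; split=> z.
    move=> zs; apply: contrapT => nz; rewrite -xy in zs nz.
    have oF : open (~` gfiber (q x)) by apply: closed_openC; exact: gfiber_closed.
    by have := zs _ oF nz; rewrite qpc// ltxx.
  have [a az] := qmap_surj z => zy U oU Uz.
  have e : d (gsrc a) x = 0 by apply/qmapP; rewrite xy -zy -az; exact/esym/qsrcE.
  (* The lift into the fibre of [x] is a point above [z] in the support of [mu x]. *)
  have [a' a'x aa'] := gd_lift ux e.
  rewrite -xy push//; last exact: open_borel.
  case: hmu => /(_ x ux)[_ supp] _ _.
  have : msupport (mu x) a' by rewrite supp.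
  apply; first by move/continuousP : (@qmap_cont _ _ d); apply.
  by rewrite /= -(iffRL (qmapP d a a') aa') az.
- move=> f cf; case: hmu => _ hc _; exact: (qfam_continuous mR minv hc cf).
- move=> y f cf; have [a <-] := qmap_surj y; case: (qmap_morphism d) => hs hr hm.
  rewrite hs hr.
  rewrite (push_cintegral hG hQ (qmap_morphism d) (@qmap_cont _ _ d) push conc (units_rng a)); last first.
    apply: cmeas_within; first exact: gfiber_borel.
    rewrite -hr; apply/subspace_continuousP => b bx.
    apply: (@cvg_comp _ _ _ (fun b => gmul b (q a)) f _ (nbhs (gmul b (q a)))).
      exact: (iffLR (subspace_continuousP _ _) (@rmul_within _ (q a)) b bx).
    by case: cf => cf _; exact: cf.
  rewrite (push_cintegral hG hQ (qmap_morphism d) (@qmap_cont _ _ d) push conc (units_src a)); last first.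
    by apply: Cc_cmeas => //; exact: gfiber_borel.
  case: hmu => _ _ /(_ a _ (qmap_Cc cf)) <-.
  by apply: eq_cintegral => b bx; rewrite hm.
Qed.

(** Push-forward does not increase the total variation, because disjoint Borel families pull back to
    such families, and it commutes with translation; so the estimates on a compact set follow from
    those on its preimage. *)
Lemma quo_amenable (m : nat -> G -> {measure set (borel G) -> \bar R}) :
  (forall n x y, units x -> units y -> d x y = 0 ->
    forall U : set G, open U -> (forall a b, d a b = 0 -> U a -> U b) -> m n x U = m n y U) ->
  (forall n x, units x ->
        [/\ radon (m n x), (m n x setT < +oo)%E,
            (tv_norm (m n x) <= 1)%E & m n x (~` gfiber x) = 0%E]) ->
  (forall n f, Cc f -> {within @units G,
        continuous (fun x => cintegral (m n x) setT f : R[i]^o)}) ->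
  (forall K : set G, compact K -> K `<=` @units G ->
        forall e : R, 0 < e -> exists n0, forall n x, (n0 <= n)%N -> K x ->
          (`|tv_norm (m n x) - 1| < e%:E)%E) ->
  (forall K : set G, compact K ->
        forall e : R, 0 < e -> exists n0, forall n a, (n0 <= n)%N -> K a ->
          (tv_norm (fun B => m n (gsrc a) B - translate a (m n (grng a)) B)
             < e%:E)%E) ->
  top_amenable R (quo d).
Proof.
move=> minv m1 m2 m3 m4.
have mR n x : units x -> radon (m n x) by move=> ux; have [] := m1 n x ux.
have push n := qfam_push (mR n) (minv n).
have conc n x : units x -> m n x (~` gfiber x) = 0%E by move=> ux; have [] := m1 n x ux.
have tvE n y : tv_norm (qfam (d := d) (m n) y) = tv_norm (m n (gsrc (qval y))).
  by rewrite !tv_norm_measure.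
exists (fun n => qfam (m n)); split.
- move=> n y uy; have [h1 h2 h3 _] := m1 n _ (units_src (qval y)); split.
  + exact: (qfam_radon (mR n)).
  + exact: h2.
  + by rewrite tvE.
  + have [x ux <-] := quo_unit uy.
    by apply: (push_conc hG hQ (qmap_morphism d) (@qmap_cont _ _ d) (push n) (conc n)).
- by move=> n f cf; exact: (qfam_continuous (mR n) (minv n) (m2 n) cf).
- move=> L cL Lu e e0.
  have cqL : compact (q @^-1` L `&` @units G).
    by apply: compact_closedI; [exact: qmap_proper|exact: units_closed].
  have [n0 n0P] := m3 _ cqL (@subIsetr _ _ _) e e0.
  exists n0 => n y n0n Ly; rewrite tvE; apply: n0P => //; split; last exact: units_src.
  by have uy := Lu _ Ly; rewrite /= -[q _]/(gsrc y) uy.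
- move=> L cL e e0; have [n0 n0P] := m4 _ (qmap_proper cL) e e0.
  exists n0 => n y n0n Ly; have [a ay] := qmap_surj y; rewrite -ay in Ly *.
  apply: le_lt_trans (n0P n a n0n Ly).
  apply: ge_ereal_sup => _ [k [B [mB tB ->]]].
  apply: ereal_sup_ubound; exists k, (fun i => q @^-1` (B i)); split.
  + by move=> i; exact: qmap_preimage.
  + apply/trivIsetP => i j _ _ ij; rewrite -preimage_setI.
    by move/trivIsetP : tB => /(_ _ _ _ _ ij) ->//; rewrite preimage_set0.
  apply: eq_bigr => i _; congr (`| _ - _ |)%E.
    by case: (qmap_morphism d) => -> _ _; apply: push => //; exact: units_src.
  case: (qmap_morphism d) => hs hr hm.
  rewrite /translate hr.
  have mS : measurable (gfiber (q (grng a)) `&` [set b | B i (gmul b (q a))]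
      : set (borel (quo d))).
    rewrite -hr; have mF := gfiber_borel (grng (q a)) hQ.
    have h := @cont_map_borel (quo d) (quo d) _ _ mF (@rmul_within (quo d) (q a)).
    exact: (h mF (B i) (mB i)).
  rewrite push//; last exact: units_rng.
  (* The preimage also contains arrows whose source is merely equivalent to [grng a]; concentration
     on the fibre discards them. *)
  rewrite (measure_conc (gfiber_borel (grng a) hG) (qmap_preimage mS) (conc n _ (units_rng a))).
  congr (m n _ _); apply/seteqP; split=> b /=.
    by move=> [br [_ h]]; split => //; rewrite hm.
  move=> [br h]; split => //; split; first by rewrite /gfiber /= hs; congr q.
  by rewrite -hm.
Qed.

End QuotientGroupoid.

(** * The inverse system of quotients *)

Section System.
Variables (R : realType) (G : ptopGroupoidType).
Hypotheses (hG : hausdorff_space G) (lG : locally_compact [set: G]).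
Variables (K : nat -> set G) (eK : exhaustion K).
Variable M : nat -> G -> {measure set (borel G) -> \bar R}.
Hypothesis MR : forall k x, units x -> radon (M k x).
Hypothesis MC : forall k f, Cc f ->
  {within @units G, continuous (fun x => cintegral (M k x) setT f : R[i]^o)}.
Hypothesis hmu : haar_system (M 0%N).

Record gidx := Gidx { gi_gpm :> gpm R G ; gi_good : good M gi_gpm }.

Lemma gidx_exists (d0 : G -> G -> R) : cpm d0 -> exists a : gidx, forall x y, d0 x y <= a x y.
Proof.
move=> c0; have [d gd0 dd0] := good_exists hG lG eK MR MC c0.
pose g := Gpm hG (good_cpm gd0) (good_proper gd0) (good_src gd0) (good_rng gd0)
  (good_inv gd0) (good_mul gd0) (haar_lift hG hmu erefl gd0).
by exists (@Gidx g gd0).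
Qed.

(** Inclusion of null relations is what makes [gbond] independent of representatives; its continuity
    then follows from the quotient topology. *)
Definition gle (a b : gidx) : Prop := forall x y, b x y = 0 -> a x y = 0.

(** [csup] is null only where all its terms are, so an index dominating it lies above the whole
    sequence. *)
Lemma gle_ub (s : nat -> gidx) : exists b, forall n, gle (s n) b.
Proof.
have cs n : cpm (s n) := gd_cpm (s n).
have [b bP] := gidx_exists (csup_cpm cs).
exists b => n x y bxy; apply: (csup_eq0 cs n).
apply/eqP; rewrite eq_le; apply/andP; split; first by rewrite -bxy.
by apply: pm_ge0; case: (csup_cpm cs).
Qed.

Lemma gle_directed : directed_set gle.
Proof.
split.
- by have [a _] := gidx_exists (@pm0 R G).
- by move=> a x y.
- by move=> a b c ab bc x y /bc /ab.
- move=> a b; have [c cP] := gle_ub (fun n => if n is 0%N then a else b).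
  by exists c; split; [exact: (cP 0%N)|exact: (cP 1%N)].
Qed.

Definition gbond (a b : gidx) (y : quo b) : quo a := qmap a (qval y).

Lemma gbondE (a b : gidx) x : gle a b -> gbond a (qmap b x) = qmap a x.
Proof. by move=> ab; apply/qmapP; apply: ab; rewrite gd_sym qval_map. Qed.

Lemma gbond_comp_qmap (a b : gidx) : gle a b -> @gbond a b \o qmap b = qmap a.
Proof. by move=> ab; apply/funext => x; exact: gbondE. Qed.

Lemma gbond_cont (a b : gidx) : gle a b -> continuous (@gbond a b).
Proof. by move=> ab; apply: quo_continuous; rewrite gbond_comp_qmap//; exact: qmap_cont. Qed.

Lemma gbond_pc (a b : gidx) : gle a b -> pc_morphism (@gbond a b).
Proof.
move=> ab; have [as_ ar am] := qmap_morphism a; have [bs br bm] := qmap_morphism b.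
split; [split| |].
- by move=> y; have [x <-] := qmap_surj y; rewrite bs !gbondE// as_.
- by move=> y; have [x <-] := qmap_surj y; rewrite br !gbondE// ar.
- move=> y z; have [x <-] := qmap_surj y => /qlift_rng[w <- wx].
  by rewrite -bm// !gbondE// am.
- exact: gbond_cont.
move=> L cL; rewrite (_ : _ @^-1` L = qmap b @` (qmap a @^-1` L)).
  apply: continuous_compact; last exact: qmap_proper.
  by apply: continuous_subspaceT; exact: qmap_cont.
apply/seteqP; split=> y.
  by have [x <-] := qmap_surj y; rewrite /= gbondE// => h; exists x.
by move=> [x Lx <-]; rewrite /= gbondE.
Qed.

Lemma gbond_surj (a b : gidx) : gle a b -> forall y, exists x, @gbond a b x = y.
Proof.
by move=> ab y; have [x <-] := qmap_surj y; exists (qmap b x); exact: gbondE.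
Qed.

Lemma g_inverse_system : inverse_system gle gbond.
Proof.
split; first exact: gle_directed.
- by move=> a b ab; split; [exact: gbond_pc|exact: gbond_surj].
- by move=> a; apply/funext => y; exact: qmapK.
- move=> a b c ab bc; apply/funext => y /=; have [x <-] := qmap_surj y.
  rewrite (gbondE x bc) (gbondE x ab) gbondE//.
  by move=> u v /bc /ab.
Qed.

Lemma gidx_sub (x : G) (U : set G) : nbhs x U ->
  exists a : gidx, forall y, a x y < 1 -> U y.
Proof.
move=> nU; have [f [cf _ fx f0]] := urysohn_point R hG lG nU.
have [a aP] := gidx_exists (cpm_fun cf).
exists a => y ay; apply: contrapT => /f0 fy.
by have := aP x y; rewrite fx fy subr0 normr1 minxx leNgt ay.
Qed.

Lemma gidx_sep (x y : G) : (forall a : gidx, qmap a x = qmap a y) -> x = y.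
Proof.
move=> h; apply: hG => A B nA nB; have [a aP] := gidx_sub nA.
exists y; split; last exact: nbhs_singleton.
by apply: aP; have /qmapP -> := h a; rewrite ltr01.
Qed.

(** Equality in [G] is tested by all projections and continuity into [G] by unit balls of single
    indices; what has to be constructed is a point above each compatible family. *)
Lemma g_inverse_limit : is_inverse_limit gle gbond (fun a : gidx => qmap a).
Proof.
split; first by split=> [a|a b ab]; [exact: qmap_pc|exact: gbond_comp_qmap].
move=> H h [hpc hcomp].
have [[a0] _ _ dir] := gle_directed.
have /choice[k kP] (y : H) : exists x : G, forall a : gidx, qmap a x = h a y.
  pose C (a : gidx) : set G := [set x | qmap a x = h a y].
  have C0 a : C a !=set0 by have [x xh] := qmap_surj (h a y); exists x.
  have Cle a b : gle a b -> C b `<=` C a.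
    move=> ab x; rewrite /C /= => bx.
    by rewrite -(gbondE x ab) bx -(hcomp a b ab).
  have Ccl a : closed (C a).
    rewrite (_ : C a = qmap a @^-1` [set h a y])//.
    apply: (iffLR (continuous_closedP _) (@qmap_cont _ _ a)).
    by apply: accessible_closed_set1; apply: hausdorff_accessible; exact: quo_haus.
  have Cc a : compact (C a).
    by rewrite (_ : C a = qmap a @^-1` [set h a y])//; apply: qmap_proper; exact: compact_set1.
  (* The fibres above the family are non-empty, compact and directed, so the filter they generate
     has a cluster point; being closed, every fibre contains it. *)
  have FF : ProperFilter (filter_from [set: gidx] C).
    apply: filter_from_proper; last by move=> a _; exact: C0.
    apply: filter_from_filter; first by exists a0.
    move=> a b _ _; have [c [ac bc]] := dir a b; exists c => // x Cx.
    by split; [exact: (Cle a c)|exact: (Cle b c)].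
  have [|x [_ xcl]] := Cc a0 (filter_from [set: gidx] C) FF; first by exists a0.
  exists x => a; apply: (Ccl a) => B nB.
  have [|z [Caz Bz]] := xcl (C a) B _ nB; first by exists a.
  by exists z.
have kE (a : gidx) : qmap a \o k = h a by apply/funext => y; exact: kP.
have kc : continuous k.
  move=> y A nA; have [a aP] := gidx_sub nA.
  have [_ hc _] := hpc a.
  have nb : nbhs (h a y) (ball (h a y) (1 : R)) by exact: nbhsx_ballx.
  have h1 : \forall z \near y, ball (h a y) (1 : R) (h a z) := hc y _ nb.
  have h2 : \forall z \near y, A (k z).
    apply: filterS h1 => z yz; apply: aP.
    by apply/qball; rewrite !kP.
  exact: h2.
exists k; split.
  split=> //; split => //.
    split=> [y|y|y z yz]; apply: gidx_sep => a; have [[as_ ar am] _ _] := qmap_pc a;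
      have [[hs hr hm] _ _] := hpc a.
    - by rewrite -as_ !kP hs.
    - by rewrite -ar !kP hr.
    (* Composability of [k y] and [k z] in [G] is itself to be shown, again by testing in every
       quotient. *)
    - rewrite kP hm// am ?kP//; apply: gidx_sep => b.
      have [[bs br _] _ _] := qmap_pc b; have [[hs' hr' _] _ _] := hpc b.
      by rewrite -bs -br !kP hs' hr' yz.
  move=> L cL; have [_ hc hp] := hpc a0.
  apply: (@subclosed_compact _ _ (h a0 @^-1` (qmap a0 @` L))).
  - by apply: (iffLR (continuous_closedP _) kc); exact: compact_closed.
  - apply: hp; apply: continuous_compact => //.
    by apply: continuous_subspaceT; exact: qmap_cont.
  - by move=> y Ly; exists (k y) => //; exact: kP.
move=> k' [_ k'E]; apply/funext => y; apply: gidx_sep => a.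
by rewrite kP -(k'E a).
Qed.

Lemma g_strong : strong_approximation (fun a : gidx => qmap a : G -> quo a).
Proof.
move=> W _ uW.
have /choice[D DP] (p : nat * nat) : exists d : G -> G -> R, cpm d /\
    forall x, exists2 B, W p.1 p.2 B & [set y | d x y < 1] `<=` B.
  have [_ [Q [oO cO OW]]] := uW p.1 p.2.
  have [d cd dP] := cover_cpm R hG lG eK oO cO.
  exists d; split => // x; have [B OB dB] := dP x.
  by have [B' WB' BB'] := OW B OB; exists B' => //; exact: subset_trans BB'.
pose E n := if unpickle n is Some p then D p else fun _ _ => 0.
have cE n : cpm (E n).
  by rewrite /E; case: unpickle => [p|]; [case: (DP p)|exact: pm0].
have [a aP] := gidx_exists (csup_cpm cE).
(* Points of the star of a ball are within three radii of its centre. With radius [2^-1 ^+ j.+2] and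
   the factor [2 ^+ j] that undoes the weight of slot [j], this gives 3/4, which is below 1. *)
exists a => l m; pose j := pickle (l, m); exists j.+2.
move=> _ [y _ <-]; have [x xy] := qmap_surj y.
have [_ hD] := DP (l, m); have [B WB dB] := hD x.
exists B => // z [_ [[w _ <-] [v [wv yv]]] wz]; apply: dB => /=.
have := csup_ge cE j x z; rewrite /E /j pickleK => h.
apply: (le_lt_trans h); apply: (@le_lt_trans _ _ (2 ^+ j * a x z)).
  by rewrite ler_pM2l ?exprn_gt0.
have e0 : 0 < 2^-1 ^+ j.+2 :> R by rewrite exprn_gt0// invr_gt0.
have [w' w'E] := qmap_surj w; rewrite -xy in yv; rewrite -w'E in wv wz.
have h1 := iffLR (qball _ _ _ _) yv; have h2 := iffLR (qball _ _ _ _) wv.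
have h3 := iffLR (qball _ _ _ _) wz.
have axz : a x z < 3 * 2^-1 ^+ j.+2.
  have := gd_tri a x v z; have := gd_tri a v w' z; rewrite (gd_sym a v w').
  by move: h1 h2 h3; move: (2^-1 ^+ j.+2 : R) => r; lra.
apply: (@lt_le_trans _ _ (2 ^+ j * (3 * 2^-1 ^+ j.+2))).
  by rewrite ltr_pM2l// exprn_gt0.
have e1 : 2 ^+ j * 2^-1 ^+ j = 1 :> R by rewrite -exprMn divff// expr1n.
rewrite !exprS; move: e1; move: (2 ^+ j : R) (2^-1 ^+ j : R) => u v' uv.
have -> : u * (3 * (2^-1 * (2^-1 * v'))) = 3 / 4 * (u * v') by field.
by rewrite uv; lra.
Qed.

Definition descend (a : gidx) (f : G -> R[i]) (y : quo a) : R[i] := f (qval y).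

Definition factors (a : gidx) (f : G -> R[i]) : Prop := forall x y, a x y = 0 -> f x = f y.

Lemma descendK (a : gidx) f : factors a f -> pullback (qmap a) (@descend a f) = f.
Proof.
move=> fa; apply/funext => x; rewrite /pullback /descend; apply: fa.
by rewrite gd_sym; exact: qval_map.
Qed.

Lemma descend_Cc (a : gidx) f : factors a f -> Cc f -> Cc (@descend a f).
Proof.
move=> fa /(CcP hG)[cf [L cL fL]]; apply/(CcP (@quo_haus _ _ a)); split.
  apply: (@quo_continuous _ _ _ R[i]^o).
  by rewrite (_ : _ \o _ = f)//; exact: descendK.
exists (qmap a @` L).
  by apply: continuous_compact => //; apply: continuous_subspaceT; exact: qmap_cont.
move=> y ny; rewrite /descend; apply: fL => Ly; apply: ny; exists (qval y) => //.
exact: qmapK.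
Qed.

Lemma factors_le (a b : gidx) f : gle a b -> factors a f -> factors b f.
Proof. by move=> ab fa x y /ab; exact: fa. Qed.

Lemma factors_exists (f : G -> R[i]) : Cc f -> exists a, factors a f.
Proof.
move=> [/continuousC_comp[cr ci] _].
have [a aP] := gidx_exists (cpm_max (cpm_fun cr) (cpm_fun ci)).
exists a => x y axy; have := aP x y; rewrite axy ge_max => /andP[h1 h2].
have z (u : R) : Num.min 1 `|u| <= 0 -> u = 0.
  by rewrite ge_min leNgt ltr01 /= normr_le0 => /eqP.
by apply: complex_eqP; apply/eqP; rewrite -subr_eq0; apply/eqP; exact: z.
Qed.

Lemma factors_seq (u : nat -> G -> R[i]) : (forall n, Cc (u n)) ->
  exists a, forall n, factors a (u n).
Proof.
move=> cu; have /choice[s sP] n : exists a, factors a (u n) by exact: factors_exists.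
have [b bP] := gle_ub s.
by exists b => n; exact: factors_le (sP n).
Qed.

Lemma g_Cc : @Cc R G = \bigcup_a (pullback (qmap a) @` @Cc R (quo (gi_gpm a))).
Proof.
apply/seteqP; split=> f.
  move=> cf; have [a fa] := factors_exists cf; exists a => //.
  by exists (@descend a f); [exact: descend_Cc|exact: descendK].
move=> [a _ [g cg <-]]; exact: (pullback_Cc hG (@quo_haus _ _ a) (@qmap_cont _ _ a) (@qmap_proper _ _ a)).
Qed.

End System.

Arguments gbond {R G M} a b y.
Arguments descend {R G M} a f y.

Lemma urysohn_Crc (R : realType) (T : ptopologicalType) (L U : set T) :
  hausdorff_space T -> locally_compact [set: T] -> compact L -> open U -> L `<=` U ->
  exists f : T -> R, [/\ Crc f, forall x, 0 <= f x <= 1, forall x, L x -> f x = 1 &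
    forall x, ~ U x -> f x = 0].
Proof.
move=> hT lT cL oU LU; have [C cC LC] := compact_nbhs_compact lT cL.
have oV : open (U `&` C°) by apply: openI => //; exact: open_interior.
have [|f [cf f01 f1 f0]] := urysohn_compact R hT lT cL oV.
  by move=> x Lx; split; [exact: LU|exact: LC].
exists f; split => //; last by move=> x nU; apply: f0 => -[].
by split => //; exists C => // x nC; apply: f0 => -[_ /interior_subset].
Qed.

(** * Invariance of Haar systems *)

Section Translation.
Variables (R : realType) (G : ptopGroupoidType).
Hypotheses (hG : hausdorff_space G) (lG : locally_compact [set: G]).
Variables (K : nat -> set G) (eK : exhaustion K).
Variable mu : G -> {measure set (borel G) -> \bar R}.
Hypothesis hmu : haar_system mu.

Lemma haar_finite x (L : set G) : units x -> compact L -> (mu x L < +oo)%E.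
Proof. by move=> ux; case: hmu => /(_ x ux)[[h _ _] _] _ _; exact: h. Qed.

Variable a : G.
Let F := gfiber (grng a).
Let mF : measurable (F : set (borel G)) := gfiber_borel (grng a) hG.

Lemma rmul_fiber b : F b -> gfiber (gsrc a) (gmul b a).
Proof. by move=> Fb; rewrite /gfiber /= gsrc_mul. Qed.

Lemma rmul_borel : measurable_fun (F : set (borel G)) ((fun b => gmul b a) : borel G -> borel G).
Proof. by apply: cont_map_borel mF _; exact: rmul_within. Qed.

Lemma rmul_compact (L : set G) : compact L -> compact ((fun b => gmul b a) @` (L `&` F)).
Proof.
move=> cL; apply: continuous_compact.
  by apply: continuous_subspaceW (@rmul_within G a); exact: subIsetr.
by apply: compact_closedI => //; exact: gfiber_closed.
Qed.

Lemma rmul_preimage_compact (L : set G) : compact L ->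
  exists2 L' : set G, compact L' & forall b, F b -> L (gmul b a) -> L' b.
Proof.
move=> cL; exists ((fun c => gmul c (ginv a)) @` (L `&` gfiber (gsrc a))).
  apply: continuous_compact; last by apply: compact_closedI => //; exact: gfiber_closed.
  apply: continuous_subspaceW (@rmul_within G (ginv a)).
  by rewrite grng_inv; exact: subIsetr.
move=> b Fb Lb; exists (gmul b a); last by rewrite gmulK.
by split => //; exact: rmul_fiber.
Qed.

(** The formula of [translate] for [mu (grng a)], to be made a measure so that uniqueness of
    measures applies. *)
Definition tmeas (B : set (borel G)) : \bar R :=
  mu (grng a) (F `&` [set b | B (gmul b a)]).

Lemma tmeas_preimage (B : set G) : measurable (B : set (borel G)) ->
  measurable (F `&` [set b | B (gmul b a)] : set (borel G)).
Proof. by move=> mB; exact: (rmul_borel mF mB). Qed.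

Lemma tmeas0 : tmeas set0 = 0%E.
Proof. by rewrite /tmeas (_ : _ `&` _ = set0) ?measure0//; apply/seteqP; split => // b []. Qed.

Lemma tmeas_ge0 B : (0 <= tmeas B)%E. Proof. exact: measure_ge0. Qed.

Lemma tmeas_sigma_additive : semi_sigma_additive tmeas.
Proof.
move=> B mB tB mUB; rewrite /tmeas.
have e : F `&` [set b | (\bigcup_n B n) (gmul b a)] =
    \bigcup_n (F `&` [set b | B n (gmul b a)]).
  apply/seteqP; split=> b; first by move=> [Fb [n _ Bn]]; exists n.
  by move=> [n _ [Fb Bn]]; split => //; exists n.
rewrite e; apply: measure_semi_sigma_additive.
- by move=> n; exact: tmeas_preimage.
- apply/trivIsetP => /= i j _ _ ij; apply/seteqP; split => // b [[_ bi] [_ bj]].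
  move/trivIsetP : tB => /(_ i j I I ij) e0.
  by have : (B i `&` B j) (gmul b a) by []; rewrite e0.
- by rewrite -e; exact: tmeas_preimage.
Qed.

HB.instance Definition _ := isMeasure.Build _ _ _ tmeas
  tmeas0 tmeas_ge0 tmeas_sigma_additive.

Lemma rmul_Crc_integrable (f : G -> R) : Crc f ->
  (mu (grng a)).-integrable (F : set (borel G)) (EFin \o (fun b => f (gmul b a))).
Proof.
move=> cf; have [M M0 fM] := Crc_bounded cf; have [cf' [L cL fL]] := cf.
have [L' cL' LL'] := rmul_preimage_compact cL.
apply: (@bounded_vanish_integrable _ _ hG _ _ F _ M) => //.
- by move=> C cC; apply: haar_finite => //; exact: units_rng.
- apply: within_cont_borel => //; apply/subspace_continuousP => b Fb.
  apply: (@cvg_comp _ _ _ (fun b => gmul b a) f _ (nbhs (gmul b a))); last exact: cf'.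
  exact: (iffLR (subspace_continuousP _ _) (@rmul_within _ a) b Fb).
- by exists L' => // b Fb nL; apply: fL => Lb; apply: nL; exact: LL'.
Qed.

Lemma haar_invR (f : G -> R) : Crc f ->
  Rintegral (mu (grng a)) F (fun b => f (gmul b a)) = Rintegral (mu (gsrc a)) setT f.
Proof.
move=> cf; have cc := Crc_Cc hG cf; case: hmu => _ _ /(_ a _ cc) [] h _.
rewrite [LHS]h; have := cintegral_conc (gfiber_borel (gsrc a) hG)
  (haar_conc hG hmu (units_src a)) (Cc_cmeas measurableT cc).
by move=> [].
Qed.

(** The invariance axiom speaks of test functions only. For each inequality, inner regularity
    supplies a compact set, and a Urysohn function between that set, or its translate, and [U]
    carries the estimate across. *)
Lemma translation_open (U : set G) : open U -> mu (gsrc a) U = tmeas U.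
Proof.
move=> oU; have mU := open_borel oU; apply/eqP; rewrite eq_le; apply/andP; split.
  case: hmu => /(_ _ (units_src a))[[_ _ ir] _] _ _.
  rewrite (ir U oU); apply: ge_ereal_sup => _ [L [cL LU] <-].
  have [f [cf f01 f1 f0]] := urysohn_Crc R hG lG cL oU LU.
  have fin C : compact C -> (mu (gsrc a) C < +oo)%E by apply: haar_finite; exact: units_src.
  have /andP[h _] := Crc_squeeze hG fin cf f01 cL oU f1 f0.
  apply: (le_trans h); rewrite -haar_invR//.
  have mV := tmeas_preimage mU.
  have /andP[_ h2] := @Rintegral_squeeze _ _ (mu (grng a)) F set0 _ _ mF measurable0
     mV (rmul_Crc_integrable cf) (fun b _ => f01 (gmul b a)) (fun _ _ h => match h with end)
     (fun b Fb nb => f0 _ (fun h => nb (conj Fb h))).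
  by apply: (le_trans h2); rewrite setIAC setIid.
(* The translated set is only relatively open in the fibre; inner regularity of [mu (grng a)] is
   applied to an open set [V] of [G] that cuts it out. *)
have [V oV VE] : exists2 V, open V & V `&` F = F `&` [set b | U (gmul b a)].
  have /continuousP/(_ U oU)/open_subspaceP[V oV VE] := @rmul_within G a.
  by exists V => //; rewrite VE setIC.
rewrite /tmeas -VE setIC -(measure_conc mF (open_borel oV)); last first.
  by apply: haar_conc => //; exact: units_rng.
case: (hmu) => /(_ _ (units_rng a))[[_ _ ir] _] _ _.
rewrite (ir V oV); apply: ge_ereal_sup => _ [L [cL LV] <-].
have mL : measurable (L : set (borel G)) by apply: closed_borel; exact: compact_closed.
have LU : (fun b => gmul b a) @` (L `&` F) `<=` U.
  move=> _ [b [/LV Vb Fb] <-]; have : (V `&` F) b by [].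
  by rewrite VE => -[].
have [f [cf f01 f1 f0]] := urysohn_Crc R hG lG (rmul_compact cL) oU LU.
have fin C : compact C -> (mu (gsrc a) C < +oo)%E by apply: haar_finite; exact: units_src.
have /andP[_ h] := Crc_squeeze hG fin cf f01 (@compact0 _) oU (fun _ h => match h with end) f0.
apply: le_trans h; rewrite -haar_invR//.
rewrite (measure_conc mF mL); last by apply: haar_conc => //; exact: units_rng.
have /andP[h2 _] := @Rintegral_squeeze _ _ (mu (grng a)) F L setT _ mF mL
   measurableT (rmul_Crc_integrable cf) (fun b _ => f01 (gmul b a))
   (fun b Fb Lb => f1 _ (ex_intro2 _ _ b (conj Lb Fb) erefl))
   (fun _ _ nT => match nT I with end).
by rewrite setIC.
Qed.

(** The open sets are stable under intersection and generate the Borel sets, and the interiors of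
    the exhaustion cover [G] by sets of finite measure. *)
Lemma translation_invariance (B : set G) : measurable (B : set (borel G)) ->
  mu (gsrc a) B = mu (grng a) (F `&` [set b | B (gmul b a)]).
Proof.
move=> mB; apply: (@measure_unique _ R (borel G) (@open G) (fun n => (K n)°) erefl _ _ _
  (mu (gsrc a)) tmeas) => //.
- by move=> A A' oA oA'; exact: openI.
- by move=> n; exact: open_interior.
- rewrite -subTset => x _; have [n _ Kx] : (\bigcup_n K n) x by case: eK => _ _ ->.
  by exists n.+1 => //; case: eK => _ h _; exact: h.
- by move=> U oU; exact: translation_open.
- move=> n; apply: (@le_lt_trans _ _ (mu (gsrc a) (K n))).
    apply: le_measure; rewrite ?inE; [|by apply: closed_borel; apply: compact_closed => //; case: eK|exact: interior_subset].
    by apply: open_borel; exact: open_interior.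
  by apply: haar_finite; [exact: units_src|case: eK].
Qed.

End Translation.

Section HaarTransport.
Variables (R : realType) (G : ptopGroupoidType).
Hypotheses (hG : hausdorff_space G) (lG : locally_compact [set: G]).
Variables (K : nat -> set G) (eK : exhaustion K).
Variable mu : G -> {measure set (borel G) -> \bar R}.
Hypothesis hmu : haar_system mu.

Lemma haar_cintegral (a : G) (f : G -> R[i]) : cmeas (gfiber (gsrc a)) f ->
  cintegral (mu (gsrc a)) (gfiber (gsrc a)) f =
  cintegral (mu (grng a)) (gfiber (grng a)) (fun b => f (gmul b a)).
Proof.
move=> mf; apply: (@cintegral_transport R G G _ _ _ _ (fun b => gmul b a)) => //.
- exact: gfiber_borel.
- exact: gfiber_borel.
- exact: rmul_borel.
- exact: rmul_fiber.
- by move=> B mB _; exact: (translation_invariance hG lG eK hmu a mB).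
Qed.

Lemma haar_integral (a : G) (f : G -> \bar R) :
  measurable_fun (gfiber (gsrc a) : set (borel G)) f ->
  (\int[mu (gsrc a)]_(b in gfiber (gsrc a)) f b =
   \int[mu (grng a)]_(b in gfiber (grng a)) f (gmul b a))%E.
Proof.
move=> mf; apply: (@integral_transport _ _ (borel G) (borel G) _ _ _ _ _ (fun b => gmul b a)) => //.
- exact: gfiber_borel.
- exact: gfiber_borel.
- exact: rmul_borel.
- exact: rmul_fiber.
- by move=> B mB _; exact: (translation_invariance hG lG eK hmu a mB).
Qed.

Definition cintegrable (T : ptopologicalType) (m : {measure set (borel T) -> \bar R})
    (D : set T) (f : T -> R[i]) : Prop :=
  m.-integrable (D : set (borel T)) (EFin \o (fun x => complex.Re (f x))) /\
  m.-integrable (D : set (borel T)) (EFin \o (fun x => complex.Im (f x))).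

Lemma integrable_scale d (T : measurableType d) (m : {measure set T -> \bar R})
    (D : set T) (u : R) (h : T -> R) : measurable D -> m.-integrable D (EFin \o h) ->
  m.-integrable D (EFin \o (fun x => u * h x)).
Proof.
move=> mD ih; rewrite (_ : _ \o _ = (fun x => u%:E * (EFin \o h) x)%E); first exact: integrableZl.
by apply/funext => x.
Qed.

Lemma integrable_lin2 d (T : measurableType d) (m : {measure set T -> \bar R})
    (D : set T) (u v : R) (h k : T -> R) : measurable D ->
  m.-integrable D (EFin \o h) -> m.-integrable D (EFin \o k) ->
  m.-integrable D (EFin \o (fun x => u * h x + v * k x)).
Proof.
move=> mD ih ik.
rewrite (_ : _ \o _ = ((EFin \o (fun x => (u * h x)%R)) \+ (EFin \o (fun x => (v * k x)%R)))%E).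
  by apply: integrableD => //; exact: integrable_scale.
by apply/funext => x.
Qed.

Lemma cintegral_lin (T : ptopologicalType) (m : {measure set (borel T) -> \bar R})
    (D : set T) (f g : T -> R[i]) (z : R[i]) : measurable (D : set (borel T)) ->
  cintegrable m D f -> cintegrable m D g ->
  cintegral m D (fun x => z * f x + g x) = z * cintegral m D f + cintegral m D g.
Proof.
move=> mD [fr fi] [gr gi]; case: z => u v; apply: complex_eqP.
  rewrite Re_add Re_mul /cintegral /=.
  rewrite (_ : (fun x => _) = (fun x => (u * complex.Re (f x) + (- v) * complex.Im (f x)) + complex.Re (g x))); last first.
    by apply/funext => x; rewrite Re_add Re_mul mulNr.
  rewrite RintegralD//; last exact: integrable_lin2.
  rewrite RintegralD//; [|exact: integrable_scale|exact: integrable_scale].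
  by rewrite !RintegralZl// mulNr.
rewrite Im_add Im_mul /cintegral /=.
rewrite (_ : (fun x => _) = (fun x => (u * complex.Im (f x) + v * complex.Re (f x)) + complex.Im (g x))); last first.
  by apply/funext => x; rewrite Im_add Im_mul.
rewrite RintegralD//; last exact: integrable_lin2.
rewrite RintegralD//; [|exact: integrable_scale|exact: integrable_scale].
by rewrite !RintegralZl.
Qed.

Lemma cintegral_conj (T : ptopologicalType) (m : {measure set (borel T) -> \bar R})
    (D : set T) (f : T -> R[i]) : measurable (D : set (borel T)) -> cintegrable m D f ->
  cintegral m D (fun x => Num.conj (f x)) = Num.conj (cintegral m D f).
Proof.
move=> mD [fr fi]; apply: complex_eqP.
  rewrite Rec_conj /cintegral /=; congr (Rintegral _ _ _).
  by apply/funext => x; rewrite Rec_conj.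
rewrite Imc_conj /cintegral /=.
rewrite (_ : (fun x => _) = (fun x => -1 * complex.Im (f x))); last first.
  by apply/funext => x; rewrite Imc_conj mulN1r.
by rewrite RintegralZl// mulN1r.
Qed.

(** The function [Re (conj I * f x)] is at most [|I| |f x|] and integrates to [|I|^2]; dividing by
    [|I|] gives the bound. *)
Lemma cintegrable_normc (T : ptopologicalType) (m : {measure set (borel T) -> \bar R})
    (D : set T) (f : T -> R[i]) : measurable (D : set (borel T)) -> cintegrable m D f ->
  m.-integrable (D : set (borel T)) (EFin \o (fun x => Normc.normc (f x))) ->
  Normc.normc (cintegral m D f) <= Rintegral m D (fun x => Normc.normc (f x)).
Proof.
move=> mD [fr fi] fn; set I := cintegral m D f.
have [I0|I0] := eqVneq (Normc.normc I) 0.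
  by rewrite I0; apply: Rintegral_ge0 => x _; exact: normc_ge0.
have Ip : 0 < Normc.normc I by rewrite lt_neqAle eq_sym I0 normc_ge0.
set u := complex.Re I; set v := complex.Im I.
have cs (z : R[i]) : u * complex.Re z + v * complex.Im z <= Normc.normc I * Normc.normc z.
  have <- : complex.Re (Num.conj I * z) = u * complex.Re z + v * complex.Im z.
    by rewrite Re_mul Rec_conj Imc_conj mulNr opprK.
  apply: (le_trans (ler_norm _)); apply: (le_trans (normc_Re _)).
  by rewrite Normc.normcM normc_conj.
have sq : Normc.normc I * Normc.normc I = u * u + v * v.
  have := sqr_normc I; rewrite normcR -rmorphXn /= expr2.
  have -> : I * I^*%C = ((u * u + v * v)%:C)%C.
    by rewrite -/(Num.conj I); apply: complex_eqP;
      rewrite ?Re_mul ?Im_mul Rec_conj Imc_conj -/u -/v /=; ring.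
  by move=> [].
rewrite -(ler_pM2l Ip) sq -[X in _ <= X]RintegralZl//.
have -> : u * u + v * v = Rintegral m D (fun x => u * complex.Re (f x) + v * complex.Im (f x)).
  rewrite RintegralD//; [|exact: integrable_scale|exact: integrable_scale].
  by rewrite !RintegralZl.
apply: le_Rintegral => //; [exact: integrable_lin2|exact: integrable_scale].
Qed.

Lemma conv_integrable (f g : G -> R[i]) (a : G) : Cc f -> Cc g ->
  let F := fun b => f (gmul a (ginv b)) * g b in
  cintegrable (mu (gsrc a)) (gfiber (gsrc a)) F /\
  (mu (gsrc a)).-integrable (gfiber (gsrc a) : set (borel G))
    (EFin \o (fun b => Normc.normc (F b))).
Proof.
move=> cf cg F.
have [Mf Mf0 fM] := Crc_bounded (Cc_normc hG cf).
have [Mg Mg0 gM] := Crc_bounded (Cc_normc hG cg).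
have [_ [L cL gL]] := iffLR (CcP hG g) cg.
have mF := gfiber_borel (gsrc a) hG.
have cF : {within gfiber (gsrc a), continuous (F : G -> R[i]^o)}.
  by apply: conv_within; [case: cf|case: cg].
have [mr mi] := cmeas_within mF cF.
have nF b : Normc.normc (F b) <= Mf * Mg.
  rewrite Normc.normcM; apply: ler_pM; rewrite ?normc_ge0//.
    by apply: le_trans (fM _); rewrite ger0_norm// normc_ge0.
  by apply: le_trans (gM _); rewrite ger0_norm// normc_ge0.
have FL b : ~ L b -> F b = 0 by move=> /gL gb; rewrite /F gb mulr0.
have fin C : compact C -> (mu (gsrc a) C < +oo)%E.
  by apply: (haar_finite hmu); exact: units_src.
have M0 : 0 <= Mf * Mg by exact: mulr_ge0.
split; first split.
- apply: (@bounded_vanish_integrable _ _ hG _ fin _ _ _ mF mr _ M0).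
    by exists L => // b _ /FL ->.
  by move=> b _; apply: le_trans (nF b); exact: normc_Re.
- apply: (@bounded_vanish_integrable _ _ hG _ fin _ _ _ mF mi _ M0).
    by exists L => // b _ /FL ->.
  by move=> b _; apply: le_trans (nF b); exact: normc_Im.
- apply: (@bounded_vanish_integrable _ _ hG _ fin _ _ _ mF _ _ M0).
  + apply: within_cont_borel => //.
    have : continuous (F : subspace (gfiber (gsrc a)) -> R[i]^o) by exact: cF.
    exact: continuous_normc.
  + by exists L => // b _ /FL ->; rewrite Normc.normc0.
  + by move=> b _; apply: le_trans (nF b); rewrite ger0_norm// normc_ge0.
Qed.

Lemma involution_Cc (f : G -> R[i]) : Cc f -> Cc (involution f).
Proof.
move=> /(CcP hG)[cf [L cL fL]]; apply/(CcP hG); split; first exact: involution_continuous.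
exists (ginv @` L).
  by apply: continuous_compact => //; apply: continuous_subspaceT; exact: ginv_continuous.
move=> a na; rewrite /involution fL; first exact: conjC0.
by move=> La; apply: na; exists (ginv a) => //; exact: ginvK.
Qed.

(** Right invariance, replacing the variable [b] by [gmul b c], turns the integral on the right into
    the conjugate of the one on the left. *)
Lemma involution_convolution (f g : G -> R[i]) : Cc f -> Cc g ->
  involution (convolution mu f g) = convolution mu (involution g) (involution f).
Proof.
move=> cf cg; apply/funext => c; rewrite /convolution haar_cintegral; last first.
  apply: cmeas_within; first exact: gfiber_borel.
  by apply: conv_within; [case: (involution_Cc cg)|case: (involution_Cc cf)].
have [ci _] := conv_integrable (ginv c) cf cg.
rewrite /involution -(gsrc_inv c) -cintegral_conj//; last exact: gfiber_borel.
apply: eq_cintegral => b; rewrite /gfiber /= gsrc_inv => bc.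
rewrite rmorphM mulrC; congr (Num.conj (g _) * Num.conj (f _)).
  by rewrite ginvM ?grng_inv ?gsrc_mul// ginvK gmulK.
by rewrite ginvM.
Qed.

End HaarTransport.

(** * Convolution and the I-norm *)

Section Convolution.
Variables (R : realType) (G : ptopGroupoidType).
Hypotheses (hG : hausdorff_space G) (lG : locally_compact [set: G]).
Variables (K : nat -> set G) (eK : exhaustion K).
Variable mu : G -> {measure set (borel G) -> \bar R}.
Hypothesis hmu : haar_system mu.

Let fin x (ux : units x) : forall L : set G, compact L -> (mu x L < +oo)%E.
Proof. by move=> L cL; apply: (haar_finite hmu). Qed.

Lemma haar_Rintegral_continuous (f : G -> R) : Crc f ->
  continuous (fun a => Rintegral (mu (gsrc a)) setT f).
Proof.
move=> cf; case: hmu => _ /(_ _ (Crc_Cc hG cf)) hc _.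
by have /continuousC_comp[] := units_src_continuous hc.
Qed.

Lemma Rintegral_fiber x (f : G -> R) : units x -> continuous f ->
  Rintegral (mu x) (gfiber x) f = Rintegral (mu x) setT f.
Proof.
move=> ux cf; rewrite /Rintegral; congr fine; apply/esym.
apply: (@integral_transport _ _ (borel G) (borel G) _ (mu x) (mu x) (gfiber x) setT id) => //.
- exact: gfiber_borel.
- by move=> B mB _; apply: measure_conc => //; [exact: gfiber_borel|exact: haar_conc].
- by apply/measurable_EFinP; exact: cont_borel.
Qed.

Definition src_pairs : set (G * G) := [set p | gsrc p.1 = gsrc p.2].

(* Near [(a0, b)] the function [F] is almost constant, say [c b]; gluing the  *)
(* constants by a partition of unity on [L] gives [phi] in [Cc G] with        *)
(* [|F a - phi| <= e] on the fibre of [a], for all [a] near [a0].             *)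
Lemma fiber_integral_continuous (F : G -> G -> R) (L : set G) : compact L ->
  {within src_pairs, continuous (fun p : G * G => F p.1 p.2)} ->
  (forall a b, gsrc a = gsrc b -> ~ L b -> F a b = 0) ->
  continuous (fun a => Rintegral (mu (gsrc a)) (gfiber (gsrc a)) (F a)).
Proof.
move=> cL /subspace_continuousP cF FL a0; apply/cvgrPdist_lt => e e0.
have [C cC LC] := compact_nbhs_compact lG cL.
have [chi [cchi chi01 chi1 _]] := urysohn_Crc R hG lG cC openT (@subsetT _ _).
pose I h a := Rintegral (mu (gsrc a)) setT h.
pose B := I chi a0 + 1.
have B0 : 0 < B by rewrite ltr_pwDr//; apply: Rintegral_ge0 => x _; case/andP: (chi01 x).
(* Three errors of [e / 3]: replacing [F a] and [F a0] by [phi] costs at most [eps * B] each, as the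
   integral of [chi] stays below [B] near [a0], and the third is the variation of the integral of
   [phi]. *)
pose eps := e / (3 * B).
have eps0 : 0 < eps by rewrite divr_gt0// mulr_gt0.
have /choice[c cP] (b : G) : exists c : R, nbhs (a0, b)
    [set p | src_pairs p -> `|F p.1 p.2 - c| < eps].
  have [s0|s0] := pselect (src_pairs (a0, b)).
    exists (F a0 b); have /cvgrPdist_lt/(_ _ eps0) h := cF (a0, b) s0.
    have h' : \forall p \near (a0, b), src_pairs p -> `|F a0 b - F p.1 p.2| < eps := h.
    by apply: filterS h' => p hp sp; rewrite distrC; exact: hp.
  exists 0; have cl : closed src_pairs.
    apply: (@closed_eq_fun G hG (G * G)%type (fun p => gsrc p.1) (fun p => gsrc p.2)) => x.
      by apply: continuous_comp; [exact: cvg_fst|exact: gsrc_continuous].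
    by apply: continuous_comp; [exact: cvg_snd|exact: gsrc_continuous].
  have := closed_openC cl; rewrite openE => /(_ _ s0).
  by apply: filterS => p np /np.
have /choice[NV NVP] (b : G) : exists W : set G * set G, [/\ nbhs a0 W.1, nbhs b W.2 &
    forall x y, W.1 x -> W.2 y -> gsrc x = gsrc y -> `|F x y - c b| < eps].
  have [[N V] [/= nN nV] NV] := cP b.
  by exists (N, V); split => // x y Nx Vy xy; exact: (NV (x, y)).
have /choice[g gP] (b : G) : exists g : G -> R, L b -> [/\ continuous g, forall y, 0 <= g y <= 1,
    g b = 1 & forall y, ~ ((NV b).2 `&` C) y -> g y = 0].
  have [Lb|nL] := pselect (L b); last by exists (fun=> 0).
  have nb : nbhs b ((NV b).2 `&` C).
    by apply: filterI; [case: (NVP b)|exact: LC].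
  by have [g ?] := urysohn_point R hG lG nb; exists g.
have [b Lb|s sL sP] := compact_seq_cover cL (U := fun b => [set y | 1/2 < g b y]).
  have [cg _ gb _] := gP b Lb; apply: (cvgr_gt _ (cg b)); rewrite gb; lra.
have g0 b y : b \in s -> 0 <= g b y by move=> /sL Lb; have [_ /(_ y)/andP[]] := gP b Lb.
have gC b y : b \in s -> ~ C y -> g b y = 0.
  by move=> /sL Lb nC; have [_ _ _ ->//] := gP b Lb; move=> [].
pose S y := \sum_(b <- s) g b y.
have S0 y : 0 <= S y by rewrite /S big_seq; apply: sumr_ge0 => b /g0.
have SL y : L y -> 1/2 < S y.
  move=> /sP[b bs /= gb]; apply: (lt_le_trans gb).
  rewrite /S (big_rem b)//= lerDl big_seq; apply: sumr_ge0 => x /mem_rem; exact: g0.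
(* The denominator stays positive everywhere and equals [S] on [L], outside which [F a] vanishes on
   the fibre. *)
pose psi y := Num.max (S y) (1/2).
have psi0 y : 0 < psi y by rewrite /psi lt_max; apply/orP; right; lra.
pose phi y := (\sum_(b <- s) c b * g b y) / psi y.
have csum (w : G -> R) : continuous (fun y => \sum_(b <- s) w b * g b y).
  move=> y; elim: s sL {sP g0 gC S S0 SL psi psi0 phi} => [|b s IH] sL.
    by under eq_fun do rewrite big_nil; exact: cvg_cst.
  rewrite (_ : (fun y => _) = (fun y => w b * g b y) \+ (fun y => \sum_(b <- s) w b * g b y));
    last by apply/funext => z; rewrite big_cons.
  apply: cvgD.
    apply: cvgM; first exact: cvg_cst.
    by have [cg _ _ _] := gP b (sL _ (mem_head _ _)); exact: cg.
  by apply: IH => x xs; apply: sL; rewrite inE xs orbT.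
have cS : continuous S.
  rewrite (_ : S = (fun y => \sum_(b <- s) 1 * g b y)); first exact: csum.
  by apply/funext => y; apply: eq_bigr => b _; rewrite mul1r.
have cpsi : continuous psi.
  by move=> y; apply: (@continuous_max R G S (fun=> 1/2)); [exact: cS|exact: cst_continuous].
have phiC y : ~ C y -> phi y = 0.
  move=> nC; rewrite /phi big_seq big1 ?mul0r// => b bs.
  by rewrite gC// mulr0.
have cphi : Crc phi.
  split; last by exists C.
  move=> y; apply: cvgM; first exact: csum.
  by apply: cvgV; [rewrite gt_eqF|exact: cpsi].
have near_est : \forall a \near a0, forall b, b \in s -> (NV b).1 a.
  elim: s {sL sP g0 gC S S0 SL psi psi0 phi csum cS cpsi phiC cphi} => [|b s IH].
    by apply: nearW => a b; rewrite in_nil.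
  have [nb _ _] := NVP b; near=> a => x; rewrite inE => /predU1P[->|xs].
    by near: a.
  by move: x xs; near: a.
have est a : (forall b, b \in s -> (NV b).1 a) -> forall y, gsrc y = gsrc a ->
    `|F a y - phi y| <= eps * chi y.
  move=> Na y ya; have [Cy|nC] := pselect (C y); last first.
    have nL : ~ L y by move=> Ly; apply: nC; apply: interior_subset; exact: LC.
    rewrite phiC// FL// subr0 normr0; apply: mulr_ge0; first exact: ltW.
    by case/andP: (chi01 y).
  rewrite chi1// mulr1.
  have FS : F a y * S y = F a y * psi y.
    have [Ly|nL] := pselect (L y); last by rewrite FL// !mul0r.
    by congr (_ * _); rewrite /psi; apply/esym/max_idPl/ltW; exact: SL.
  have -> : F a y - phi y = (\sum_(b <- s) (F a y - c b) * g b y) / psi y.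
    rewrite /phi; under [in RHS]eq_bigr do rewrite mulrBl.
    rewrite sumrB -mulr_sumr -/(S y) FS mulrBl mulfK// gt_eqF//.
  rewrite normrM normfV (gtr0_norm (psi0 y)) ler_pdivrMr//.
  apply: (@le_trans _ _ (eps * S y)); last by rewrite ler_pM2l// /psi le_max lexx.
  apply: (le_trans (ler_norm_sum _ _ _)); rewrite /S mulr_sumr big_seq [leRHS]big_seq.
  apply: ler_sum => b bs; rewrite normrM (ger0_norm (g0 b y bs)).
  have [_ _ _ gz] := gP b (sL b bs).
  have [[Vy _]|nV] := pselect (((NV b).2 `&` C) y); last by rewrite gz// !mulr0.
  apply: ler_wpM2r; first exact: g0.
  by apply: ltW; have [_ _ h] := NVP b; apply: h => //; exact: Na.
have [Mp Mp0 phiM] := Crc_bounded cphi.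
have key a : (forall b, b \in s -> (NV b).1 a) ->
    `|Rintegral (mu (gsrc a)) (gfiber (gsrc a)) (F a) - I phi a| <= eps * I chi a.
  move=> Na; have ua := units_src a; have mFb := gfiber_borel (gsrc a) hG.
  have mFa : measurable_fun (gfiber (gsrc a) : set (borel G)) (F a).
    apply: within_cont_borel => //; apply/subspace_continuousP => y ya.
    apply: (@cvg_trans _ ((fun p : G * G => F p.1 p.2) @ within src_pairs (nbhs (a, y)))).
      move=> A /= hA.
      have h1 : nbhs (a, y) [set p | src_pairs p -> A (F p.1 p.2)] := hA.
      have cab : (fun z => (a, z)) @ y --> (a, y).
        by apply: cvg_pair; [exact: cvg_cst|exact: cvg_id].
      have h2 : \forall z \near y, src_pairs (a, z) -> A (F a z) := cab _ h1.
      rewrite /nbhs /=; apply: filterS h2 => z hz za; apply: hz.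
      by rewrite /src_pairs /=; symmetry.
    by apply: (cF (a, y)); rewrite /src_pairs /=; symmetry.
  have iphi : (mu (gsrc a)).-integrable (gfiber (gsrc a) : set (borel G)) (EFin \o phi).
    by apply: (Crc_integrable hG (fin ua)).
  have ichi : (mu (gsrc a)).-integrable (gfiber (gsrc a) : set (borel G)) (EFin \o chi).
    by apply: (Crc_integrable hG (fin ua)).
  have iF : (mu (gsrc a)).-integrable (gfiber (gsrc a) : set (borel G)) (EFin \o (F a)).
    apply: (@bounded_vanish_integrable _ _ hG _ (fin ua) _ _ (Mp + eps)) => //.
    - by exists L => // y ya nL; apply: FL.
    - by rewrite addr_ge0// ltW.
    - move=> y ya; rewrite -(subrK (phi y) (F a y)); apply: (le_trans (ler_normD _ _)).
      rewrite addrC; apply: lerD; first exact: phiM.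
      apply: (le_trans (est a Na y ya)); case/andP: (chi01 y) => _ h.
      by rewrite ler_piMr// ltW.
  rewrite /I -!(Rintegral_fiber ua) //; [|by case: cchi|by case: cphi].
  rewrite -RintegralB//.
  have iB : (mu (gsrc a)).-integrable (gfiber (gsrc a) : set (borel G))
      (EFin \o (fun x => F a x - phi x)).
    rewrite (_ : _ \o _ = (EFin \o F a) \- (EFin \o phi))%E; first exact: integrableB.
    by apply/funext => x.
  apply: (le_trans (le_normr_Rintegral _ _)) => //.
  rewrite -RintegralZl//; apply: le_Rintegral => //.
  - exact: (integrable_norm iB).
  - exact: integrable_scale.
  - by move=> y ya; exact: est.
have cI : \forall a \near a0, `|I phi a0 - I phi a| < e / 3.
  by have /cvgrPdist_lt := @haar_Rintegral_continuous phi cphi a0; apply; rewrite divr_gt0.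
have cB : \forall a \near a0, I chi a < B.
  by apply: (cvgr_lt _ (@haar_Rintegral_continuous chi cchi a0)); rewrite /B ltrDl.
have e3 : eps * B = e / 3 by rewrite /eps; field; rewrite gt_eqF.
have k0 : `|Rintegral (mu (gsrc a0)) (gfiber (gsrc a0)) (F a0) - I phi a0| <= e / 3.
  have Na0 b : b \in s -> (NV b).1 a0.
    by move=> _; have [h _ _] := NVP b; exact: nbhs_singleton h.
  have h := key a0 Na0.
  apply: (le_trans h); rewrite -e3 ler_pM2l// /B lerDl//.
pose J (a : G) : R := Rintegral (mu (gsrc a)) (gfiber (gsrc a)) (F a).
have cJ : \forall a \near a0, `|J a - I phi a| <= e / 3.
  apply: filterS2 near_est cB => a Na Ba; apply: (le_trans (key a Na)).
  by rewrite -e3 ler_pM2l// ltW.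
apply: filterS2 cI cJ => a h1 h3.
rewrite -!/(J _) in k0 *.
move: k0 h1 h3; rewrite !ler_norml !ltr_norml.
move: (J a0) (J a) (I phi a0) (I phi a) => u1 u2 u3 u4.
lra.
Unshelve. all: by end_near. Qed.

Lemma conv_within_src_pairs (f g : G -> R[i]) :
  continuous (f : G -> R[i]^o) -> continuous (g : G -> R[i]^o) ->
  {within src_pairs, continuous (fun p : G * G => f (gmul p.1 (ginv p.2)) * g p.2 : R[i]^o)}.
Proof.
move=> cf' cg'.
apply/subspace_continuousP => p sp.
apply: (@cvgM R[i]); last first.
  apply: cvg_within_filter; apply: continuous_comp; [exact: cvg_snd|exact: cg'].
apply: (@cvg_comp _ _ _ (fun p : G * G => gmul p.1 (ginv p.2)) f _ (nbhs (gmul p.1 (ginv p.2))));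
  last exact: cf'.
have cp : composable (p.1, ginv p.2) by rewrite /composable /= grng_inv.
apply: (@cvg_trans _ ((fun p => gmul p.1 p.2) @ within (@composable G) (nbhs (p.1, ginv p.2)))).
  move=> A /= hA.
  have h1 : nbhs (p.1, ginv p.2) [set p | composable p -> A (gmul p.1 p.2)] := hA.
  have cab : (fun z : G * G => (z.1, ginv z.2)) @ p --> (p.1, ginv p.2).
    apply: cvg_pair; first exact: cvg_fst.
    by apply: continuous_comp; [exact: cvg_snd|exact: ginv_continuous].
  have h2 : \forall z \near p, composable (z.1, ginv z.2) -> A (gmul z.1 (ginv z.2)) := cab _ h1.
  rewrite /nbhs /=; apply: filterS h2 => z hz za; apply: hz.
  by rewrite /composable /= grng_inv.
exact: (mul_cvg cp).
Qed.

Lemma gmul_compact (L L' : set G) : compact L -> compact L' ->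
  compact ((fun p => gmul p.1 p.2) @` ((L `*` L') `&` @composable G)).
Proof.
move=> cL cL'; apply: continuous_compact.
  by apply: continuous_subspaceW (@gmul_continuous G); exact: subIsetr.
by apply: compact_closedI; [exact: compact_setX|exact: composable_closed].
Qed.

Lemma convolution_Cc (f g : G -> R[i]) : Cc f -> Cc g -> Cc (convolution mu f g).
Proof.
move=> cf cg; have [cf' [L cL fL]] := iffLR (CcP hG f) cf.
have [cg' [L' cL' gL]] := iffLR (CcP hG g) cg.
have cF := conv_within_src_pairs cf' cg'.
apply/(CcP hG); split.
  apply/continuousC_comp; split; rewrite /convolution /cintegral /=.
    apply: (fiber_integral_continuous (F := fun a b => complex.Re (f (gmul a (ginv b)) * g b)) cL').
      by apply/subspace_continuousP => p sp; apply: cvgC_Re; exact: (iffLR (subspace_continuousP _ _) cF).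
    by move=> a b _ /gL ->; rewrite mulr0.
  apply: (fiber_integral_continuous (F := fun a b => complex.Im (f (gmul a (ginv b)) * g b)) cL').
    by apply/subspace_continuousP => p sp; apply: cvgC_Im; exact: (iffLR (subspace_continuousP _ _) cF).
  by move=> a b _ /gL ->; rewrite mulr0.
exists ((fun p => gmul p.1 p.2) @` ((L `*` L') `&` @composable G)); first exact: gmul_compact.
move=> a na; rewrite /convolution.
rewrite (@eq_cintegral _ _ _ _ _ (fun=> 0)) => [|b ab].
  by apply: complex_eqP; rewrite /cintegral /= /Rintegral integral0.
have [Lb|/gL ->] := pselect (L' b); last by rewrite mulr0.
have [Lab|/fL ->] := pselect (L (gmul a (ginv b))); last by rewrite mul0r.
exfalso; apply: na; exists (gmul a (ginv b), b); last by rewrite /= gmulVK.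
by split => //=; rewrite /composable /= gsrc_mul ?grng_inv// gsrc_inv.
Qed.

End Convolution.

(** * Tonelli's theorem on products of fibres *)

Section SigmaFiniteFubini.
Variables (R : realType) (d : measure_display) (T : measurableType d)
  (m : {measure set T -> \bar R}).
Hypothesis sf : sigma_finite setT m.

(** An alias of [m], so that the hypothesis [sf] can be attached to it as a canonical structure. *)
Definition sigma_finite_copy : set T -> \bar R := m.
HB.instance Definition _ := Measure.copy sigma_finite_copy m.
HB.instance Definition _ := Measure_isSigmaFinite.Build _ _ _ sigma_finite_copy sf.

Lemma sigma_finite_fubini (f : T * T -> \bar R) : measurable_fun setT f ->
  (forall p, 0 <= f p)%E ->
  (\int[m]_x \int[m]_y f (x, y) = \int[m]_y \int[m]_x f (x, y))%E.
Proof. by move=> mf f0; exact: (@fubini_tonelli _ _ T T R sigma_finite_copy sigma_finite_copy). Qed.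

Lemma sigma_finite_measurable_fst (f : T * T -> \bar R) : measurable_fun setT f ->
  (forall p, 0 <= f p)%E -> measurable_fun setT (fun x => \int[m]_y f (x, y))%E.
Proof.
move=> mf f0.
exact: (@measurable_fun_fubini_tonelli_F _ _ T T R sigma_finite_copy f mf f0).
Qed.

Lemma sigma_finite_measurable_snd (f : T * T -> \bar R) : measurable_fun setT f ->
  (forall p, 0 <= f p)%E -> measurable_fun setT (fun y => \int[m]_x f (x, y))%E.
Proof.
move=> mf f0.
exact: (@measurable_fun_fubini_tonelli_G _ _ T T R sigma_finite_copy f mf f0).
Qed.

End SigmaFiniteFubini.

Section ProductMeasurability.
Variables (R : realType) (T : ptopologicalType).

(* A compact set is a finite union of rectangles inside any open set          *)
(* containing it, which gives measurability for the product of the Borel      *)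
(* sigma-algebras even when the latter is smaller than the Borel one.         *)
Lemma product_measurable (D L : set T) (f : T * T -> R) : closed D -> compact L ->
  {within D `*` D, continuous f} -> (forall p, 0 <= f p) ->
  (forall p, ~ (D p.1 /\ D p.2) -> f p = 0) ->
  (forall p, ~ (L p.1 /\ L p.2) -> f p = 0) ->
  measurable_fun setT (f : (borel T * borel T) -> R).
Proof.
move=> cD cL cf f0 fD fL; apply: (measurability _ (RGenOInfty.measurableE R)).
move=> _ [_ [c ->] <-]; rewrite setTI.
have [c0|c0] := ltP c 0.
  rewrite (_ : _ @^-1` _ = setT)//; apply/seteqP; split => // p _ /=.
  by rewrite in_itv/= andbT; exact: lt_le_trans c0 _.
have mD : measurable (D : set (borel T)) by exact: closed_borel.
have closedDD : closed (D `*` D).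
  have -> : D `*` D = fst @^-1` D `&` snd @^-1` D by [].
  by apply: closedI; apply: preimage_closed => // p _; [exact: cvg_fst|exact: cvg_snd].
have ED p : c < f p -> D p.1 /\ D p.2.
  by move=> Ep; apply: contrapT => /fD fp; move: Ep; rewrite fp ltNge c0.
have EL p : c < f p -> L p.1 /\ L p.2.
  by move=> Ep; apply: contrapT => /fL fp; move: Ep; rewrite fp ltNge c0.
have [U oU UE] : exists2 U, open U & U `&` (D `*` D) = [set p | c < f p].
  have /continuousP/(_ _ (@open_gt R c))/open_subspaceP[U oU UE] := cf.
  exists U => //; rewrite UE; apply/seteqP; split => p; first by case.
  by move=> h; split => //; exact: ED.
pose P n := [set p | c + n.+1%:R^-1 <= f p].
have PE p n : P n p -> c < f p.
  by apply: lt_le_trans; rewrite ltrDl invr_gt0.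
have cP n : compact (P n).
  have /continuous_closedP/(_ _ (@closed_ge R (c + n.+1%:R^-1)))/closed_subspaceP[V cV VE] := cf.
  have -> : P n = (L `*` L) `&` (V `&` (D `*` D)).
    rewrite VE; apply/seteqP; split => p; last by move=> [_ []].
    by move=> Pp; split; [exact/EL/(PE p n)|split => //; exact/ED/(PE p n)].
  apply: compact_closedI; first exact: compact_setX.
  by apply: closedI => //; exact: closedDD.
have cover n : exists2 B : set (T * T), measurable (B : set (borel T * borel T)) &
    P n `<=` B /\ B `<=` U.
  have /choice[AB ABP] (p : T * T) : exists AB : set T * set T, U p ->
      [/\ open AB.1, open AB.2, AB.1 p.1, AB.2 p.2 & AB.1 `*` AB.2 `<=` U].
    have [Up|nU] := pselect (U p); last by exists (set0, set0).
    have [[A B] [/= nA nB] ABU] : nbhs p U by exact: open_nbhs_nbhs.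
    exists (A°, B°) => _; split; [exact: open_interior|exact: open_interior|exact: nA|exact: nB|].
    by move=> q [/interior_subset Aq /interior_subset Bq]; apply: ABU.
  have PU p : P n p -> U p.
    move=> /PE cp; suff : (U `&` (D `*` D)) p by case.
    by rewrite UE; exact: cp.
  have [p /PU/ABP[oA oB Ap Bp _]|s sP cs] :=
      compact_seq_cover (cP n) (U := fun p => (AB p).1 `*` (AB p).2).
    by exists ((AB p).1, (AB p).2) => //; split; exact: open_nbhs_nbhs.
  exists (\bigcup_(p in [set` s]) ((AB p).1 `*` (AB p).2)).
    apply: fin_bigcup_measurable; first exact: finite_seq.
    move=> p /= /sP/PU/ABP[oA oB _ _ _].
    by apply: measurableX; exact: open_borel.
  split; first by move=> q /cs[p ps pq]; exists p.
  by move=> q [p /= /sP/PU/ABP[_ _ _ _ h] pq]; exact: h.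
have /choice[B BP] n : exists B : set (T * T), measurable (B : set (borel T * borel T)) /\
    (P n `<=` B /\ B `<=` U) by have [B ? ?] := cover n; exists B.
have -> : f @^-1` `]c, +oo[ = \bigcup_n (B n `&` (D `*` D)).
  apply/seteqP; split => p.
    rewrite /= in_itv/= andbT => cp; have [n _ np] : exists2 n, True & n.+1%:R^-1 < f p - c.
      have fc : 0 < f p - c by rewrite subr_gt0.
      by have [n hn] := ltr_add_invr fc; exists n => //; rewrite add0r in hn.
    exists n => //; split; last exact: ED.
    by have [_ [h _]] := BP n; apply: h; rewrite /P /=; move: np; move: (_^-1) => r; lra.
  move=> [n _ [Bp Dp]]; rewrite /= in_itv/= andbT.
  suff : (U `&` (D `*` D)) p by rewrite UE.
  by split => //; have [_ [_ h]] := BP n; exact: h.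
apply: bigcup_measurable => n _; apply: measurableI; first by case: (BP n).
exact: measurableX.
Qed.

End ProductMeasurability.

(** * The I-norm and its submultiplicativity *)

Section INorm.
Variables (R : realType) (G : ptopGroupoidType).
Hypotheses (hG : hausdorff_space G) (lG : locally_compact [set: G]).
Variables (K : nat -> set G) (eK : exhaustion K).
Variable mu : G -> {measure set (borel G) -> \bar R}.
Hypothesis hmu : haar_system mu.

Lemma haar_sigma_finite x : units x -> sigma_finite setT (mu x).
Proof.
move=> ux; exists K => [|n]; first by case: eK => _ _ ->.
have cK : compact (K n) by case: eK.
split; last exact: haar_finite.
by apply: closed_borel; exact: compact_closed.
Qed.

Lemma fiber_integral x (h : G -> \bar R) : units x -> measurable_fun setT (h : borel G -> \bar R) ->
  (\int[mu x]_(a in gfiber x) h a = \int[mu x]_a h a)%E.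
Proof.
move=> ux mh; apply/esym.
apply: (@integral_transport _ _ (borel G) (borel G) _ (mu x) (mu x) (gfiber x) setT id) => //.
- exact: gfiber_borel.
- by move=> B mB _; apply: measure_conc => //; [exact: gfiber_borel|exact: haar_conc].
Qed.

Lemma Cc_normc_borel (f : G -> R[i]) : Cc f ->
  measurable_fun setT ((fun a => (Normc.normc (f a))%:E) : borel G -> \bar R).
Proof.
move=> cf; apply/measurable_EFinP; apply: cont_borel => //.
by case: (Cc_normc hG cf).
Qed.

Definition fnorm (f : G -> R[i]) (x : G) : \bar R := (\int[mu x]_a (Normc.normc (f a))%:E)%E.

Lemma fnorm_ge0 f x : (0 <= fnorm f x)%E.
Proof. by apply: integral_ge0 => a _; rewrite lee_fin normc_ge0. Qed.

Lemma normc_conv_le (f g : G -> R[i]) (a : G) : Cc f -> Cc g ->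
  ((Normc.normc (convolution mu f g a))%:E <=
   \int[mu (gsrc a)]_(b in gfiber (gsrc a))
     (Normc.normc (f (gmul a (ginv b)) * g b))%:E)%E.
Proof.
move=> cf cg; have [ci ni] := conv_integrable hG hmu a cf cg.
have mD := gfiber_borel (gsrc a) hG.
have := cintegrable_normc mD ci ni; rewrite -lee_fin => /le_trans; apply.
rewrite /Rintegral fineK//; apply: integrable_fin_num => //.
Qed.

(** Tonelli's theorem exchanges the two integrals over the fibre of [x]. For fixed [b], right
    invariance evaluates the inner integral as [fnorm f (grng b)] times the norm of [g b]. *)
Lemma fnorm_conv (f g : G -> R[i]) x (M : R) : units x -> Cc f -> Cc g -> 0 <= M ->
  (forall y, units y -> fnorm f y <= M%:E)%E ->
  (fnorm (convolution mu f g) x <= M%:E * fnorm g x)%E.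
Proof.
move=> ux cf cg M0 fM; set D := gfiber x.
have mD : measurable (D : set (borel G)) := gfiber_borel x hG.
pose F (p : G * G) := Normc.normc (f (gmul p.1 (ginv p.2)) * g p.2).
(* Off the fibre the product [gmul p.1 (ginv p.2)] may be arbitrary, so the integrand is cut off to
   be measurable on the whole product. *)
pose FD := F \_ (D `*` D).
have F0 p : 0 <= F p by exact: normc_ge0.
have FD0 p : 0 <= FD p by rewrite /FD patchE; case: ifP.
have cF : {within D `*` D, continuous F}.
  have cc : {within D `*` D, continuous (fun p : G * G => f (gmul p.1 (ginv p.2)) * g p.2 : R[i]^o)}.
    apply: (continuous_subspaceW _ (conv_within_src_pairs _ _)); [|by case: cf|by case: cg].
    by move=> p [/= p1 p2]; rewrite /src_pairs /= p1 p2.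
  exact: (@continuous_normc R (subspace (D `*` D)) _ cc).
have [_ [L cL fL]] := iffLR (CcP hG f) cf.
have [_ [L' cL' gL]] := iffLR (CcP hG g) cg.
have mF : measurable_fun setT (FD : borel G * borel G -> R).
  have cP := gmul_compact hG cL cL'.
  apply: (@product_measurable R G D _ FD (@gfiber_closed G hG x) (compactU cP cL')) => //.
  - apply: (subspace_eq_continuous _ cF) => p /set_mem Dp.
    by change (F p = FD p); rewrite /FD patchE mem_set.
  - by move=> p nD; rewrite /FD patchE memNset.
  - move=> p nL; rewrite /FD patchE; case: ifP => // /set_mem[D1 D2].
    have [Lb|/gL gb] := pselect (L' p.2); last by rewrite /F gb mulr0 Normc.normc0.
    have [Lab|/fL fb] := pselect (L (gmul p.1 (ginv p.2))); last by rewrite /F fb mul0r Normc.normc0.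
    exfalso; apply: nL; split; last by right.
    have s12 : gsrc p.1 = gsrc p.2 by rewrite D1 D2.
    left; exists (gmul p.1 (ginv p.2), p.2); last by rewrite /= gmulVK.
    by split => //=; rewrite /composable /= gsrc_mul ?grng_inv// gsrc_inv.
have mFE : measurable_fun setT (EFin \o FD : borel G * borel G -> \bar R).
  exact/measurable_EFinP.
have FDr a : D a -> (\int[mu x]_b (FD (a, b))%:E = \int[mu x]_(b in D) (F (a, b))%:E)%E.
  move=> Da; rewrite [RHS]integral_mkcond; apply: eq_integral => b _.
  rewrite /FD !patchE; case: (boolP (b \in D)) => [bD|bD].
    by rewrite mem_set//; split => //; exact: set_mem bD.
  by rewrite memNset// => -[_ /mem_set]; rewrite (negbTE bD).
have FDl b : D b -> (\int[mu x]_a (FD (a, b))%:E = \int[mu x]_(a in D) (F (a, b))%:E)%E.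
  move=> Db; rewrite [RHS]integral_mkcond; apply: eq_integral => a _.
  rewrite /FD !patchE; case: (boolP (a \in D)) => [aD|aD].
    by rewrite mem_set//; split => //; exact: set_mem aD.
  by rewrite memNset// => -[/mem_set]; rewrite (negbTE aD).
have sf := haar_sigma_finite ux.
have FE0 p : (0 <= (EFin \o FD) p)%E by rewrite lee_fin.
apply: (@le_trans _ _ (\int[mu x]_a \int[mu x]_b (FD (a, b))%:E)%E).
  rewrite /fnorm -(fiber_integral ux); last first.
    by apply: Cc_normc_borel; exact: convolution_Cc.
  have mI : measurable_fun setT ((fun a => \int[mu x]_b (FD (a, b))%:E)%E : borel G -> \bar R).
    exact: (sigma_finite_measurable_fst sf mFE FE0).
  rewrite -(fiber_integral ux mI); apply: ge0_le_integral => //.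
  - by move=> a _; rewrite lee_fin normc_ge0.
  - apply: measurable_funTS; apply: Cc_normc_borel; exact: convolution_Cc.
  - exact: measurable_funTS.
  - move=> a Da; rewrite FDr//; apply: le_trans (normc_conv_le a cf cg) _.
    by rewrite (Da : gsrc a = x).
rewrite (sigma_finite_fubini sf mFE)//.
have mJ : measurable_fun setT ((fun b => \int[mu x]_a (FD (a, b))%:E)%E : borel G -> \bar R).
  exact: (sigma_finite_measurable_snd sf mFE FE0).
rewrite -(fiber_integral ux mJ) /fnorm -(fiber_integral ux (Cc_normc_borel cg)).
have mg := measurable_funTS (Cc_normc_borel cg).
rewrite -ge0_integralZl_EFin//; last by move=> a _; rewrite lee_fin normc_ge0.
apply: ge0_le_integral => //.
- by move=> b _; apply: integral_ge0 => a _; rewrite lee_fin.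
- exact: measurable_funTS.
- exact: measurable_funeM.
move=> b Db; rewrite FDl//.
have mfb : measurable_fun (D : set (borel G))
    ((fun a => (Normc.normc (f (gmul a (ginv b))))%:E) : borel G -> \bar R).
  apply: (measurable_comp (F := setT) measurableT _ (Cc_normc_borel cf)) => //.
  by rewrite /D -(Db : gsrc b = x) -(grng_inv b); exact: rmul_borel.
under eq_integral do rewrite /F /= Normc.normcM mulrC EFinM.
rewrite ge0_integralZl_EFin ?normc_ge0//; last by move=> a _; rewrite lee_fin normc_ge0.
rewrite muleC; apply: lee_wpmul2r; first by rewrite lee_fin normc_ge0.
apply: le_trans (fM (grng b) (units_rng b)).
rewrite /fnorm -(fiber_integral (units_rng b) (Cc_normc_borel cf)).
move: mfb; rewrite /D -(Db : gsrc b = x) => mfb.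
(* Substituting [gmul a b] for the variable cancels [ginv b]. *)
rewrite (haar_integral hG lG eK hmu mfb); rewrite le_eqVlt; apply/orP; left; apply/eqP.
by apply: eq_integral => a /set_mem ab; rewrite gmulK.
Qed.

(** At units that are not sources of points of [L] the integral is 0; on [L] it is a continuous
    function of the arrow, hence bounded. *)
Lemma fnorm_bounded (f : G -> R[i]) : Cc f ->
  exists2 M : R, 0 <= M & forall x, units x -> (fnorm f x <= M%:E)%E.
Proof.
move=> cf; have ch := Cc_normc hG cf; set h := fun x => _ in ch.
have [_ [L cL fL]] := iffLR (CcP hG f) cf.
have fE x : units x -> fnorm f x = (Rintegral (mu x) setT h)%:E.
  move=> ux; rewrite /Rintegral fineK//.
  have := @Crc_integrable _ _ hG (mu x) (fun C cC => haar_finite hmu ux cC) setT _ measurableT ch.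
  by move=> /(integrable_fin_num measurableT).
have /compact_bounded[M0 [_ hM]] : compact ((fun a => Rintegral (mu (gsrc a)) setT h) @` L).
  apply: continuous_compact => //; apply: continuous_subspaceT.
  exact: (haar_Rintegral_continuous hG hmu ch).
exists (Num.max 0 (M0 + 1)) => [|x ux]; first by rewrite le_max lexx.
have [[a La ax]|nx] := pselect ((gsrc @` L) x).
  rewrite fE// lee_fin le_max; apply/orP; right.
  have M01 : M0 < M0 + 1 by rewrite ltrDl.
  apply: (le_trans (ler_norm _)); apply: (hM _ M01).
  by exists a => //; rewrite ax.
rewrite /fnorm -(fiber_integral ux (Cc_normc_borel cf)) integral0_eq.
  by rewrite lee_fin le_max lexx.
move=> a ax; rewrite fL ?Normc.normc0// => La.
by apply: nx; exists a.
Qed.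

Lemma I_normE (f : G -> R[i]) : I_norm mu f =
  maxe (ereal_sup [set fnorm f x | x in @units G])
       (ereal_sup [set fnorm (involution f) x | x in @units G]).
Proof. by []. Qed.

Lemma I_normP (f : G -> R[i]) r : (I_norm mu f <= r)%E <->
  forall x, units x -> (fnorm f x <= r)%E /\ (fnorm (involution f) x <= r)%E.
Proof.
rewrite I_normE ge_max; split => [/andP[h1 h2] x ux|h].
  by split; [apply: le_trans h1|apply: le_trans h2]; apply: ereal_sup_ubound; exists x.
by apply/andP; split; apply: ge_ereal_sup => _ [x ux <-]; case: (h x ux).
Qed.

Lemma involutionK (f : G -> R[i]) : involution (involution f) = f.
Proof. by apply/funext => a; rewrite /involution ginvK conjCK. Qed.

Lemma I_norm_involution (f : G -> R[i]) : I_norm mu (involution f) = I_norm mu f.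
Proof. by rewrite !I_normE involutionK maxC. Qed.

Lemma I_norm_ge0 (f : G -> R[i]) : (0 <= I_norm mu f)%E.
Proof.
rewrite I_normE le_max; apply/orP; left.
apply: (le_trans (fnorm_ge0 f (gsrc point))); apply: ereal_sup_ubound.
by exists (gsrc point) => //; exact: units_src.
Qed.

Definition inorm (f : G -> R[i]) : R := fine (I_norm mu f).

Lemma inorm_ge0 f : 0 <= inorm f. Proof. by apply: fine_ge0; exact: I_norm_ge0. Qed.

Lemma inorm_involution f : inorm (involution f) = inorm f.
Proof. by rewrite /inorm I_norm_involution. Qed.

Lemma I_norm_inorm (f : G -> R[i]) : Cc f -> I_norm mu f = (inorm f)%:E.
Proof.
move=> cf; rewrite /inorm fineK// ge0_fin_numE ?I_norm_ge0//.
have [M M0 hM] := fnorm_bounded cf.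
have [M' M'0 hM'] := fnorm_bounded (involution_Cc hG cf).
apply: (@le_lt_trans _ _ (Num.max M M')%:E); last exact: ltry.
apply/I_normP => x ux; split; [apply: (le_trans (hM x ux))|apply: (le_trans (hM' x ux))].
  by rewrite lee_fin le_max lexx.
by rewrite lee_fin le_max lexx orbT.
Qed.

Lemma inormP (f : G -> R[i]) r : Cc f -> inorm f <= r <->
  forall x, units x -> (fnorm f x <= r%:E)%E /\ (fnorm (involution f) x <= r%:E)%E.
Proof. by move=> cf; rewrite -lee_fin -I_norm_inorm//; exact: I_normP. Qed.

Lemma fnorm_lin (f g : G -> R[i]) (z : R[i]) x : units x -> Cc f -> Cc g ->
  (fnorm (z *: f + g)%R x <= (Normc.normc z)%:E * fnorm f x + fnorm g x)%E.
Proof.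
move=> ux cf cg; have mf := Cc_normc_borel cf; have mg := Cc_normc_borel cg.
have f0 (k : G -> R[i]) a : (0 <= (Normc.normc (k a))%:E)%E by rewrite lee_fin normc_ge0.
have mzf : measurable_fun setT
    ((fun a => (Normc.normc z)%:E * (Normc.normc (f a))%:E)%E : borel G -> \bar R).
  exact: measurable_funeM.
rewrite /fnorm -ge0_integralZl_EFin ?normc_ge0// -ge0_integralD//; last first.
  by move=> a _; rewrite mule_ge0// lee_fin normc_ge0.
apply: ge0_le_integral => //.
- by apply: Cc_normc_borel; exact: Cc_lin.
- exact: emeasurable_funD.
- move=> a _; rewrite -EFinM -EFinD lee_fin.
  by apply: le_trans (le_normcD _ _) _; rewrite Normc.normcM.
Qed.

Lemma involution_lin (f g : G -> R[i]) (z : R[i]) :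
  involution (z *: f + g) = Num.conj z *: involution f + involution g.
Proof. by apply/funext => a; rewrite /involution !fctE rmorphD rmorphM. Qed.

Lemma inorm_lin (f g : G -> R[i]) (z : R[i]) : Cc f -> Cc g ->
  inorm (z *: f + g) <= Normc.normc z * inorm f + inorm g.
Proof.
move=> cf cg; apply/(inormP _ (Cc_lin hG z cf cg)) => x ux.
have h k : Cc k -> (fnorm k x <= (inorm k)%:E)%E by move=> ck; have /(inormP _ ck)/(_ x ux)[] := lexx (inorm k).
have z0 : (0 <= (Normc.normc z)%:E)%E by rewrite lee_fin normc_ge0.
have key (f' g' : G -> R[i]) z' : Cc f' -> Cc g' -> Normc.normc z' = Normc.normc z ->
    inorm f' = inorm f -> inorm g' = inorm g ->
    (fnorm (z' *: f' + g')%R x <= (Normc.normc z * inorm f + inorm g)%:E)%E.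
  move=> cf' cg' zz ff gg; apply: (le_trans (fnorm_lin z' ux cf' cg')).
  rewrite EFinD EFinM zz -ff -gg; apply: leeD; last exact: h.
  by apply: lee_wpmul2l => //; exact: h.
split; first exact: key.
rewrite involution_lin; apply: key; rewrite ?inorm_involution ?normc_conj//; exact: involution_Cc.
Qed.

Lemma inorm0 : inorm 0 = 0.
Proof.
have c0 : Cc (0 : G -> R[i]) by exact: (Cc0 R hG).
apply/eqP; rewrite eq_le inorm_ge0 andbT; apply: (iffRL (inormP 0 c0)) => x ux.
have i0 : involution (0 : G -> R[i]) = 0 by apply/funext => a; exact: conjC0.
by rewrite i0 /fnorm integral0_eq// => a _; rewrite Normc.normc0.
Qed.

Lemma inorm_conv (f g : G -> R[i]) : Cc f -> Cc g ->
  inorm (convolution mu f g) <= inorm f * inorm g.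
Proof.
move=> cf cg; have cfg := convolution_Cc hG lG hmu cf cg; apply/(inormP _ cfg) => x ux.
have h k y : units y -> Cc k -> (fnorm k y <= (inorm k)%:E)%E.
  by move=> uy ck; have /(inormP _ ck)/(_ y uy)[] := lexx (inorm k).
have key (k l : G -> R[i]) : Cc k -> Cc l ->
    (fnorm (convolution mu k l) x <= (inorm k * inorm l)%:E)%E.
  move=> ck cl; apply: (le_trans (fnorm_conv ux ck cl (inorm_ge0 k) (fun y uy => h k y uy ck))).
  by rewrite EFinM; apply: lee_wpmul2l; [rewrite lee_fin inorm_ge0|exact: h].
split; first exact: key.
rewrite (involution_convolution hG lG eK hmu cf cg) mulrC -(inorm_involution f) -(inorm_involution g).
by apply: key; exact: involution_Cc.
Qed.

Lemma convolution_linl (f f' g : G -> R[i]) (z : R[i]) : Cc f -> Cc f' -> Cc g ->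
  convolution mu (z *: f + f') g = z *: convolution mu f g + convolution mu f' g.
Proof.
move=> cf cf' cg; apply/funext => a; rewrite !fctE /convolution.
have [ci _] := conv_integrable hG hmu a cf cg.
have [ci' _] := conv_integrable hG hmu a cf' cg.
have mD := gfiber_borel (gsrc a) hG.
transitivity (z * convolution mu f g a + convolution mu f' g a); last by [].
rewrite /convolution -cintegral_lin//.
by apply: eq_cintegral => b _; rewrite mulrA -mulrDl.
Qed.

Lemma convolution_linr (f g g' : G -> R[i]) (z : R[i]) : Cc f -> Cc g -> Cc g' ->
  convolution mu f (z *: g + g') = z *: convolution mu f g + convolution mu f g'.
Proof.
move=> cf cg cg'; apply/funext => a; rewrite !fctE /convolution.
have [ci _] := conv_integrable hG hmu a cf cg.
have [ci' _] := conv_integrable hG hmu a cf cg'.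
have mD := gfiber_borel (gsrc a) hG.
transitivity (z * convolution mu f g a + convolution mu f g' a); last by [].
rewrite /convolution -cintegral_lin//.
by apply: eq_cintegral => b _; rewrite mulrCA -mulrDr.
Qed.

End INorm.

(** * Hilbert spaces *)

Section DotNorm.
Variables (R : realType) (V : lmodType R[i]) (d : {dot V for (@Num.conj R[i])}).
Implicit Types x y z : V.

Lemma dotDl x y z : d (x + y) z = d x z + d y z.
Proof. by rewrite linearDl. Qed.

Lemma dotZl (a : R[i]) x z : d (a *: x) z = a * d x z.
Proof. by rewrite linearZl_LR. Qed.

Lemma dotC x y : d x y = Num.conj (d y x).
Proof. by rewrite hermC mul1r. Qed.

Lemma dotDr x y z : d x (y + z) = d x y + d x z.
Proof. by rewrite linearDr. Qed.

Lemma dotZr (a : R[i]) x z : d x (a *: z) = Num.conj a * d x z.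
Proof. by rewrite linearZr_LR. Qed.

Lemma dotBl x y z : d (x - y) z = d x z - d y z.
Proof. by rewrite dotDl linearNl. Qed.

Lemma dotBr x y z : d x (y - z) = d x y - d x z.
Proof. by rewrite dotDr linearNr. Qed.

Definition dip x y : R := complex.Re (d x y).

Lemma dipC x y : dip x y = dip y x.
Proof. by rewrite /dip dotC Rec_conj. Qed.

Lemma dipDl x y z : dip (x + y) z = dip x z + dip y z.
Proof. by rewrite /dip dotDl Re_add. Qed.

Lemma dipDr x y z : dip x (y + z) = dip x y + dip x z.
Proof. by rewrite /dip dotDr Re_add. Qed.

Lemma dipZl (r : R) x z : dip (r%:C%C *: x) z = r * dip x z.
Proof. by rewrite /dip dotZl Re_mul /= mul0r subr0. Qed.

Lemma dipZr (r : R) x z : dip z (r%:C%C *: x) = r * dip z x.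
Proof. by rewrite dipC dipZl dipC. Qed.

Lemma dot_self x : d x x = (dip x x)%:C%C.
Proof.
have : 0 <= d x x by exact: dnorm_ge0.
by rewrite /dip; case: (d x x) => u v; rewrite lecE /= => /andP[/eqP -> _].
Qed.

Lemma dip_ge0 x : 0 <= dip x x.
Proof. by have := dnorm_ge0 d x; rewrite dot_self lecR. Qed.

Lemma dip_eq0 x : (dip x x == 0) = (x == 0).
Proof. by rewrite -(dnorm_eq0 d) dot_self; apply/eqP/eqP => [->//|[]]. Qed.

Lemma dot_norm_ge0 x : 0 <= dot_norm d x. Proof. exact: sqrtr_ge0. Qed.

Lemma dot_norm_sqr x : dot_norm d x ^+ 2 = dip x x.
Proof. by rewrite sqr_sqrtr// dip_ge0. Qed.

Lemma dot_norm_eq0 x : (dot_norm d x == 0) = (x == 0).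
Proof. by rewrite -dip_eq0 -dot_norm_sqr sqrf_eq0. Qed.

Lemma dot_norm0 : dot_norm d 0 = 0.
Proof. by apply/eqP; rewrite dot_norm_eq0. Qed.

Lemma dot_normZ (a : R[i]) x : dot_norm d (a *: x) = Normc.normc a * dot_norm d x.
Proof.
rewrite /dot_norm dotZl dotZr mulrA dot_self /=.
have -> : a * Num.conj a = (Normc.normc a ^+ 2)%:C%C.
  by rewrite -normCK normcR -rmorphXn.
by rewrite Re_mul /= mul0r subr0 sqrtrM ?sqr_ge0// sqrtr_sqr ger0_norm// normc_ge0.
Qed.

Lemma dip_le x y : dip x y <= dot_norm d x * dot_norm d y.
Proof.
have [->|y0] := eqVneq y 0.
  by rewrite dipC -[X in dip X _](scale0r 0) -[0 : R[i]]/(0%:C%C) dipZl mul0r dot_norm0 mulr0.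
have q0 : 0 < dip y y by rewrite lt_def dip_eq0 y0 dip_ge0.
apply: (le_trans (ler_norm _)).
rewrite -ler_sqr ?nnegrE ?normr_ge0 ?mulr_ge0 ?dot_norm_ge0//.
rewrite exprMn !dot_norm_sqr real_normK ?num_real//.
(* The real [t] that minimises the squared norm of [x + t y]. *)
pose t := - (dip x y / dip y y).
have := dip_ge0 (x + t%:C%C *: y).
rewrite dipDl !dipDr !dipZl !dipZr (dipC y x).
have -> : dip x x + t * dip x y + (t * dip x y + t * (t * dip y y)) =
    dip x x - dip x y ^+ 2 / dip y y.
  by rewrite /t; field; rewrite gt_eqF.
by rewrite subr_ge0 ler_pdivrMr.
Qed.

Lemma dot_normD x y : dot_norm d (x + y) <= dot_norm d x + dot_norm d y.
Proof.
rewrite -ler_sqr ?nnegrE ?addr_ge0 ?dot_norm_ge0// sqrrD !dot_norm_sqr.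
rewrite dipDl !dipDr (dipC y x); have := dip_le x y; lra.
Qed.

Lemma dot_normN x : dot_norm d (- x) = dot_norm d x.
Proof. by rewrite /dot_norm linearNl linearNr opprK. Qed.

Lemma dot_normB x y : dot_norm d (x - y) <= dot_norm d x + dot_norm d y.
Proof. by rewrite -(dot_normN y) dot_normD. Qed.

(** Multiplying [x] by the conjugate of [d x y] makes the pairing real and non-negative, which
    reduces the claim to [dip_le]. *)
Lemma normc_dot_le x y : Normc.normc (d x y) <= dot_norm d x * dot_norm d y.
Proof.
set w := d x y; have [w0|w0] := eqVneq (Normc.normc w) 0.
  by rewrite w0 mulr_ge0 ?dot_norm_ge0.
have wp : 0 < Normc.normc w by rewrite lt_def w0 normc_ge0.
rewrite -(ler_pM2l wp); have := dip_le (Num.conj w *: x) y.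
rewrite dot_normZ normc_conj -mulrA; apply: le_trans.
rewrite /dip dotZl -/w (_ : Num.conj w * w = (Normc.normc w ^+ 2)%:C%C) ?expr2//.
by rewrite mulrC -normCK normcR -rmorphXn.
Qed.

End DotNorm.

Section HilbertLimits.
Variables (R : realType) (H : hilbert R).
Implicit Types (u v : nat -> H) (x y l m : H).

Lemma hnorm_ge0 x : 0 <= hnorm x. Proof. exact: dot_norm_ge0. Qed.
Lemma hnormD x y : hnorm (x + y) <= hnorm x + hnorm y. Proof. exact: dot_normD. Qed.
Lemma hnormB x y : hnorm (x - y) <= hnorm x + hnorm y. Proof. exact: dot_normB. Qed.
Lemma hnormN x : hnorm (- x) = hnorm x. Proof. exact: dot_normN. Qed.
Lemma hnormZ (a : R[i]) x : hnorm (a *: x) = Normc.normc a * hnorm x.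
Proof. exact: dot_normZ. Qed.
Lemma hnorm0 : hnorm (0 : H) = 0. Proof. exact: dot_norm0. Qed.

Definition hlim u l : Prop := (fun n => hnorm (u n - l)) @ \oo --> (0 : R).

Lemma hlimP u l : hlim u l <->
  forall e : R, 0 < e -> exists n0, forall n, (n0 <= n)%N -> hnorm (u n - l) < e.
Proof.
split => [/cvgrPdist_lt h e e0|h].
  have [n0 _ hn] := h e e0; exists n0 => n n0n; have := hn n n0n.
  by rewrite /= sub0r normrN ger0_norm// hnorm_ge0.
apply/cvgrPdist_lt => e e0; have [n0 hn] := h e e0; exists n0 => // n /= /hn.
by rewrite sub0r normrN ger0_norm// hnorm_ge0.
Qed.

Lemma hlim_dom u l (w : nat -> R) : (forall n, hnorm (u n - l) <= w n) ->
  w @ \oo --> (0 : R) -> hlim u l.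
Proof.
move=> uw w0; apply: (squeeze_cvgr _ (cvg_cst 0) w0).
by apply: nearW => n; rewrite hnorm_ge0 uw.
Qed.

Lemma hlim_uniq u l m : hlim u l -> hlim u m -> l = m.
Proof.
move=> ul um; apply/eqP; rewrite -subr_eq0 -(dot_norm_eq0 (hilbert_dot H)) eq_le dot_norm_ge0 andbT.
have c0 : (fun n => hnorm (u n - m) + hnorm (u n - l)) @ \oo --> (0 : R).
  by rewrite -[X in _ --> X](addr0 0); apply: cvgD.
apply: (cvgr_to_ge c0); apply: nearW => n.
have -> : l - m = (u n - m) - (u n - l) by rewrite opprB [RHS]addrC subrKA.
exact: hnormB.
Qed.

Lemma hlim_cst l : hlim (fun=> l) l.
Proof. by rewrite /hlim subrr hnorm0; exact: cvg_cst. Qed.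

Lemma hlim_lin (a : R[i]) u v l m : hlim u l -> hlim v m ->
  hlim (fun n => a *: u n + v n) (a *: l + m).
Proof.
move=> ul vm; apply: (@hlim_dom _ _ (fun n => Normc.normc a * hnorm (u n - l) + hnorm (v n - m))).
  move=> n /=; rewrite opprD addrACA -scalerBr; apply: (le_trans (hnormD _ _)).
  by rewrite hnormZ.
rewrite -[X in _ --> X]addr0 -[X in _ --> X + _](mulr0 (Normc.normc a)).
by apply: cvgD => //; apply: cvgM => //; exact: cvg_cst.
Qed.

Lemma hlim_dot u v l m x y : hlim u l -> hlim v m ->
  (forall n, hilbert_dot H (u n) y = hilbert_dot H x (v n)) ->
  hilbert_dot H l y = hilbert_dot H x m.
Proof.
move=> ul vm uv; set d := hilbert_dot H.
apply/eqP; rewrite -subr_eq0 -normc_eq0 eq_le normc_ge0 andbT.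
have c0 : (fun n => hnorm (u n - l) * hnorm y + hnorm x * hnorm (v n - m)) @ \oo --> (0 : R).
  rewrite -[X in _ --> X]addr0 -[X in _ --> X + _](mul0r (hnorm y)) -[X in _ --> _ + X](mulr0 (hnorm x)).
  by apply: cvgD; apply: cvgM => //; exact: cvg_cst.
apply: (cvgr_to_ge c0); apply: nearW => n.
have -> : d l y - d x m = - d (u n - l) y + d x (v n - m).
  by rewrite dotBl dotBr uv opprB subrKA.
apply: (le_trans (le_normcD _ _)); rewrite normcN.
by apply: lerD; exact: normc_dot_le.
Qed.

Lemma hlim_norm_le u l (r : R) (w : nat -> R) : hlim u l -> w @ \oo --> r ->
  (forall n, hnorm (u n) <= w n) -> hnorm l <= r.
Proof.
move=> ul wr uw.
have c0 : (fun n => hnorm (u n - l) + w n) @ \oo --> r.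
  by rewrite -[X in _ --> X]add0r; apply: cvgD.
apply: (cvgr_to_ge c0); apply: nearW => n.
rewrite -{1}[l](subKr (u n)) addrC; apply: (le_trans (hnormD _ _)).
by rewrite hnormN lerD.
Qed.

Lemma op_norm_le (T : H -> H) (r : R) : (forall a x, T (a *: x) = a *: T x) ->
  (op_norm T <= r%:E)%E -> forall x, hnorm (T x) <= r * hnorm x.
Proof.
move=> TZ Tr x.
have r0 : 0 <= r.
  rewrite -lee_fin; apply: le_trans Tr; apply: (@le_trans _ _ (hnorm (T 0))%:E).
    by rewrite lee_fin hnorm_ge0.
  by apply: ereal_sup_ubound; exists 0 => //=; rewrite hnorm0.
have [x0|x0] := eqVneq (hnorm x) 0.
  have -> : x = 0 by apply/eqP; rewrite -(dot_norm_eq0 (hilbert_dot H)); apply/eqP.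
  have T0 : T 0 = 0 by rewrite -[X in T X](scale0r (0 : H)) TZ scale0r.
  by rewrite T0 hnorm0 mulr0.
have xp : 0 < hnorm x by rewrite lt_def x0 hnorm_ge0.
pose a : R[i] := ((hnorm x)^-1)%:C%C.
have na : Normc.normc a = (hnorm x)^-1 by rewrite normc_real ger0_norm// invr_ge0 ltW.
have : ((hnorm (T (a *: x)))%:E <= r%:E)%E.
  apply: le_trans Tr; apply: ereal_sup_ubound; exists (a *: x) => //=.
  by rewrite hnormZ na mulVf.
by rewrite lee_fin TZ hnormZ na mulrC ler_pdivrMr.
Qed.

Lemma op_norm_leP (T : H -> H) (r : R) : 0 <= r ->
  (forall x, hnorm (T x) <= r * hnorm x) -> (op_norm T <= r%:E)%E.
Proof.
move=> r0 Tr; apply: ge_ereal_sup => _ [x /= x1 <-]; rewrite lee_fin.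
by apply: (le_trans (Tr x)); rewrite ler_piMr.
Qed.

End HilbertLimits.

(** * Completions and representations *)

Section CompletionClasses.
Variables (R : realType) (V : zmodType) (N : V -> \bar R) (X : set V).
Hypothesis XB : forall f g, X f -> X g -> X (f - g).
Hypothesis N0 : forall e : R, 0 < e -> (N 0 < e%:E)%E.
Hypothesis NB : forall f g (e e' : R), X f -> X g -> (N f < e%:E)%E -> (N g < e'%:E)%E ->
  (N (f - g)%R < (e + e')%:E)%E.
Implicit Types (u v w : nat -> V).

Definition null_diff u v : Prop := forall e : R, 0 < e ->
  exists n0, forall n, (n0 <= n)%N -> (N (u n - v n)%R < e%:E)%E.

Lemma null_diff_refl u : null_diff u u.
Proof. by move=> e e0; exists 0 => n _; rewrite subrr; exact: N0. Qed.

Lemma null_diff_trans u v w : (forall n, X (u n)) -> (forall n, X (v n)) ->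
  (forall n, X (w n)) -> null_diff u v -> null_diff w v -> null_diff u w.
Proof.
move=> Xu Xv Xw uv wv e e0; have e2 : 0 < e / 2 by rewrite divr_gt0.
have [n1 h1] := uv _ e2; have [n2 h2] := wv _ e2.
exists (maxn n1 n2) => n; rewrite geq_max => /andP[/h1 k1 /h2 k2].
have -> : u n - w n = (u n - v n) - (w n - v n) by rewrite opprB addrA subrK.
by rewrite [e]splitr; apply: NB => //; exact: XB.
Qed.

Lemma null_diff_sym u v : (forall n, X (u n)) -> (forall n, X (v n)) ->
  null_diff u v -> null_diff v u.
Proof. by move=> Xu Xv uv; apply: (null_diff_trans Xv Xv Xu) => //; exact: null_diff_refl. Qed.

Lemma ncauchy_subseq u (phi : nat -> nat) : (forall n, (n <= phi n)%N) -> ncauchy N X u ->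
  ncauchy N X (u \o phi).
Proof.
move=> hphi [Xu cu]; split => [n|e e0]; first exact: Xu.
have [n0 hn] := cu e e0; exists n0 => m n m0 n0n; apply: hn.
  exact: leq_trans m0 (hphi m).
exact: leq_trans n0n (hphi n).
Qed.

Lemma null_diff_subseq u (phi psi : nat -> nat) : (forall n, (n <= phi n)%N) ->
  (forall n, (n <= psi n)%N) -> ncauchy N X u -> null_diff (u \o phi) (u \o psi).
Proof.
move=> hphi hpsi [Xu cu] e e0; have [n0 hn] := cu e e0; exists n0 => n n0n; apply: hn.
  exact: leq_trans n0n (hphi n).
exact: leq_trans n0n (hpsi n).
Qed.

(** Expressing the Cauchy property by equivalence of reindexed sequences lets every lemma on
    [null_diff] also show that an operation preserves Cauchy sequences. *)
Lemma ncauchyP u : (forall n, X (u n)) ->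
  (forall phi psi : nat -> nat, (forall n, (n <= phi n)%N) -> (forall n, (n <= psi n)%N) ->
     null_diff (u \o phi) (u \o psi)) -> ncauchy N X u.
Proof.
move=> Xu h; split => // e e0; apply: contrapT => /forallNP nc.
have /choice[pq pqP] n0 : exists pq : nat * nat, [/\ (n0 <= pq.1)%N, (n0 <= pq.2)%N &
    ~ (N (u pq.1 - u pq.2)%R < e%:E)%E].
  have /existsNP[m /existsNP[n /not_implyP[m0 /not_implyP[n0n hn]]]] := nc n0.
  by exists (m, n).
have [||n0 hn] := h (fun n => (pq n).1) (fun n => (pq n).2) _ _ e e0.
- by move=> n; case: (pqP n).
- by move=> n; case: (pqP n).
by have [_ _] := pqP n0; apply; exact: hn.
Qed.

Lemma nclass_eq u v : (forall n, X (u n)) -> (forall n, X (v n)) -> null_diff u v ->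
  nclass N X u = nclass N X v.
Proof.
move=> Xu Xv uv; apply/seteqP; split => w [[Xw cw] h]; split => //.
  apply: (null_diff_trans Xv Xu Xw); first exact: null_diff_sym.
  exact: null_diff_sym.
apply: (null_diff_trans Xu Xv Xw) => //; exact: null_diff_sym.
Qed.

Lemma nclass_mem u : ncauchy N X u -> nclass N X u u.
Proof. by move=> cu; split => //; exact: null_diff_refl. Qed.

Lemma ncauchy_cst f : X f -> ncauchy N X (fun=> f).
Proof. by move=> Xf; split => // e e0; exists 0 => m n _ _; rewrite subrr; exact: N0. Qed.

Lemma completion_in_mem f : X f -> completion N X (completion_in N X f).
Proof. by move=> Xf; exists (fun=> f) => //; exact: ncauchy_cst. Qed.

Lemma completion_ncauchy c u : completion N X c -> c u -> ncauchy N X u.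
Proof. by move=> [v _ <-] []. Qed.

Lemma completion_null_diff c u v : completion N X c -> c u -> c v -> null_diff u v.
Proof.
move=> [w [Xw cw] <-] [[Xu _] wu] [[Xv _] wv].
by apply: (null_diff_trans Xu Xw Xv); exact: null_diff_sym.
Qed.

Lemma completion_xget c : completion N X c -> c (xget (fun=> 0) c).
Proof.
move=> [u cu uc]; apply: (@xgetPex _ (fun=> 0) c); exists u.
by rewrite -uc; exact: nclass_mem.
Qed.

(** Once the operation respects [null_diff], the union over all representatives collapses to a
    single class. *)
Lemma completion_op2E (op : V -> V -> V) (c d : set (nat -> V)) u v :
  c u -> d v -> (forall u', c u' -> forall n, X (u' n)) -> (forall v', d v' -> forall n, X (v' n)) ->
  (forall f g, X f -> X g -> X (op f g)) ->
  (forall u' v', c u' -> d v' -> null_diff (fun n => op (u' n) (v' n)) (fun n => op (u n) (v n))) ->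
  completion_op2 N X op c d = nclass N X (fun n => op (u n) (v n)).
Proof.
move=> cu dv cX dX Xop h.
have E u' v' : c u' -> d v' ->
    nclass N X (fun n => op (u' n) (v' n)) = nclass N X (fun n => op (u n) (v n)).
  move=> cu' dv'; apply: nclass_eq => [n|n|]; last exact: h.
    by apply: Xop; [exact: cX|exact: dX].
  by apply: Xop; [exact: cX|exact: dX].
apply/seteqP; split => w; first by move=> [u' cu' [v' dv' w']]; rewrite -(E u' v').
by move=> w'; exists u => //; exists v.
Qed.

End CompletionClasses.

Section CompletionMap.
Variables (R : realType) (V W : zmodType) (N : V -> \bar R) (X : set V).
Hypothesis XB : forall f g, X f -> X g -> X (f - g).
Hypothesis N0 : forall e : R, 0 < e -> (N 0 < e%:E)%E.
Hypothesis NB : forall f g (e e' : R), X f -> X g -> (N f < e%:E)%E -> (N g < e'%:E)%E ->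
  (N (f - g)%R < (e + e')%:E)%E.

Lemma completion_mapE (op : W -> V) (c : set (nat -> W)) u : c u ->
  (forall u', c u' -> forall n, X (op (u' n))) ->
  (forall u', c u' -> null_diff N (fun n => op (u' n)) (fun n => op (u n))) ->
  completion_map N X op c = nclass N X (fun n => op (u n)).
Proof.
move=> cu cX h.
have E u' : c u' -> nclass N X (fun n => op (u' n)) = nclass N X (fun n => op (u n)).
  by move=> cu'; apply: (nclass_eq XB N0 NB) => [n|n|]; [exact: cX|exact: cX|exact: h].
apply/seteqP; split => w; first by move=> [u' cu' w']; rewrite -(E u').
by move=> w'; exists u.
Qed.

End CompletionMap.

(** * Representations of the L1-completion and of the compactly supported functions *)

Section Representations.
Variables (R : realType) (G : ptopGroupoidType).
Hypotheses (hG : hausdorff_space G) (lG : locally_compact [set: G]).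
Variables (K : nat -> set G) (eK : exhaustion K).
Variable mu : G -> {measure set (borel G) -> \bar R}.
Hypothesis hmu : haar_system mu.
Implicit Types (f g : G -> R[i]) (u v : nat -> G -> R[i]) (c d : set (nat -> G -> R[i])).

Let N := I_norm mu.
Let X := @Cc R G.

Lemma inormD f g : Cc f -> Cc g -> inorm mu (f + g) <= inorm mu f + inorm mu g.
Proof.
move=> cf cg; have := inorm_lin hG hmu 1 cf cg.
by rewrite scale1r -[1]/(1%:C%C) normc_real normr1 mul1r.
Qed.

Lemma inormN f : inorm mu (- f) = inorm mu f.
Proof.
rewrite /inorm; congr fine; rewrite /I_norm.
have E (h : G -> R[i]) x : (\int[mu x]_a (Normc.normc ((- h) a))%:E = \int[mu x]_a (Normc.normc (h a))%:E)%E.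
  by apply: eq_integral => a _; rewrite fctE normcN.
congr (maxe (ereal_sup _) (ereal_sup _)); apply: eq_imagel => x _; first exact: E.
rewrite -[RHS]E; apply: eq_integral => a _.
by rewrite /involution !fctE rmorphN.
Qed.

Lemma inormB f g : Cc f -> Cc g -> inorm mu (f - g) <= inorm mu f + inorm mu g.
Proof.
move=> cf cg; rewrite -(inormN g); apply: inormD => //.
by rewrite -[- g]add0r; apply: CcB => //; exact: (Cc0 R hG).
Qed.

Lemma I_norm_lt f (e : R) : Cc f -> (N f < e%:E)%E = (inorm mu f < e).
Proof. by move=> cf; rewrite /N (I_norm_inorm hG hmu cf) lte_fin. Qed.

Let XB f g : X f -> X g -> X (f - g). Proof. exact: CcB. Qed.
Let N0 (e : R) : 0 < e -> (N 0%R < e%:E)%E.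
Proof. by move=> e0; rewrite I_norm_lt ?(inorm0 hG hmu)//; exact: (Cc0 R hG). Qed.
Let NB f g (e e' : R) : X f -> X g -> (N f < e%:E)%E -> (N g < e'%:E)%E ->
  (N (f - g)%R < (e + e')%:E)%E.
Proof.
move=> Xf Xg; rewrite !I_norm_lt//; last exact: XB.
by move=> h1 h2; apply: (le_lt_trans (inormB Xf Xg)); rewrite ltrD.
Qed.

Lemma null_diff_inorm u v : (forall n, X (u n)) -> (forall n, X (v n)) ->
  null_diff N u v <-> (fun n => inorm mu (u n - v n)) @ \oo --> (0 : R).
Proof.
move=> Xu Xv; split => [h|/cvgrPdist_lt h e e0].
  apply/cvgrPdist_lt => e e0; have [n0 hn] := h e e0; exists n0 => // n /= /hn.
  by rewrite I_norm_lt; [rewrite sub0r normrN ger0_norm// inorm_ge0|exact: XB].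
have [n0 _ hn] := h e e0; exists n0 => n n0n; have := hn n n0n.
by rewrite /= I_norm_lt; [rewrite sub0r normrN ger0_norm// inorm_ge0|exact: XB].
Qed.

Lemma ncauchy_inorm u : ncauchy N X u -> exists r : R, (fun n => inorm mu (u n)) @ \oo --> r.
Proof.
move=> [Xu cu]; suff /cvg_ex[r hr] : cvg ((fun n => inorm mu (u n)) @ \oo) by exists r.
apply/cauchy_cvgP/cauchy_ballP => e e0; have [n0 hn] := cu e e0.
rewrite near_map2; exists ([set n | (n0 <= n)%N], [set n | (n0 <= n)%N]); first by split; exists n0.
move=> [m n] /= [m0 n0n]; have := hn _ _ m0 n0n; have := hn _ _ n0n m0.
have h k l : inorm mu (u k) - inorm mu (u l) <= inorm mu (u k - u l).
  by rewrite lerBlDr -{1}[u k](subrK (u l)); apply: inormD; [exact: XB|exact: Xu].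
rewrite /ball /= !I_norm_lt; [|exact: XB|exact: XB] => h1 h2.
rewrite ltr_norml ltrNl opprB; apply/andP; split.
  exact: le_lt_trans (h n m) h1.
exact: le_lt_trans (h m n) h2.
Qed.

Lemma null_diff_lin (z : R[i]) u u' v v' : (forall n, X (u n)) -> (forall n, X (u' n)) ->
  (forall n, X (v n)) -> (forall n, X (v' n)) -> null_diff N u u' -> null_diff N v v' ->
  null_diff N (fun n => z *: u n + v n) (fun n => z *: u' n + v' n).
Proof.
move=> Xu Xu' Xv Xv' /(null_diff_inorm Xu Xu') hu /(null_diff_inorm Xv Xv') hv.
apply/null_diff_inorm => [n|n|]; [exact: (Cc_lin hG z (Xu n) (Xv n))|exact: (Cc_lin hG z (Xu' n) (Xv' n))|].
have c0 : (fun n => Normc.normc z * inorm mu (u n - u' n) + inorm mu (v n - v' n)) @ \oo --> (0 : R).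
  rewrite -[X in _ --> X]addr0 -[X in _ --> X + _](mulr0 (Normc.normc z)).
  by apply: cvgD; [apply: cvgM; [exact: cvg_cst|exact: hu]|exact: hv].
apply: (squeeze_cvgr _ (cvg_cst 0) c0); apply: nearW => n.
rewrite inorm_ge0 opprD addrACA -scalerBr /=.
by apply: (inorm_lin hG hmu); exact: XB.
Qed.

(** The difference splits as [u (v - v') + (u - u') v']; the Cauchy hypotheses make the norms of [u]
    and [v'] converge, so both terms tend to 0. *)
Lemma null_diff_conv u u' v v' : ncauchy N X u -> (forall n, X (u' n)) ->
  (forall n, X (v n)) -> ncauchy N X v' -> null_diff N u u' -> null_diff N v v' ->
  null_diff N (fun n => convolution mu (u n) (v n)) (fun n => convolution mu (u' n) (v' n)).
Proof.
move=> cu Xu' Xv cv'; have [Xu _] := cu; have [Xv' _] := cv'.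
move=> /(null_diff_inorm Xu Xu') hu /(null_diff_inorm Xv Xv') hv.
have [r ur] := ncauchy_inorm cu; have [s vs] := ncauchy_inorm cv'.
have XC f g : X f -> X g -> X (convolution mu f g) by exact: (convolution_Cc hG lG hmu).
apply/null_diff_inorm => [n|n|]; [exact: (XC _ _ (Xu n) (Xv n))|exact: (XC _ _ (Xu' n) (Xv' n))|].
have c0 : (fun n => inorm mu (u n) * inorm mu (v n - v' n) +
    inorm mu (u n - u' n) * inorm mu (v' n)) @ \oo --> (0 : R).
  rewrite -[X in _ --> X]addr0 -[X in _ --> X + _](mulr0 r) -[X in _ --> _ + X](mul0r s).
  by apply: cvgD; apply: cvgM; [exact: ur|exact: hv|exact: hu|exact: vs].
apply: (squeeze_cvgr _ (cvg_cst 0) c0); apply: nearW => n.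
rewrite inorm_ge0 /=.
have -> : convolution mu (u n) (v n) - convolution mu (u' n) (v' n) =
    convolution mu (u n) (v n - v' n) + convolution mu (u n - u' n) (v' n).
  have -> : v n - v' n = -1 *: v' n + v n by rewrite scaleN1r addrC.
  have -> : u n - u' n = -1 *: u' n + u n by rewrite scaleN1r addrC.
  rewrite (convolution_linr hG hmu (-1) (Xu n) (Xv' n) (Xv n)).
  rewrite (convolution_linl hG hmu (-1) (Xu' n) (Xu n) (Xv' n)) !scaleN1r.
  by rewrite [in RHS](addrC (- convolution mu (u n) (v' n))) [in RHS](addrC (- _) (convolution mu (u n) (v' n))) subrKA.
apply: (le_trans (inormD (XC _ _ (Xu n) (XB (Xv n) (Xv' n))) (XC _ _ (XB (Xu n) (Xu' n)) (Xv' n)))).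
apply: lerD; first exact: (inorm_conv hG lG eK hmu (Xu n) (XB (Xv n) (Xv' n))).
exact: (inorm_conv hG lG eK hmu (XB (Xu n) (Xu' n)) (Xv' n)).
Qed.

Lemma null_diff_involution u v : (forall n, X (u n)) -> (forall n, X (v n)) ->
  null_diff N u v -> null_diff N (fun n => involution (u n)) (fun n => involution (v n)).
Proof.
move=> Xu Xv /(null_diff_inorm Xu Xv) h.
apply/null_diff_inorm => [n|n|]; [exact: (involution_Cc hG (Xu n))|exact: (involution_Cc hG (Xv n))|].
apply: cvg_trans h; apply: near_eq_cvg; apply: nearW => n.
rewrite -inorm_involution; congr (inorm mu _).
by apply/funext => a; rewrite /involution !fctE rmorphB.
Qed.

Lemma completion_norm_cvg c : completion N X c -> exists2 r : R, completion_norm N c = r%:E &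
  (fun n => inorm mu (xget (fun=> 0) c n)) @ \oo --> r.
Proof.
move=> Lc; set w := xget _ c; have cw : c w := completion_xget N0 Lc.
have cu := completion_ncauchy Lc cw; have [r wr] := ncauchy_inorm cu; exists r => //.
rewrite /completion_norm (_ : (fun n => _) = (fun n => (inorm mu (w n))%:E)).
  apply/cvg_lim => //; apply/fine_cvgP; split; last exact: wr.
  by apply: nearW => n; rewrite fin_numE.
apply/funext => n; rewrite /N; apply: (I_norm_inorm hG hmu).
by case: cu => h _; exact: h.
Qed.

Lemma completion_norm_in f : X f -> completion_norm N (completion_in N X f) = (inorm mu f)%:E.
Proof.
move=> Xf; have Lc := completion_in_mem N0 Xf.
have [r -> wr] := completion_norm_cvg Lc; congr (_%:E); set w := xget _ _ in wr.
have [Xw _] := completion_ncauchy Lc (completion_xget N0 Lc).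
have [_ fw] := completion_xget N0 Lc.
have {fw} := iffLR (null_diff_inorm (fun=> Xf) Xw) fw; rewrite -/w => fw.
have wf : (fun n => inorm mu (w n)) @ \oo --> inorm mu f.
  have l0 : (fun n => inorm mu f - inorm mu (f - w n)) @ \oo --> inorm mu f.
    by rewrite -[X in _ --> X]subr0; apply: cvgB => //; exact: cvg_cst.
  have u0 : (fun n => inorm mu f + inorm mu (f - w n)) @ \oo --> inorm mu f.
    by rewrite -[X in _ --> X]addr0; apply: cvgD => //; exact: cvg_cst.
  apply: (squeeze_cvgr _ l0 u0); apply: nearW => n; apply/andP; split.
    rewrite lerBlDr -{1}[f](subrK (w n)) addrC; exact: (inormD (Xw n) (XB Xf (Xw n))).
  have {1}-> : w n = f - (f - w n) by rewrite subKr.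
  exact: (inormB Xf (XB Xf (Xw n))).
exact: (cvg_unique _ wr wf).
Qed.

(* Contractive representations of [L1 G] correspond to these, by restriction  *)
(* to the dense subalgebra [Cc G] and by continuous extension.                *)
Definition Cc_rep (H : hilbert R) (rho : (G -> R[i]) -> H -> H) : Prop :=
  [/\ forall f, Cc f -> forall (a : R[i]) x y, rho f (a *: x + y) = a *: rho f x + rho f y,
      forall f g, Cc f -> Cc g -> forall (a : R[i]) x,
        rho (a *: f + g) x = a *: rho f x + rho g x,
      forall f g, Cc f -> Cc g -> forall x, rho (convolution mu f g) x = rho f (rho g x),
      forall f, Cc f -> forall x y,
        hilbert_dot H (rho f x) y = hilbert_dot H x (rho (involution f) y) &
      forall f, Cc f -> (op_norm (rho f) <= (inorm mu f)%:E)%E].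

Let XC f g : X f -> X g -> X (convolution mu f g).
Proof. exact: (convolution_Cc hG lG hmu). Qed.
Let XL (a : R[i]) f g : X f -> X g -> X (a *: f + g).
Proof. exact: Cc_lin. Qed.
Let XI f : X f -> X (involution f).
Proof. exact: involution_Cc. Qed.

Let cX c : completion N X c -> forall u, c u -> forall n, X (u n).
Proof. by move=> Lc u cu; have [Xu _] := completion_ncauchy Lc cu. Qed.

Lemma L1_linE (a : R[i]) c d u v : completion N X c -> completion N X d -> c u -> d v ->
  completion_op2 N X (fun f g => a *: f + g) c d = nclass N X (fun n => a *: u n + v n).
Proof.
move=> Lc Ld cu dv; apply: (completion_op2E XB N0 NB cu dv (cX Lc) (cX Ld)).
  exact: XL.
move=> u' v' cu' dv'; apply: null_diff_lin.
- exact: cX cu'.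
- exact: cX cu.
- exact: cX dv'.
- exact: cX dv.
- exact: (completion_null_diff XB N0 NB Lc).
- exact: (completion_null_diff XB N0 NB Ld).
Qed.

Lemma L1_convE c d u v : completion N X c -> completion N X d -> c u -> d v ->
  completion_op2 N X (convolution mu) c d = nclass N X (fun n => convolution mu (u n) (v n)).
Proof.
move=> Lc Ld cu dv; apply: (completion_op2E XB N0 NB cu dv (cX Lc) (cX Ld)).
  exact: XC.
move=> u' v' cu' dv'; apply: null_diff_conv.
- exact: completion_ncauchy Lc cu'.
- exact: cX cu.
- exact: cX dv'.
- exact: completion_ncauchy Ld dv.
- exact: (completion_null_diff XB N0 NB Lc).
- exact: (completion_null_diff XB N0 NB Ld).
Qed.

Lemma L1_involutionE c u : completion N X c -> c u ->
  completion_map N X (@involution R G) c = nclass N X (fun n => involution (u n)).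
Proof.
move=> Lc cu; apply: (completion_mapE XB N0 NB cu).
  by move=> u' cu' n; apply: XI; exact: cX cu' _.
move=> u' cu'; apply: null_diff_involution; [exact: cX cu'|exact: cX cu|].
exact: (completion_null_diff XB N0 NB Lc).
Qed.

Lemma ncauchy_lin (a : R[i]) u v : ncauchy N X u -> ncauchy N X v ->
  ncauchy N X (fun n => a *: u n + v n).
Proof.
move=> cu cv; have [Xu _] := cu; have [Xv _] := cv.
apply: ncauchyP => [n|phi psi hphi hpsi]; first exact: XL.
apply: (@null_diff_lin a (u \o phi) (u \o psi) (v \o phi) (v \o psi)) => //.
- by move=> n; exact: Xu.
- by move=> n; exact: Xu.
- by move=> n; exact: Xv.
- by move=> n; exact: Xv.
- exact: (null_diff_subseq _ _ cu).
- exact: (null_diff_subseq _ _ cv).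
Qed.

Lemma ncauchy_conv u v : ncauchy N X u -> ncauchy N X v ->
  ncauchy N X (fun n => convolution mu (u n) (v n)).
Proof.
move=> cu cv; have [Xu _] := cu; have [Xv _] := cv.
apply: ncauchyP => [n|phi psi hphi hpsi]; first exact: XC.
apply: (@null_diff_conv (u \o phi) (u \o psi) (v \o phi) (v \o psi)).
- exact: (ncauchy_subseq hphi cu).
- by move=> n; exact: Xu.
- by move=> n; exact: Xv.
- exact: (ncauchy_subseq hpsi cv).
- exact: (null_diff_subseq hphi hpsi cu).
- exact: (null_diff_subseq hphi hpsi cv).
Qed.

Lemma ncauchy_involution u : ncauchy N X u -> ncauchy N X (fun n => involution (u n)).
Proof.
move=> cu; have [Xu _] := cu.
apply: ncauchyP => [n|phi psi hphi hpsi]; first exact: XI.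
apply: (@null_diff_involution (u \o phi) (u \o psi)) => //.
- by move=> n; exact: Xu.
- by move=> n; exact: Xu.
- exact: (null_diff_subseq _ _ cu).
Qed.

Lemma rep_restrict (H : hilbert R) pi : contractive_star_rep mu (H := H) pi ->
  Cc_rep (H := H) (fun f => pi (completion_in N X f)).
Proof.
move=> [p1 p2 p3 p4 p5]; split.
- by move=> f cf; apply: p1; exact: (completion_in_mem N0).
- move=> f g cf cg a x.
  have Lf := completion_in_mem N0 cf; have Lg := completion_in_mem N0 cg.
  rewrite -(p2 _ _ Lf Lg); congr (pi _ x).
  by rewrite (L1_linE a Lf Lg (nclass_mem N0 (ncauchy_cst N0 cf)) (nclass_mem N0 (ncauchy_cst N0 cg))).
- move=> f g cf cg x.
  have Lf := completion_in_mem N0 cf; have Lg := completion_in_mem N0 cg.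
  have E := L1_convE Lf Lg (nclass_mem N0 (ncauchy_cst N0 cf)) (nclass_mem N0 (ncauchy_cst N0 cg)).
  by have h := p3 _ _ Lf Lg x; rewrite E in h; exact: h.
- move=> f cf x y; have Lf := completion_in_mem N0 cf.
  rewrite (p4 _ Lf); congr (hilbert_dot H x (pi _ y)).
  by rewrite (L1_involutionE Lf (nclass_mem N0 (ncauchy_cst N0 cf))).
- move=> f cf; rewrite -completion_norm_in//; apply: p5.
  exact: (completion_in_mem N0).
Qed.

Section Extend.
Variables (H : hilbert R) (rho : (G -> R[i]) -> H -> H).
Hypothesis rrho : Cc_rep rho.

Let rho_le f x : X f -> hnorm (rho f x) <= inorm mu f * hnorm x.
Proof.
case: rrho => r1 _ _ _ r5 Xf; apply: op_norm_le; last exact: r5.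
move=> a y; have := r1 f Xf a y 0; rewrite !addr0 => ->.
have := r1 f Xf 1 0 0; rewrite scaler0 !addr0 scale1r => /eqP.
by rewrite -[X in X == _]addr0 (inj_eq (addrI _)) eq_sym => /eqP ->; rewrite addr0.
Qed.

Let rhoB f g x : X f -> X g -> rho (f - g) x = rho f x - rho g x.
Proof.
case: rrho => _ r2 _ _ _ Xf Xg; have := r2 g f Xg Xf (-1) x.
by rewrite !scaleN1r addrC => ->; rewrite addrC.
Qed.

Definition rep_ext c x : H := xget 0 [set l | hlim (fun n => rho (xget (fun=> 0) c n) x) l].

Lemma rep_ext_lim c u x : completion N X c -> c u -> hlim (fun n => rho (u n) x) (rep_ext c x).
Proof.
move=> Lc cu; set w := xget (fun=> 0) c.
have cw : c w := completion_xget N0 Lc.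
have Xw := cX Lc cw; have Xu := cX Lc cu.
have [l wl] : exists l, hlim (fun n => rho (w n) x) l.
  have [_ cy] := completion_ncauchy Lc cw.
  have [|l lP] := @hilbert_complete _ H (fun n => rho (w n) x); last by exists l; exact/hlimP.
  move=> e e0; have x1 : 0 < hnorm x + 1 by rewrite ltr_wpDl ?hnorm_ge0.
  have [n0 hn] := cy _ (divr_gt0 e0 x1); exists n0 => m n m0 n0n.
  have := hn m n m0 n0n; rewrite I_norm_lt; last exact: XB.
  rewrite ltr_pdivlMr// -rhoB// => h; apply: le_lt_trans h.
  apply: (le_trans (rho_le x (XB (Xw m) (Xw n)))).
  by apply: ler_wpM2l; rewrite ?inorm_ge0// lerDl.
have wr : hlim (fun n => rho (w n) x) (rep_ext c x).
  by apply: (@xgetPex _ 0 [set l | hlim (fun n => rho (w n) x) l]); exists l.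
have /(null_diff_inorm Xu Xw) uw : null_diff N u w by exact: (completion_null_diff XB N0 NB Lc).
apply: (@hlim_dom _ _ _ _ (fun n => inorm mu (u n - w n) * hnorm x + hnorm (rho (w n) x - rep_ext c x))).
  move=> n; rewrite -(subrKA (rho (w n) x)) -rhoB//; apply: (le_trans (hnormD _ _)).
  by rewrite lerD2r; apply: rho_le; exact: XB.
rewrite -[X in _ --> X]addr0 -[X in _ --> X + _](mul0r (hnorm x)).
by apply: cvgD => //; apply: cvgM => //; exact: cvg_cst.
Qed.

Lemma rep_ext_in f x : X f -> rep_ext (completion_in N X f) x = rho f x.
Proof.
move=> Xf; have Lf := completion_in_mem N0 Xf.
apply: (hlim_uniq (rep_ext_lim x Lf (nclass_mem N0 (ncauchy_cst N0 Xf)))).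
exact: hlim_cst.
Qed.

Lemma rep_ext_nclass u x : ncauchy N X u -> hlim (fun n => rho (u n) x) (rep_ext (nclass N X u) x).
Proof.
move=> cu; apply: rep_ext_lim; first by exists u.
exact: (nclass_mem N0).
Qed.

Lemma rep_extend : contractive_star_rep mu rep_ext.
Proof.
have [r1 r2 r3 r4 r5] := rrho; split.
- move=> c Lc a x y; have cw := completion_xget N0 Lc; have Xw := cX Lc cw.
  apply: (hlim_uniq (rep_ext_lim _ Lc cw)).
  rewrite (_ : (fun n => _) = (fun n => a *: rho (xget (fun=> 0) c n) x + rho (xget (fun=> 0) c n) y)).
    by apply: hlim_lin; exact: rep_ext_lim.
  by apply/funext => n; apply: r1; exact: Xw.
- move=> c d Lc Ld a x; have cw := completion_xget N0 Lc; have dv := completion_xget N0 Ld.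
  rewrite (L1_linE a Lc Ld cw dv).
  have cy := ncauchy_lin a (completion_ncauchy Lc cw) (completion_ncauchy Ld dv).
  apply: (hlim_uniq (rep_ext_nclass x cy)).
  rewrite (_ : (fun n => _) = (fun n => a *: rho (xget (fun=> 0) c n) x + rho (xget (fun=> 0) d n) x)).
    by apply: hlim_lin; exact: rep_ext_lim.
  by apply/funext => n; apply: r2; [exact: cX cw n|exact: cX dv n].
- move=> c d Lc Ld x; have cw := completion_xget N0 Lc; have dv := completion_xget N0 Ld.
  rewrite (L1_convE Lc Ld cw dv).
  have cc := completion_ncauchy Lc cw; have cd := completion_ncauchy Ld dv.
  set w := xget _ c in cw cc *; set v := xget _ d in dv cd *.
  have Xw := cX Lc cw; have Xv := cX Ld dv.
  have [s ws] := ncauchy_inorm cc.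
  apply: (hlim_uniq (rep_ext_nclass x (ncauchy_conv cc cd))).
  (* Inserting [rho (w n) y] leaves two null terms: the norms of [w n] converge, [rho (v n) x] tends
     to [y], and [rho (w n) y] tends to [rep_ext c y]. *)
  pose y := rep_ext d x.
  apply: (@hlim_dom _ _ _ _ (fun n => inorm mu (w n) * hnorm (rho (v n) x - y) +
      hnorm (rho (w n) y - rep_ext c y))).
    move=> n; rewrite r3; [|exact: Xw|exact: Xv].
    rewrite -(subrKA (rho (w n) y)); apply: (le_trans (hnormD _ _)).
    rewrite lerD2r; have -> : rho (w n) (rho (v n) x) - rho (w n) y = rho (w n) (rho (v n) x - y).
      have := r1 _ (Xw n) (-1) y (rho (v n) x).
      by rewrite !scaleN1r addrC => ->; rewrite addrC.
    exact: rho_le.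
  rewrite -[X in _ --> X]addr0 -[X in _ --> X + _](mulr0 s).
  apply: cvgD; last exact: rep_ext_lim.
  by apply: cvgM => //; exact: rep_ext_lim.
- move=> c Lc x y; have cw := completion_xget N0 Lc.
  rewrite (L1_involutionE Lc cw); have cc := completion_ncauchy Lc cw.
  apply: (hlim_dot (rep_ext_lim x Lc cw) (rep_ext_nclass y (ncauchy_involution cc))).
  by move=> n; apply: r4; exact: cX cw n.
- move=> c Lc; have cw := completion_xget N0 Lc; have Xw := cX Lc cw.
  have [r -> wr] := completion_norm_cvg Lc.
  apply: ge_ereal_sup => _ [x /= x1 <-]; rewrite lee_fin.
  apply: (hlim_norm_le (rep_ext_lim x Lc cw) wr) => n.
  apply: (le_trans (rho_le x (Xw n))).
  by rewrite ler_piMr// inorm_ge0.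
Qed.

End Extend.

(** Restriction and extension identify the two suprema. Representations of [Cc G] are the form that
    can be moved along pullbacks and through ultraproducts. *)
Lemma max_normE f : Cc f -> max_norm mu f =
  ereal_sup [set r | exists (H : hilbert R) rho, @Cc_rep H rho /\ r = op_norm (rho f)].
Proof.
move=> cf; congr ereal_sup; apply/seteqP; split => r [H [pi [hpi ->]]].
  by exists H, (fun f => pi (completion_in N X f)); split => //; exact: rep_restrict.
exists H, (rep_ext pi); split; first exact: rep_extend.
congr op_norm; apply/funext => x; apply/esym; exact: rep_ext_in.
Qed.

Lemma max_normP f r : Cc f -> (max_norm mu f <= r)%E <->
  forall (H : hilbert R) rho, @Cc_rep H rho -> (op_norm (rho f) <= r)%E.
Proof.
move=> cf; rewrite max_normE//; split => [h H rho hr|h].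
  by apply: le_trans h; apply: ereal_sup_ubound; exists H, rho.
by apply: ge_ereal_sup => _ [H [rho [hr ->]]]; exact: h.
Qed.

Lemma max_norm_le_inorm f : Cc f -> (max_norm mu f <= (inorm mu f)%:E)%E.
Proof. by move=> cf; apply/max_normP => // H rho [_ _ _ _]; exact. Qed.

Lemma max_norm0 (e : R) : 0 < e -> (max_norm mu 0%R < e%:E)%E.
Proof.
move=> e0; have c0 : Cc (0 : G -> R[i]) by exact: (Cc0 R hG).
by apply: (le_lt_trans (max_norm_le_inorm c0)); rewrite (inorm0 hG hmu) lte_fin.
Qed.

Lemma max_normB f g (e e' : R) : Cc f -> Cc g -> (max_norm mu f < e%:E)%E ->
  (max_norm mu g < e'%:E)%E -> (max_norm mu (f - g)%R < (e + e')%:E)%E.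
Proof.
move=> cf cg fe ge.
(* A supremum passes on weak bounds only; the gap between [e1] and [e] restores strictness at the
   end. *)
have {fe}[e1 fe1 e1e] : exists2 e1 : R, (max_norm mu f <= e1%:E)%E & e1 < e.
  case E : (max_norm mu f) fe => [r| |] //=; last by exists (e - 1); [exact: leNye|rewrite gtrBl].
  by rewrite lte_fin => re; exists r.
have : (max_norm mu (f - g)%R <= (e1 + e')%:E)%E.
  apply/max_normP => [|H rho hr]; first exact: CcB.
  have [r1 r2 _ _ _] := hr.
  apply: ge_ereal_sup => _ [x /= x1 <-].
  have -> : rho (f - g) x = rho f x - rho g x.
    have := r2 g f cg cf (-1) x.
    by rewrite !scaleN1r addrC => ->; rewrite addrC.
  rewrite lee_fin; apply: (le_trans (hnormB _ _)); apply: lerD.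
    rewrite -lee_fin; apply: le_trans fe1; apply: le_trans (iffLR (max_normP _ cf) (lexx _) _ _ hr).
    by apply: ereal_sup_ubound; exists x.
  rewrite -lee_fin; apply: le_trans (ltW ge); apply: le_trans (iffLR (max_normP _ cg) (lexx _) _ _ hr).
  by apply: ereal_sup_ubound; exists x.
by move=> h; apply: (le_lt_trans h); rewrite lte_fin ltrD2r.
Qed.

End Representations.

Section PullbackContraction.
Variables (R : realType) (G H : ptopGroupoidType) (h : G -> H).
Hypotheses (hG : hausdorff_space G) (lG : locally_compact [set: G]).
Hypotheses (hH : hausdorff_space H) (lH : locally_compact [set: H]).
Variables (K : nat -> set G) (eK : exhaustion K) (L : nat -> set H) (eL : exhaustion L).
Hypotheses (mh : groupoid_morphism h) (ch : continuous h) (ph : proper_map h).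
Hypothesis hsurj : forall z, units z -> exists2 x, units x & h x = z.
Variables (m : G -> {measure set (borel G) -> \bar R})
  (n : H -> {measure set (borel H) -> \bar R}).
Hypotheses (hm : haar_system m) (hn : haar_system n).
Hypothesis push : forall x, units x -> forall B : set (borel H), measurable B ->
  n (h x) B = m x (h @^-1` B).

(** Surjectivity on units makes the pullback isometric for the I-norm, which preserves
    contractivity; multiplicativity comes from the push-forward relation between the Haar
    measures. *)
Lemma rep_pullback (V : hilbert R) rho : Cc_rep m (H := V) rho ->
  Cc_rep n (H := V) (fun f => rho (pullback h f)).
Proof.
have conc x : units x -> m x (~` gfiber x) = 0%E by exact: (haar_conc hG hm).
have pC f : Cc f -> Cc (pullback h f) := @pullback_Cc R G H h hG hH ch ph f.
move=> [r1 r2 r3 r4 r5]; split.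
- by move=> f /pC; exact: r1.
- by move=> f g /pC cf /pC cg a x; exact: (r2 _ _ cf cg a x).
- move=> f g cf cg x; rewrite (pullback_convolution hG hH mh ch push conc cf cg).
  by apply: r3; exact: pC.
- move=> f cf x y; rewrite (pullback_involution mh).
  by apply: r4; exact: pC.
- move=> f cf; rewrite /inorm -(push_I_norm mh ch push hsurj (proj1 cf)).
  by apply: r5; exact: pC.
Qed.

Lemma max_norm_pullback (f : H -> R[i]) : Cc f ->
  (max_norm m (pullback h f) <= max_norm n f)%E.
Proof.
move=> cf; have pC := @pullback_Cc R G H h hG hH ch ph f cf.
apply/(max_normP hG lG eK hm _ pC) => V rho hr.
exact: (iffLR (max_normP hH lH eL hn _ cf) (lexx _) _ _ (rep_pullback hr)).
Qed.

End PullbackContraction.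

(** * Ultraproducts of Hilbert spaces *)

Section UltraLimits.
Variables (R : realType) (I : Type) (U : set_system I).
Hypothesis UU : UltraFilter U.

Let UF : ProperFilter U := @ultra_proper _ _ UU.

(** Compactness of the interval gives a cluster point, and for an ultrafilter clustering is
    convergence. *)
Lemma ultra_cvg (f : I -> R) (M : R) : (forall i, `|f i| <= M) -> f @ U --> lim (f @ U).
Proof.
move=> fM; have PF : ProperFilter (f @ U) by exact: fmap_proper_filter.
have [|l [_ lcl]] := @segment_compact R (- M) M (f @ U) PF.
  apply: (@filterE _ U) => i; rewrite /= in_itv/= -ler_norml; exact: fM.
suff fl : f @ U --> l by rewrite (cvg_lim _ fl).
move=> A nA; have [//|nU] := in_ultra_setVsetC (f @^-1` A) UU.
by have [x [nx]] := lcl (~` A) A nU nA.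
Qed.

Lemma ultra_cvgC (f : I -> R[i]) (M : R) : (forall i, Normc.normc (f i) <= M) ->
  exists l : R[i], f @ U --> (l : R[i]^o).
Proof.
move=> fM.
have hr : (fun i => complex.Re (f i)) @ U --> lim ((fun i => complex.Re (f i)) @ U).
  by apply: (@ultra_cvg _ M) => i; apply: le_trans (fM i); exact: normc_Re.
have hi : (fun i => complex.Im (f i)) @ U --> lim ((fun i => complex.Im (f i)) @ U).
  by apply: (@ultra_cvg _ M) => i; apply: le_trans (fM i); exact: normc_Im.
by exists (Complex (lim ((fun i => complex.Re (f i)) @ U)) (lim ((fun i => complex.Im (f i)) @ U)));
  apply: cvgC_ReIm.
Qed.

End UltraLimits.

(** Bundled, so that the canonical structures on the ultraproduct depend on the ultrafilter without
    a separate hypothesis. *)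
Record ultra (I : Type) := Ultra {
  ultra_system :> set_system I ;
  ultraP : UltraFilter ultra_system
}.

#[global] Instance ultra_proper_filter (I : Type) (U : ultra I) : ProperFilter (ultra_system U) :=
  @ultra_proper _ _ (ultraP U).

Section Ultraproduct.
Variables (R : realType) (I : Type) (UF : ultra I) (H : I -> hilbert R).

Local Notation U := (ultra_system UF).
Let UU : UltraFilter U := ultraP UF.
Let PU : ProperFilter U := ultra_proper_filter UF.
Let F := forall i, H i.
Implicit Types (x y z : F).

Definition ubounded x : Prop := exists M : R, forall i, hnorm (x i) <= M.

Definition unull x : Prop := (fun i => hnorm (x i)) @ U --> (0 : R).

Definition uadd x y : F := fun i => x i + y i.
Definition uscale (a : R[i]) x : F := fun i => a *: x i.
Definition usub x y : F := fun i => x i - y i.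
Definition uzero : F := fun i => 0.

Lemma ubounded0 : ubounded uzero.
Proof. by exists 0 => i; rewrite hnorm0. Qed.

Lemma ubounded_add x y : ubounded x -> ubounded y -> ubounded (uadd x y).
Proof.
move=> [M xM] [M' yM]; exists (M + M') => i.
by apply: (le_trans (hnormD _ _)); exact: lerD.
Qed.

Lemma ubounded_scale a x : ubounded x -> ubounded (uscale a x).
Proof.
move=> [M xM]; exists (Normc.normc a * M) => i.
by rewrite /uscale hnormZ; apply: ler_wpM2l => //; exact: normc_ge0.
Qed.

Lemma ubounded_sub x y : ubounded x -> ubounded y -> ubounded (usub x y).
Proof.
move=> [M xM] [M' yM]; exists (M + M') => i.
by apply: (le_trans (hnormB _ _)); exact: lerD.
Qed.

Lemma unull_dom x (w : I -> R) : (\forall i \near U, hnorm (x i) <= w i) ->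
  w @ U --> (0 : R) -> unull x.
Proof.
move=> xw w0; apply: (squeeze_cvgr _ (cvg_cst 0) w0).
by apply: filterS xw => i ->; rewrite hnorm_ge0.
Qed.

Lemma unull_near x : (\forall i \near U, x i = 0) -> unull x.
Proof.
move=> x0; apply: (@unull_dom _ (fun=> 0)); last exact: cvg_cst.
by apply: filterS x0 => i ->; rewrite hnorm0.
Qed.

Lemma unull_lin a x y z : unull x -> unull y -> (forall i, z i = a *: x i + y i) -> unull z.
Proof.
move=> x0 y0 zE; apply: (@unull_dom _ (fun i => Normc.normc a * hnorm (x i) + hnorm (y i))).
  by apply: nearW => i; rewrite zE -hnormZ; exact: hnormD.
rewrite -[X in _ --> X]addr0 -[X in _ --> X + _](mulr0 (Normc.normc a)).
by apply: cvgD => //; apply: cvgM => //; exact: cvg_cst.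
Qed.

Lemma unull_sym x y : unull (usub x y) -> unull (usub y x).
Proof.
move=> h; apply: (unull_lin (a := -1) h (unull_near (x := uzero) _)).
  exact: nearW.
by move=> i; rewrite scaleN1r addr0 opprB.
Qed.

Lemma unull_trans x y z : unull (usub x y) -> unull (usub y z) -> unull (usub x z).
Proof.
by move=> h1 h2; apply: (unull_lin (a := 1) h1 h2) => i; rewrite scale1r subrKA.
Qed.

Definition ucls x : set F := [set y | ubounded y /\ unull (usub x y)].

Record ultraproduct := Ultraproduct {
  ucl : set F ;
  uclP : exists2 x, ubounded x & ucl = ucls x
}.

HB.instance Definition _ := gen_eqMixin ultraproduct.
HB.instance Definition _ := gen_choiceMixin ultraproduct.

(** Sending unbounded families to zero makes the class map [uq] total. *)
Definition uclip x : F := if pselect (ubounded x) then x else uzero.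

Lemma uclip_bounded x : ubounded (uclip x).
Proof. by rewrite /uclip; case: (pselect (ubounded x)) => //= b; exact: ubounded0. Qed.

Lemma uclip_id x : ubounded x -> uclip x = x.
Proof. by rewrite /uclip; case: (pselect (ubounded x)) => /=. Qed.

Definition uq x : ultraproduct :=
  Ultraproduct (ex_intro2 _ _ (uclip x) (uclip_bounded x) erefl).

Definition urep (C : ultraproduct) : F := sval (cid2 (uclP C)).

Lemma urep_bounded C : ubounded (urep C).
Proof. by rewrite /urep; case: (cid2 _). Qed.

Lemma ucl_inj C D : ucl C = ucl D -> C = D.
Proof.
case: C D => [C CP] [D DP] /= E; move: DP; rewrite -E => DP.
by congr Ultraproduct; exact: Prop_irrelevance.
Qed.

Lemma uqP x y : ubounded x -> ubounded y -> uq x = uq y <-> unull (usub x y).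
Proof.
move=> bx by_; split => [E|h].
  have : ucl (uq x) = ucl (uq y) by rewrite E.
  rewrite /= !uclip_id// => E'.
  have [] : ucls x y; last by [].
  by rewrite E'; split => //; apply: unull_near; apply: nearW => i; rewrite /usub subrr.
apply: ucl_inj; rewrite /= !uclip_id//; apply/seteqP; split => z [bz hz]; split => //.
  by apply: unull_trans hz; exact: unull_sym.
exact: unull_trans hz.
Qed.

Lemma uq_near x y : ubounded x -> ubounded y -> (\forall i \near U, x i = y i) -> uq x = uq y.
Proof.
move=> bx by_ xy; apply/uqP => //; apply: unull_near.
by apply: filterS xy => i; rewrite /usub => ->; rewrite subrr.
Qed.

Lemma urepK C : uq (urep C) = C.
Proof.
apply: ucl_inj; rewrite /= uclip_id; last exact: urep_bounded.
by rewrite /urep; case: (cid2 _).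
Qed.

Lemma uq_surj C : exists2 x, ubounded x & uq x = C.
Proof. by exists (urep C); [exact: urep_bounded|exact: urepK]. Qed.

Definition uq_add C D : ultraproduct := uq (uadd (urep C) (urep D)).
Definition uq_opp C : ultraproduct := uq (uscale (-1) (urep C)).
Definition uq_scale a C : ultraproduct := uq (uscale a (urep C)).

Lemma uq_addE x y : ubounded x -> ubounded y -> uq_add (uq x) (uq y) = uq (uadd x y).
Proof.
move=> bx by_; have [rx ry] := (urep_bounded (uq x), urep_bounded (uq y)).
apply/uqP; [exact: ubounded_add|exact: ubounded_add|].
have /uqP h1 := urepK (uq x); have /uqP h2 := urepK (uq y).
apply: (unull_lin (a := 1) (h1 rx bx) (h2 ry by_)) => i.
by rewrite /usub /uadd scale1r opprD addrACA.
Qed.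

Lemma uq_scaleE a x : ubounded x -> uq_scale a (uq x) = uq (uscale a x).
Proof.
move=> bx; have rx := urep_bounded (uq x).
apply/uqP; [exact: ubounded_scale|exact: ubounded_scale|].
have /uqP h1 := urepK (uq x).
apply: (unull_lin (a := a) (h1 rx bx) (unull_near (x := uzero) _)); first exact: nearW.
by move=> i; rewrite /usub /uscale addr0 scalerBr.
Qed.

Lemma uq_oppE x : ubounded x -> uq_opp (uq x) = uq (uscale (-1) x).
Proof. exact: uq_scaleE. Qed.

Lemma uq_addA : associative uq_add.
Proof.
move=> C D E; have [x bx <-] := uq_surj C; have [y by_ <-] := uq_surj D; have [z bz <-] := uq_surj E.
rewrite !uq_addE//; [|exact: ubounded_add|exact: ubounded_add].
by apply: uq_near; [do 2?apply: ubounded_add => //|do 2?apply: ubounded_add => //|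
  apply: nearW => i; rewrite /uadd addrA].
Qed.

Lemma uq_addC : commutative uq_add.
Proof.
move=> C D; have [x bx <-] := uq_surj C; have [y by_ <-] := uq_surj D.
rewrite !uq_addE//; apply: uq_near; [exact: ubounded_add|exact: ubounded_add|].
by apply: nearW => i; rewrite /uadd addrC.
Qed.

Lemma uq_add0 : left_id (uq uzero) uq_add.
Proof.
move=> C; have [x bx <-] := uq_surj C; rewrite uq_addE//; last exact: ubounded0.
apply: uq_near => //; first by apply: ubounded_add => //; exact: ubounded0.
by apply: nearW => i; rewrite /uadd add0r.
Qed.

Lemma uq_addN : left_inverse (uq uzero) uq_opp uq_add.
Proof.
move=> C; have [x bx <-] := uq_surj C; have bN := ubounded_scale (-1) bx.
rewrite uq_oppE// uq_addE//; apply: uq_near; [exact: ubounded_add|exact: ubounded0|].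
by apply: nearW => i; rewrite /uadd /uscale scaleN1r addNr.
Qed.

HB.instance Definition _ := GRing.isZmodule.Build ultraproduct
  uq_addA uq_addC uq_add0 uq_addN.

Lemma uq_scaleA a b C : uq_scale a (uq_scale b C) = uq_scale (a * b) C.
Proof.
have [x bx <-] := uq_surj C; have bb := ubounded_scale b bx.
rewrite !uq_scaleE//; apply: uq_near; [exact: ubounded_scale|exact: ubounded_scale|].
by apply: nearW => i; rewrite /uscale scalerA.
Qed.

Lemma uq_scale1 : left_id 1 uq_scale.
Proof.
move=> C; have [x bx <-] := uq_surj C; rewrite uq_scaleE//.
apply: uq_near => //; first exact: ubounded_scale.
by apply: nearW => i; rewrite /uscale scale1r.
Qed.

Lemma uq_scaleDr : right_distributive uq_scale +%R.
Proof.
move=> a C D; have [x bx <-] := uq_surj C; have [y by_ <-] := uq_surj D.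
have bax := ubounded_scale a bx; have bay := ubounded_scale a by_.
rewrite -![_ + _]/(uq_add _ _) uq_addE// !uq_scaleE//; last exact: ubounded_add.
rewrite uq_addE//; apply: uq_near; [by apply: ubounded_scale; exact: ubounded_add|exact: ubounded_add|].
by apply: nearW => i; rewrite /uscale /uadd scalerDr.
Qed.

Lemma uq_scaleDl C : {morph uq_scale^~ C : a b / a + b}.
Proof.
move=> a b; have [x bx <-] := uq_surj C.
have bax := ubounded_scale a bx; have bbx := ubounded_scale b bx.
rewrite -![uq_scale _ _ + _]/(uq_add _ _) !uq_scaleE// uq_addE//.
apply: uq_near; [exact: ubounded_scale|exact: ubounded_add|].
by apply: nearW => i; rewrite /uscale /uadd scalerDl.
Qed.

HB.instance Definition _ := GRing.Zmodule_isLmodule.Build R[i] ultraproduct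
  uq_scaleA uq_scale1 uq_scaleDr uq_scaleDl.

Lemma uq_linE a x y : ubounded x -> ubounded y ->
  uq (fun i => a *: x i + y i) = a *: uq x + uq y.
Proof.
move=> bx by_; have bax := ubounded_scale a bx.
transitivity (uq_add (uq_scale a (uq x)) (uq y)); last by [].
by rewrite uq_scaleE// uq_addE.
Qed.

Lemma uq_subE x y : ubounded x -> ubounded y -> uq (usub x y) = uq x - uq y.
Proof.
move=> bx by_; rewrite addrC -scaleN1r -uq_linE//; congr uq.
by apply: functional_extensionality_dep => i; rewrite /usub scaleN1r addrC.
Qed.

Definition udot (C D : ultraproduct) : R[i] :=
  xget 0 [set l : R[i] | (fun i => hilbert_dot (H i) (urep C i) (urep D i)) @ U --> (l : R[i]^o)].

Lemma ubounded_dot x y : ubounded x -> ubounded y ->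
  exists2 M : R, 0 <= M & forall i, Normc.normc (hilbert_dot (H i) (x i) (y i)) <= M.
Proof.
move=> [M xM] [M' yM].
have [M0|M0] := leP 0 M; last first.
  exists 0 => // i; have := le_lt_trans (xM i) M0; rewrite ltNge hnorm_ge0//.
have [M'0|M'0] := leP 0 M'; last first.
  exists 0 => // i; have := le_lt_trans (yM i) M'0; rewrite ltNge hnorm_ge0//.
exists (M * M'); first exact: mulr_ge0.
move=> i; apply: (le_trans (normc_dot_le _ _ _)).
by apply: ler_pM; rewrite ?dot_norm_ge0//; [exact: xM|exact: yM].
Qed.

(** The limit along the chosen representatives exists because their pairings are bounded. Passing to
    other representatives changes the pairings by a null amount, by Cauchy-Schwarz and
    boundedness. *)
Lemma udot_cvg x y : ubounded x -> ubounded y ->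
  (fun i => hilbert_dot (H i) (x i) (y i)) @ U --> (udot (uq x) (uq y) : R[i]^o).
Proof.
move=> bx by_; have rx := urep_bounded (uq x); have ry := urep_bounded (uq y).
have [M M0 hM] := ubounded_dot rx ry.
have [l hl] := ultra_cvgC UU hM.
have {hl} : (fun i => hilbert_dot (H i) (urep (uq x) i) (urep (uq y) i)) @ U --> (udot (uq x) (uq y) : R[i]^o).
  exact: (@xgetPex _ 0 [set l : R[i] | (fun i => hilbert_dot (H i) (urep (uq x) i) (urep (uq y) i)) @ U --> (l : R[i]^o)] (ex_intro _ l hl)).
move: (udot _ _) => {}l /cvgC_normP hl.
have /uqP h1 := urepK (uq x); have /uqP h2 := urepK (uq y).
have {}h1 := h1 rx bx; have {}h2 := h2 ry by_.
have [Mx xM] := bx; have [My yM] := ry.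
have c0 : (fun i => hnorm (usub (urep (uq x)) x i) * My + Mx * hnorm (usub (urep (uq y)) y i)) @ U --> (0 : R).
  rewrite -[X in _ --> X]addr0 -[X in _ --> X + _](mul0r My) -[X in _ --> _ + X](mulr0 Mx).
  by apply: cvgD; apply: cvgM => //; exact: cvg_cst.
apply/cvgC_normP => e e0; have e2 : 0 < e / 2 by rewrite divr_gt0.
have near1 := hl _ e2.
have near2 : \forall i \near U, hnorm (usub (urep (uq x)) x i) * My + Mx * hnorm (usub (urep (uq y)) y i) < e / 2.
  by apply: (cvgr_lt _ c0).
apply: filterS2 near1 near2 => i; set d := hilbert_dot (H i) => n1 n2.
have -> : d (x i) (y i) - l = (d (urep (uq x) i) (urep (uq y) i) - l) +
    - (d (usub (urep (uq x)) x i) (urep (uq y) i) + d (x i) (usub (urep (uq y)) y i)).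
  rewrite /usub dotBl dotBr.
  move: (d (urep _ i) (urep _ i)) (d (x i) (urep _ i)) (d (x i) (y i)) => u v w; ring.
rewrite [e]splitr; apply: (le_lt_trans (le_normcD _ _)); apply: ltrD => //.
rewrite normcN; apply: le_lt_trans n2; apply: (le_trans (le_normcD _ _)).
apply: lerD; apply: (le_trans (normc_dot_le _ _ _)).
  by apply: ler_wpM2l; [exact: dot_norm_ge0|exact: yM].
by apply: ler_wpM2r; [exact: dot_norm_ge0|exact: xM].
Qed.

Lemma uhermitian C D : udot C D = (-1) ^+ false * Num.conj (udot D C).
Proof.
rewrite expr0 mul1r; have [x bx <-] := uq_surj C; have [y by_ <-] := uq_surj D.
have h := udot_cvg bx by_.
apply: (cvg_unique (@norm_hausdorff R[i] R[i]^o) h).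
have k := udot_cvg by_ bx.
have kr := cvgC_Re PU k; have ki := cvgN (cvgC_Im PU k).
pose d i := hilbert_dot (H i) (x i) (y i); pose d' i := hilbert_dot (H i) (y i) (x i).
have Er : (fun i => complex.Re (d i)) = (fun i => complex.Re (d' i)).
  by apply/funext => i; rewrite /d dotC Rec_conj.
have Ei : (fun i => complex.Im (d i)) = \- (fun i => complex.Im (d' i)).
  by apply/funext => i; rewrite /d dotC Imc_conj.
by apply: cvgC_ReIm; [rewrite -/d Er Rec_conj; exact: kr|rewrite -/d Ei Imc_conj; exact: ki].
Qed.

Lemma udotDl a C C' D : udot (a *: C + C') D = a * udot C D + udot C' D.
Proof.
have [x bx <-] := uq_surj C; have [x' bx' <-] := uq_surj C'; have [y by_ <-] := uq_surj D.
rewrite -uq_linE//; have bl := ubounded_add (ubounded_scale a bx) bx'.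
apply: (cvg_unique (@norm_hausdorff R[i] R[i]^o) (udot_cvg bl by_)).
rewrite (_ : (fun i => _) = (fun i => a * hilbert_dot (H i) (x i) (y i) + hilbert_dot (H i) (x' i) (y i))).
  apply: (@cvgD R[i] R[i]^o); last exact: udot_cvg.
  by apply: (@cvgM R[i]); [exact: cvg_cst|exact: udot_cvg].
by apply/funext => i; rewrite dotDl dotZl.
Qed.

Lemma udot_bilinear : bilinear_for (GRing.Scale.Law.clone _ _ *%R _)
  (GRing.Scale.Law.clone _ _ (@Num.conj R[i] \; *%R) _) udot.
Proof.
split=> [D a C C'|C a D D']; first exact: udotDl.
rewrite uhermitian expr0 mul1r udotDl rmorphD rmorphM /=.
by rewrite [in RHS](uhermitian C D) [in RHS](uhermitian C D') !expr0 !mul1r.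
Qed.

Lemma udot_norm x : ubounded x -> (fun i => hnorm (x i)) @ U --> Num.sqrt (complex.Re (udot (uq x) (uq x))).
Proof.
move=> bx; have h := cvgC_Re PU (udot_cvg bx bx).
have k := @sqrt_continuous R (complex.Re (udot (uq x) (uq x))).
apply: (@cvg_comp _ _ _ (fun i => complex.Re (hilbert_dot (H i) (x i) (x i)))
  (@Num.sqrt R) _ (nbhs (complex.Re (udot (uq x) (uq x))))); [exact: h|exact: k].
Qed.

Lemma udot_pos C : C != 0 -> 0 < udot C C.
Proof.
have [x bx <-] := uq_surj C => x0.
have E i : hilbert_dot (H i) (x i) (x i) = (hnorm (x i) ^+ 2)%:C%C by rewrite dot_norm_sqr dot_self.
have im0 : complex.Im (udot (uq x) (uq x)) = 0.
  have := cvgC_Im PU (udot_cvg bx bx) => h.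
  apply: (cvg_unique (@norm_hausdorff R R) h).
  by rewrite (_ : (fun i => _) = fun=> 0); [exact: cvg_cst|apply/funext => i; rewrite E].
have re0 : 0 <= complex.Re (udot (uq x) (uq x)).
  apply: (cvgr_to_ge (cvgC_Re PU (udot_cvg bx bx))); apply: nearW => i.
  by rewrite E /= sqr_ge0.
rewrite ltcE im0 eqxx /= lt_def re0 andbT; apply: contra x0 => /eqP re.
apply/eqP; have := udot_norm bx; rewrite re sqrtr0 => nx.
have b0 := ubounded0; apply/(uqP bx b0); rewrite /unull.
by under eq_fun do rewrite /usub subr0.
Qed.

HB.instance Definition _ := bilinear_isBilinear.Build R[i] ultraproduct ultraproduct R[i]
  *%R (@Num.conj R[i] \; *%R) udot udot_bilinear.
HB.instance Definition _ := isHermitianSesquilinear.Build R[i] ultraproduct false (@Num.conj R[i]) udot uhermitian.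
HB.instance Definition _ := isDotProduct.Build R[i] ultraproduct udot udot_pos.

Definition ultra_dot : {dot ultraproduct for (@Num.conj R[i])} := udot.

Let unorm := dot_norm ultra_dot.

Lemma unorm_cvg x : ubounded x -> (fun i => hnorm (x i)) @ U --> unorm (uq x).
Proof. exact: udot_norm. Qed.

Lemma unorm_le x (r : R) : ubounded x -> (\forall i \near U, hnorm (x i) <= r) ->
  unorm (uq x) <= r.
Proof. by move=> bx h; exact: (cvgr_to_le (unorm_cvg bx) h). Qed.

Lemma unorm_lt x (r : R) : ubounded x -> unorm (uq x) < r ->
  \forall i \near U, hnorm (x i) < r.
Proof. by move=> bx; exact: (cvgr_lt _ (unorm_cvg bx)). Qed.

(* A fast Cauchy sequence has representatives that are Cauchy at every index, *)
(* uniformly, by keeping the previous value at the indices where the next     *)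
(* representative is too far.                                                 *)
Fixpoint uadjust (v : nat -> ultraproduct) (k : nat) : F :=
  if k is k'.+1 then fun i =>
    let z := urep (v k) i in let p := uadjust v k' i in
    if hnorm (z - p) <= 2^-1 ^+ k' then z else p
  else urep (v 0%N).

Lemma uadjust_step v k i : hnorm (uadjust v k.+1 i - uadjust v k i) <= 2^-1 ^+ k.
Proof.
rewrite /=; case: ifP => // _; rewrite subrr hnorm0; apply: exprn_ge0.
by rewrite invr_ge0.
Qed.

Lemma uadjust_bounded v k : ubounded (uadjust v k).
Proof.
elim: k => [|k [M IH]]; first exact: urep_bounded.
exists (M + 2^-1 ^+ k) => i.
rewrite -(subrK (uadjust v k i) (uadjust v k.+1 i)) addrC.
by apply: (le_trans (hnormD _ _)); apply: lerD => //; exact: uadjust_step.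
Qed.

Lemma uadjustE v k : (forall k, unorm (v k.+1 - v k) < 2^-1 ^+ k) -> uq (uadjust v k) = v k.
Proof.
move=> vk; elim: k => [|k IH]; first exact: urepK.
rewrite -[RHS]urepK; apply: uq_near; [exact: uadjust_bounded|exact: urep_bounded|].
have bs := ubounded_sub (urep_bounded (v k.+1)) (uadjust_bounded v k).
have := vk k; rewrite -IH -[X in unorm (X - _)]urepK -uq_subE; [|exact: urep_bounded|exact: uadjust_bounded].
move=> /(unorm_lt bs); apply: filterS => i; rewrite /usub => h /=.
by rewrite ltW.
Qed.

Lemma uadjust_tail v k l i : (k <= l)%N ->
  hnorm (uadjust v l i - uadjust v k i) <= 2 * 2^-1 ^+ k - 2 * 2^-1 ^+ l.
Proof.
move=> /subnK <-; elim: (l - k)%N => [|j IH]; first by rewrite add0n !subrr hnorm0.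
rewrite addSn -(subrKA (uadjust v (j + k) i)); apply: (le_trans (hnormD _ _)).
have := uadjust_step v (j + k) i; rewrite exprS mulrA divff ?mul1r; last by rewrite pnatr_eq0.
by move: IH; move: (2^-1 ^+ (j + k)) (2^-1 ^+ k) => p q; lra.
Qed.

Lemma half_pow_lt (e : R) : 0 < e -> exists k : nat, 2^-1 ^+ k < e.
Proof.
move=> e0; have h : (fun n => 2^-1 ^+ n : R) @ \oo --> (0 : R).
  by apply: cvg_expr; rewrite ger0_norm ?invr_ge0// invf_lt1// ltr1n.
have [k _ hk] : \forall n \near \oo, (2^-1 ^+ n : R) < e by exact: (cvgr_lt _ h).
by exists k; apply: hk => /=.
Qed.

Lemma ultra_complete (u : nat -> ultraproduct) :
  (forall e : R, 0 < e -> exists n0, forall m n, (n0 <= m)%N -> (n0 <= n)%N ->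
     dot_norm ultra_dot (u m - u n) < e) ->
  exists l, forall e : R, 0 < e -> exists n0, forall n, (n0 <= n)%N ->
     dot_norm ultra_dot (u n - l) < e.
Proof.
move=> cu.
have p0 k : 0 < 2^-1 ^+ k :> R by rewrite exprn_gt0// invr_gt0.
have /choice[n0 hn] k := cu _ (p0 k).
(* The maximum over all [j] up to [k] keeps both [psi k] and [psi k.+1] beyond [n0 k], so
   consecutive terms of [v] are within [2^-1 ^+ k]. *)
pose psi k := (\max_(j < k.+1) n0 j)%N.
have psi_ge j k : (j <= k)%N -> (n0 j <= psi k)%N.
  by move=> jk; exact: (@leq_bigmax_cond _ xpredT (fun j : 'I_k.+1 => n0 j) (Ordinal (jk : (j < k.+1)%N))).
pose v k := u (psi k).
have vk k : unorm (v k.+1 - v k) < 2^-1 ^+ k.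
  by apply: hn; exact: psi_ge.
(* The rate does not depend on [i], so the coordinatewise limits form a bounded family and the
   estimate passes to the ultraproduct. *)
have ex i : exists l : H i, forall k, hnorm (uadjust v k i - l) <= 2 * 2^-1 ^+ k.
  have [|l lP] := @hilbert_complete _ (H i) (fun k => uadjust v k i).
    move=> e e0; have [k0 hk] := half_pow_lt (divr_gt0 e0 (ltr0n _ 4 : 0 < 4%:R)).
    have h j : (k0 <= j)%N -> hnorm (uadjust v j i - uadjust v k0 i) < e / 2.
      move=> kj; apply: (le_lt_trans (uadjust_tail v i kj)).
      by move: hk (p0 j); move: (2^-1 ^+ k0) (2^-1 ^+ j) => p q; lra.
    exists k0 => m n /h hm /h hn'; rewrite -(subrKA (uadjust v k0 i)).
    apply: (le_lt_trans (hnormD _ _)); rewrite [e]splitr; apply: ltrD => //.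
    by rewrite -hnormN opprB.
  exists l => k; apply/ler_addgt0Pr => e e0; have [n1 hn1] := lP _ e0.
  have hm := hn1 (maxn n1 k) (leq_maxl _ _).
  rewrite -(subrKA (uadjust v (maxn n1 k) i)) addrC; apply: (le_trans (hnormD _ _)).
  rewrite addrC; apply: lerD; last exact: ltW.
  rewrite -hnormN opprB; apply: (le_trans (uadjust_tail v i (leq_maxr n1 k))).
  by rewrite gerBl mulr_ge0// ltW.
pose y i := sval (cid (ex i)); have yP i : forall k, hnorm (uadjust v k i - y i) <= 2 * 2^-1 ^+ k.
  exact: svalP (cid (ex i)).
have by_ : ubounded y.
  have [M hM] := uadjust_bounded v 0; exists (M + 2) => i.
  rewrite -(subKr (uadjust v 0 i) (y i)); apply: (le_trans (hnormB _ _)).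
  by apply: lerD => //; have := yP i 0%N; rewrite expr0 mulr1.
exists (uq y) => e e0; have [k hk] := half_pow_lt (divr_gt0 e0 (ltr0n _ 4 : 0 < 4%:R)).
exists (psi k) => n kn; rewrite -(subrKA (v k)); apply: (le_lt_trans (dot_normD _ _ _)).
have h1 : unorm (u n - v k) < 2^-1 ^+ k.
  by apply: hn; [exact: leq_trans (psi_ge k k (leqnn k)) kn|exact: psi_ge].
have h2 : unorm (v k - uq y) <= 2 * 2^-1 ^+ k.
  rewrite -(uadjustE k vk) -uq_subE//; last exact: uadjust_bounded.
  apply: unorm_le; last by apply: nearW => i; exact: yP.
  by apply: ubounded_sub => //; exact: uadjust_bounded.
move: h1 h2 hk; rewrite /unorm; move: (2^-1 ^+ k) (dot_norm _ _) (dot_norm _ _) => p q r; lra.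
Qed.

Definition ultra_hilbert : hilbert R := Hilbert ultra_complete.

End Ultraproduct.

(** * Norms on the quotients *)

Section SystemNorms.
Variables (R : realType) (G : ptopGroupoidType).
Hypothesis lcG : lc_groupoid G.
Variables (K : nat -> set G) (eK : exhaustion K).
Variable M : nat -> G -> {measure set (borel G) -> \bar R}.
Hypothesis MR : forall k x, units x -> radon (M k x).
Hypothesis MC : forall k f, Cc f ->
  {within @units G, continuous (fun x => cintegral (M k x) setT f : R[i]^o)}.
Hypothesis hmu : haar_system (M 0%N).

Let hG : hausdorff_space G. Proof. by case: lcG. Qed.
Let lG : locally_compact [set: G]. Proof. by case: lcG. Qed.

Notation A := (gidx M).
Notation mu := (M 0%N).

Definition gfam (a : A) : quo a -> {measure set (borel (quo a)) -> \bar R} :=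
  @qfam R G a mu.

Arguments gfam : clear implicits.

Lemma gfam_haar (a : A) : haar_system (gfam a).
Proof.
apply: (quo_haar hmu) => x y ux uy axy; exact: (good_meas (gi_good a) 0 ux uy axy).
Qed.

Lemma gfam_push (a : A) x : units x -> forall B : set (borel (quo a)), measurable B ->
  gfam a (qmap a x) B = mu x (qmap a @^-1` B).
Proof.
apply: (qfam_push (m := mu)); first by move=> y uy; apply: MR.
move=> u v ux uy axy; exact: (good_meas (gi_good a) 0 ux uy axy).
Qed.

Lemma quo_locally_compact (a : A) : locally_compact [set: quo a].
Proof. by case: (quo_lc a lcG). Qed.

Lemma quo_exhaustion (a : A) : exists L : nat -> set (quo a), exhaustion L.
Proof.
apply: exhaustion_exists; first exact: quo_locally_compact.
have [cK _ KT] := eK; exists (fun n => qmap a @` K n) => [n|].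
  by apply: continuous_compact => //; apply: continuous_subspaceT; exact: qmap_cont.
rewrite -subTset => y _; have [x <-] := qmap_surj y.
have [n _ Kx] : (\bigcup_n K n) x by rewrite KT.
by exists n => //; exists x.
Qed.

Lemma qmap_units (a : A) (y : quo a) : units y -> exists2 x, units x & qmap a x = y.
Proof. exact: quo_unit. Qed.

Lemma max_norm_qmap (a : A) (f : quo a -> R[i]) : Cc f ->
  (max_norm mu (pullback (qmap a) f) <= max_norm (gfam a) f)%E.
Proof.
have [L eL] := quo_exhaustion a.
apply: (max_norm_pullback hG lG (@quo_haus _ _ a) (@quo_locally_compact a) eK eL
  (qmap_morphism a) (@qmap_cont _ _ a) (@qmap_proper _ _ a) (@qmap_units a) hmu (gfam_haar a) (@gfam_push a)).
Qed.

Lemma gbond_push (a b : A) : gle a b -> forall y, units y ->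
  forall B : set (borel (quo a)), measurable B ->
  gfam a (gbond a b y) B = gfam b y (gbond a b @^-1` B).
Proof.
move=> ab y uy B mB; have [x ux <-] := qmap_units uy.
rewrite (gbondE x ab) gfam_push// gfam_push//; last first.
  by apply: (preimage_borel (gbond_cont ab)).
by rewrite -comp_preimage gbond_comp_qmap.
Qed.

Lemma gbond_units (a b : A) : gle a b -> forall z : quo a, units z ->
  exists2 y : quo b, units y & gbond a b y = z.
Proof.
move=> ab z uz; have [x ux <-] := qmap_units uz.
exists (qmap b x); last exact: gbondE.
by have [hs _ _] := qmap_morphism b; rewrite /units /= hs ux.
Qed.

Lemma max_norm_gbond (a b : A) (f : quo a -> R[i]) : gle a b -> Cc f ->
  (max_norm (gfam b) (pullback (gbond a b) f) <= max_norm (gfam a) f)%E.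
Proof.
move=> ab; have [L eL] := quo_exhaustion a; have [L' eL'] := quo_exhaustion b.
have [mb cb pb] := gbond_pc ab.
apply: (max_norm_pullback (@quo_haus _ _ b) (@quo_locally_compact b) (@quo_haus _ _ a)
  (@quo_locally_compact a) eL' eL mb cb pb (gbond_units ab) (gfam_haar b) (gfam_haar a) (gbond_push ab)).
Qed.

Lemma gbond_descend (a b : A) f : gle a b -> factors a f ->
  pullback (gbond a b) (descend a f) = descend b f.
Proof.
move=> ab fa; apply/funext => y; have [x <-] := qmap_surj y.
rewrite /pullback gbondE// /descend.
rewrite -[LHS]/(pullback (qmap a) (descend a f) x) descendK//.
by rewrite -[RHS]/(pullback (qmap b) (descend b f) x) descendK//; exact: factors_le fa.
Qed.

Lemma inorm_descend (a : A) f : factors a f -> Cc f ->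
  inorm (gfam a) (descend a f) = inorm mu f.
Proof.
move=> fa cf; have cd := descend_Cc hG fa cf.
rewrite /inorm -{2}(descendK fa); congr fine; apply/esym.
apply: (push_I_norm (qmap_morphism a) (@qmap_cont _ _ a) (@gfam_push a) (@qmap_units a)).
by case: cd.
Qed.

Lemma conv_descend (a : A) f g : factors a f -> factors a g -> Cc f -> Cc g ->
  pullback (qmap a) (convolution (gfam a) (descend a f) (descend a g)) = convolution mu f g.
Proof.
move=> fa ga cf cg.
rewrite (pullback_convolution hG (@quo_haus _ _ a) (qmap_morphism a) (@qmap_cont _ _ a) (@gfam_push a)).
- by rewrite !descendK.
- by move=> x ux; exact: haar_conc.
- exact: descend_Cc.
- exact: descend_Cc.
Qed.

Lemma descend_pullback (a : A) (g : quo a -> R[i]) : descend a (pullback (qmap a) g) = g.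
Proof. by apply/funext => y; rewrite /descend /pullback qmapK. Qed.

Lemma involution_descend (a : A) f : factors a f ->
  pullback (qmap a) (involution (descend a f)) = involution f.
Proof. by move=> fa; rewrite (pullback_involution (qmap_morphism a)) descendK. Qed.

(** * Ultraproducts of representations of the quotients *)

Section UltraRep.
Variables (U : ultra A) (H : A -> hilbert R).
Variable rho : forall a : A, (quo a -> R[i]) -> H a -> H a.
Hypothesis tails : forall a0 : A, \forall a \near ultra_system U, gle a0 a.
Hypothesis rrho : \forall a \near ultra_system U, Cc_rep (gfam a) (@rho a).

Let good_at f (a : A) : Prop := factors a f /\ Cc_rep (gfam a) (@rho a).

Let good_near f : Cc f -> \forall a \near ultra_system U, good_at f a.
Proof.
move=> cf; have [a0 fa0] := factors_exists hG lG eK MR MC hmu cf.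
apply: filterS2 (tails a0) rrho => a a0a ra; split => //.
exact: factors_le fa0.
Qed.

Let V := ultra_hilbert U H.

(** The value 0 at the other indices keeps the bound by the I-norm valid everywhere; by [tails] and
    [rrho] those indices are negligible for the ultrafilter when [f] is in [Cc G]. *)
Definition urep_fam f (x : forall a, H a) : forall a, H a := fun a =>
  if pselect (good_at f a) then rho (descend a f) (x a) else 0.

Lemma urep_fam_near f x : Cc f ->
  \forall a \near ultra_system U, urep_fam f x a = rho (descend a f) (x a).
Proof.
move=> /good_near; apply: filterS => a ga; rewrite /urep_fam.
by case: (pselect (good_at f a)).
Qed.

Lemma rho_lin (a : A) f (z : R[i]) x y : Cc f -> good_at f a ->
  rho (descend a f) (z *: x + y) = z *: rho (descend a f) x + rho (descend a f) y.
Proof. by move=> cf [fa [r1 _ _ _ _]]; apply: r1; exact: descend_Cc. Qed.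

Lemma rho_le (a : A) f x : Cc f -> good_at f a ->
  hnorm (rho (descend a f) x) <= inorm mu f * hnorm x.
Proof.
move=> cf ga; have [fa [r1 _ _ _ r5]] := ga.
rewrite -(inorm_descend fa cf); apply: op_norm_le; last by apply: r5; exact: descend_Cc.
move=> z y; have := rho_lin z y 0 cf ga; rewrite !addr0 => ->.
have := rho_lin 1 0 0 cf ga; rewrite scaler0 !addr0 scale1r => /eqP.
by rewrite -[X in X == _]addr0 (inj_eq (addrI _)) eq_sym => /eqP ->; rewrite addr0.
Qed.

Lemma urep_fam_le f x a : Cc f -> hnorm (urep_fam f x a) <= inorm mu f * hnorm (x a).
Proof.
move=> cf; rewrite /urep_fam; case: (pselect (good_at f a)) => [ga|_] /=.
  exact: rho_le.
by rewrite hnorm0 mulr_ge0 ?inorm_ge0 ?hnorm_ge0.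
Qed.

Lemma urep_fam_bounded f x : Cc f -> ubounded x -> ubounded (urep_fam f x).
Proof.
move=> cf [B xB]; exists (inorm mu f * B) => a.
by apply: (le_trans (urep_fam_le x a cf)); apply: ler_wpM2l; rewrite ?inorm_ge0.
Qed.

Definition urho f (C : V) : V := uq U (urep_fam f (urep C)).

Lemma urhoE f x : Cc f -> ubounded x -> urho f (uq U x) = uq U (urep_fam f x).
Proof.
move=> cf bx; have rx := urep_bounded (uq U x).
apply/uqP; [exact: urep_fam_bounded|exact: urep_fam_bounded|].
have /uqP h1 := urepK (uq U x); have {}h1 := h1 rx bx.
apply: (@unull_dom _ _ _ _ _ (fun a => inorm mu f * hnorm (usub (urep (uq U x)) x a))).
  apply: filterS2 (good_near cf) (good_near cf) => a ga _.
  rewrite /usub /urep_fam; case: (pselect (good_at f a)) => // _ /=.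
  have -> : rho (descend a f) (urep (uq U x) a) - rho (descend a f) (x a) =
      rho (descend a f) (urep (uq U x) a - x a).
    have := rho_lin (-1) (x a) (urep (uq U x) a) cf ga.
    by rewrite !scaleN1r addrC => ->; rewrite addrC.
  exact: rho_le.
rewrite -[X in _ --> X](mulr0 (inorm mu f)).
by apply: cvgM => //; exact: cvg_cst.
Qed.

Lemma urho_norm f x r : Cc f -> ubounded x ->
  (\forall a \near ultra_system U, r <= hnorm (rho (descend a f) (x a))) ->
  r <= hnorm (urho f (uq U x) : V).
Proof.
move=> cf bx hr; rewrite urhoE//.
have bf := urep_fam_bounded cf bx.
apply: (cvgr_to_ge (unorm_cvg bf)).
by apply: filterS2 hr (urep_fam_near x cf) => a h ->.
Qed.

(** Each algebraic identity holds at all indices to which the functions involved descend. These form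
    a set of the ultrafilter, and agreement there is equality in the ultraproduct. *)
Lemma urho_rep : Cc_rep mu urho.
Proof.
have XC f g : Cc f -> Cc g -> Cc (convolution mu f g) by exact: (convolution_Cc hG lG hmu).
split.
- move=> f cf z C D; have [x bx <-] := uq_surj C; have [y by_ <-] := uq_surj D.
  rewrite -uq_linE// !urhoE//; last by apply: ubounded_add => //; exact: ubounded_scale.
  rewrite -uq_linE; [|exact: urep_fam_bounded|exact: urep_fam_bounded].
  apply: uq_near.
  - by apply: urep_fam_bounded => //; apply: ubounded_add => //; exact: ubounded_scale.
  - by apply: ubounded_add; [apply: ubounded_scale|]; exact: urep_fam_bounded.
  apply: filterS (good_near cf) => a ga; rewrite /urep_fam.
  by case: (pselect (good_at f a)) => //= _; exact: rho_lin.
- move=> f g cf cg z C; have [x bx <-] := uq_surj C; have cl := Cc_lin hG z cf cg.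
  rewrite !urhoE// -uq_linE; [|exact: urep_fam_bounded|exact: urep_fam_bounded].
  apply: uq_near; first exact: urep_fam_bounded.
    by apply: ubounded_add; [apply: ubounded_scale|]; exact: urep_fam_bounded.
  near=> a; have [fa [_ r2 _ _ _]] : good_at f a by near: a; exact: good_near.
  have [ga _] : good_at g a by near: a; exact: good_near.
  have -> : urep_fam (z *: f + g) x a = rho (descend a (z *: f + g)) (x a).
    by near: a; exact: urep_fam_near.
  have -> : urep_fam f x a = rho (descend a f) (x a) by near: a; exact: urep_fam_near.
  have -> : urep_fam g x a = rho (descend a g) (x a) by near: a; exact: urep_fam_near.
  exact: (r2 _ _ (descend_Cc hG fa cf) (descend_Cc hG ga cg) z (x a)).
- move=> f g cf cg C; have [x bx <-] := uq_surj C; have cl := XC _ _ cf cg.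
  have bg := urep_fam_bounded cg bx.
  rewrite !urhoE//; apply: uq_near; [exact: urep_fam_bounded|exact: urep_fam_bounded|].
  near=> a; have [fa [_ _ r3 _ _]] : good_at f a by near: a; exact: good_near.
  have [ga _] : good_at g a by near: a; exact: good_near.
  have -> : urep_fam (convolution mu f g) x a = rho (descend a (convolution mu f g)) (x a).
    by near: a; exact: urep_fam_near.
  have -> : urep_fam f (urep_fam g x) a = rho (descend a f) (urep_fam g x a).
    by near: a; exact: urep_fam_near.
  have -> : urep_fam g x a = rho (descend a g) (x a) by near: a; exact: urep_fam_near.
  rewrite -r3; [|exact: descend_Cc|exact: descend_Cc].
  by rewrite -(conv_descend fa ga cf cg) descend_pullback.
- move=> f cf C D; have [x bx <-] := uq_surj C; have [y by_ <-] := uq_surj D.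
  have ci := involution_Cc hG cf.
  rewrite !urhoE//; have h1 := udot_cvg (UF := U) (urep_fam_bounded cf bx) by_.
  have h2 := udot_cvg (UF := U) bx (urep_fam_bounded ci by_).
  apply: (cvg_unique (@norm_hausdorff R[i] R[i]^o) h1); apply: cvg_trans h2.
  apply: near_eq_cvg; near=> a.
  have [fa [_ _ _ r4 _]] : good_at f a by near: a; exact: good_near.
  have -> : urep_fam f x a = rho (descend a f) (x a) by near: a; exact: urep_fam_near.
  have -> : urep_fam (involution f) y a = rho (descend a (involution f)) (y a).
    by near: a; exact: urep_fam_near.
  rewrite r4; last exact: descend_Cc.
  by rewrite -(involution_descend fa) descend_pullback.
- move=> f cf; apply: op_norm_leP; first exact: inorm_ge0.
  move=> C; have [x bx <-] := uq_surj C; rewrite urhoE//.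
  have h1 := unorm_cvg (UF := U) (urep_fam_bounded cf bx); have h2 := unorm_cvg (UF := U) bx.
  rewrite -subr_ge0.
  have h3 : (fun a => inorm mu f * hnorm (x a) - hnorm (urep_fam f x a)) @ ultra_system U -->
      inorm mu f * hnorm (uq U x : V) - hnorm (uq U (urep_fam f x) : V).
    by apply: cvgB; [apply: cvgM; [exact: cvg_cst|exact: h2]|exact: h1].
  apply: (cvgr_to_ge h3); apply: nearW => a.
  by rewrite subr_ge0; exact: urep_fam_le.
Unshelve. all: by end_near. Qed.

End UltraRep.

End SystemNorms.

Arguments gfam {R G M} a _.

(** * The maximal C*-algebra as a union *)

Section CstarUnion.
Variables (R : realType) (G : ptopGroupoidType).
Hypothesis lcG : lc_groupoid G.
Variables (K : nat -> set G) (eK : exhaustion K).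
Variable M : nat -> G -> {measure set (borel G) -> \bar R}.
Hypothesis MR : forall k x, units x -> radon (M k x).
Hypothesis MC : forall k f, Cc f ->
  {within @units G, continuous (fun x => cintegral (M k x) setT f : R[i]^o)}.
Hypothesis hmu : haar_system (M 0%N).

Let hG : hausdorff_space G. Proof. by case: lcG. Qed.
Let lG : locally_compact [set: G]. Proof. by case: lcG. Qed.

Notation A := (gidx M).
Notation mu := (M 0%N).
Notation nu := gfam.

Lemma max_norm_witness (a : A) (f : quo a -> R[i]) (c : R) : Cc f ->
  (c%:E < max_norm (nu a) f)%E ->
  exists (H : hilbert R) rho (x : H), [/\ Cc_rep (nu a) rho, hnorm x <= 1 & c < hnorm (rho f x)].
Proof.
move=> cf; have [L eL] := quo_exhaustion lcG eK a.
rewrite (max_normE (@quo_haus _ _ a) (@quo_locally_compact _ _ lcG _ a) eL (gfam_haar hmu a) cf).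
move=> /ereal_sup_gt[_ [H [rho [hr ->]]]] /ereal_sup_gt[_ [x /= x1 <-]].
by rewrite lte_fin => cx; exists H, rho, x.
Qed.

(* If all the norms of the quotients of [f] exceed [c], then so does the norm *)
(* of the ultraproduct of representations that witness it.                    *)
Lemma max_norm_descend_lt (f : G -> R[i]) (c : R) : Cc f -> (max_norm mu f < c%:E)%E ->
  exists2 a : A, factors a f & (max_norm (nu a) (descend a f) < c%:E)%E.
Proof.
move=> cf fc; apply: contrapT => /forall2NP nex.
(* A limit of norms above [c'] is only known to be at least [c']; choosing [c'] strictly above the
   norm of [f] still yields a contradiction. *)
have [c' fc' cc'] : exists2 c' : R, (max_norm mu f < c'%:E)%E & c' < c.
  case E : (max_norm mu f) fc => [r| |] //=.
    by rewrite lte_fin => rc; exists ((r + c) / 2); rewrite ?lte_fin; lra.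
  by move=> _; exists (c - 1); [exact: ltNyr|rewrite gtrBl].
have [a0 fa0] := factors_exists hG lG eK MR MC hmu cf.
have wit (a : A) : factors a f -> exists (H : hilbert R) rho (x : H),
    [/\ Cc_rep (nu a) rho, hnorm x <= 1 & c' < hnorm (rho (descend a f) x)].
  move=> fa; apply: max_norm_witness; first exact: descend_Cc.
  have [//|/negP] := nex a; rewrite -leNgt; apply: lt_le_trans.
  by rewrite lte_fin.
have [H0 _] := wit a0 fa0.
pose data (a : A) := {H : hilbert R & (((quo a -> R[i]) -> H -> H) * H)%type}.
(* Where [f] does not descend, the zero maps on [H0] fill the place, so that the family is indexed
   by all of [A]. *)
have ex (a : A) : exists D : data a, hnorm (projT2 D).2 <= 1 /\ (factors a f ->
    Cc_rep (nu a) (projT2 D).1 /\ c' < hnorm ((projT2 D).1 (descend a f) (projT2 D).2)).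
  have [fa|nfa] := pselect (factors a f).
    by have [H [rho [x [h1 h2 h3]]]] := wit a fa; exists (existT _ H (rho, x)).
  by exists (existT _ H0 (fun _ _ => 0, 0)); split => //=; rewrite hnorm0.
pose D a := sval (cid (ex a)).
have DP a : hnorm (projT2 (D a)).2 <= 1 /\ (factors a f -> Cc_rep (nu a) (projT2 (D a)).1 /\
    c' < hnorm ((projT2 (D a)).1 (descend a f) (projT2 (D a)).2)) := svalP (cid (ex a)).
have [_ refl trans dir] := gle_directed hG lG eK MR MC hmu.
pose tail (a : A) : set A := [set b | gle a b].
have FF : ProperFilter (filter_from [set: A] tail).
  apply: filter_from_proper; last by move=> a _; exists a; exact: refl.
  apply: filter_from_filter; first by exists a0.
  move=> a b _ _; have [d [ad bd]] := dir a b; exists d => // x dx.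
  by split; [exact: trans dx|exact: trans dx].
(* An ultrafilter containing all tails of the directed set: each function of [Cc G] descends at
   almost all of its indices. *)
have [U0 [UU tU]] := ultraFilterLemma FF; pose U := Ultra UU.
have tails a : \forall b \near ultra_system U, gle a b by apply: tU; exists a.
have fnear : \forall a \near ultra_system U, factors a f.
  by apply: filterS (tails a0) => a a0a; exact: factors_le fa0.
have rrho : \forall a \near ultra_system U, Cc_rep (nu a) (projT2 (D a)).1.
  by apply: filterS fnear => a /(DP a).2[].
pose x a := (projT2 (D a)).2.
have bx : ubounded x by exists 1 => a; exact: (DP a).1.
have hrep := urho_rep lcG eK MR MC hmu tails rrho.
have lo := urho_norm lcG eK MR MC hmu tails rrho cf bx (r := c').
have : (c'%:E <= max_norm mu f)%E.
  apply: le_trans (iffLR (max_normP hG lG eK hmu _ cf) (lexx _) _ _ hrep).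
  apply: (@le_trans _ _ (hnorm (urho (fun a => (projT2 (D a)).1) f (uq U x) : ultra_hilbert U _))%:E).
    rewrite lee_fin; apply: lo.
    by apply: filterS fnear => a /(DP a).2[_ /ltW].
  apply: ereal_sup_ubound; exists (uq U x) => //.
  by apply: unorm_le => //; apply: nearW => a; exact: (DP a).1.
by rewrite leNgt fc'.
Qed.

(** For each triple [(m, n, k)] with the norm of [u m - u n] below [2^-1 ^+ k], some index already
    has its quotient norm below that bound. An upper bound [b] of these countably many indices
    works, as norms decrease along connecting maps. *)
Lemma ncauchy_descend (u : nat -> G -> R[i]) : ncauchy (max_norm mu) (@Cc R G) u ->
  exists2 a : A, (forall n, factors a (u n)) &
    ncauchy (max_norm (nu a)) (@Cc R (quo a)) (fun n => descend a (u n)).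
Proof.
move=> [Xu cu]; have XB m n : Cc (u m - u n) := CcB hG (Xu m) (Xu n).
have /choice[s sP] (p : nat * nat * nat) : exists a : A,
    (max_norm mu (u p.1.1 - u p.1.2)%R < (2^-1 ^+ p.2)%:E)%E ->
    factors a (u p.1.1 - u p.1.2) /\
    (max_norm (nu a) (descend a (u p.1.1 - u p.1.2)%R) < (2^-1 ^+ p.2)%:E)%E.
  have [h|h] := pselect (max_norm mu (u p.1.1 - u p.1.2)%R < (2^-1 ^+ p.2)%:E)%E.
    by have [a fa ha] := max_norm_descend_lt (XB _ _) h; exists a.
  by have [a _] := factors_exists hG lG eK MR MC hmu (Xu 0%N); exists a.
have [a0 fa0] := factors_seq hG lG eK MR MC hmu Xu.
have [b bP] := gle_ub hG lG eK MR MC hmu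
  (fun j => if j is j'.+1 then oapp s a0 (unpickle j') else a0).
have a0b : gle a0 b := bP 0%N.
have sb p : gle (s p) b by have := bP (pickle p).+1; rewrite /= pickleK.
exists b => [n|]; first exact: factors_le (fa0 n).
split => [n|e e0]; first by apply: descend_Cc => //; exact: factors_le (fa0 n).
have [k hk] := half_pow_lt e0; have p0 : 0 < 2^-1 ^+ k :> R by rewrite exprn_gt0// invr_gt0.
have [n0 hn] := cu _ p0; exists n0 => m n m0 n0n.
have [fs hs] := sP (m, n, k) (hn m n m0 n0n).
have cs := descend_Cc hG fs (XB m n).
have := max_norm_gbond lcG eK MR hmu (sb (m, n, k)) cs.
rewrite gbond_descend// => h; apply: le_lt_trans h _; apply: (lt_trans hs).
by rewrite lte_fin.
Qed.

Let XB f g : Cc f -> Cc g -> Cc (f - g : G -> R[i]). Proof. exact: CcB. Qed.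
Let N0 (e : R) : 0 < e -> (max_norm mu 0%R < e%:E)%E.
Proof. exact: (max_norm0 hG lG eK hmu). Qed.
Let NB f g (e e' : R) : Cc f -> Cc g -> (max_norm mu f < e%:E)%E -> (max_norm mu g < e'%:E)%E ->
  (max_norm mu (f - g)%R < (e + e')%:E)%E.
Proof. exact: (max_normB hG lG eK hmu). Qed.

Lemma ncauchy_pullback (a : A) v : ncauchy (max_norm (nu a)) (@Cc R (quo a)) v ->
  ncauchy (max_norm mu) (@Cc R G) (fun n => pullback (qmap a) (v n)).
Proof.
move=> [Xv cv]; split => [n|e e0].
  exact: (pullback_Cc hG (@quo_haus _ _ a) (@qmap_cont _ _ a) (@qmap_proper _ _ a)).
have [n0 hn] := cv e e0; exists n0 => m n m0 n0n.
apply: le_lt_trans (hn m n m0 n0n).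
exact: (max_norm_qmap lcG eK MR hmu (CcB (@quo_haus _ _ a) (Xv m) (Xv n))).
Qed.

Lemma pullback_Cstar_nclass (a : A) v : ncauchy (max_norm (nu a)) (@Cc R (quo a)) v ->
  pullback_Cstar mu (qmap a) (nclass (max_norm (nu a)) (@Cc R (quo a)) v) =
  nclass (max_norm mu) (@Cc R G) (fun n => pullback (qmap a) (v n)).
Proof.
move=> cv; have [L eL] := quo_exhaustion lcG eK a.
have vv : nclass (max_norm (nu a)) (@Cc R (quo a)) v v.
  apply: nclass_mem => // e.
  exact: (max_norm0 (@quo_haus _ _ a) (@quo_locally_compact _ _ lcG _ a) eL (gfam_haar hmu a)).
apply: (completion_mapE XB N0 NB vv) => [v' [[Xv' _] _] n|v' [[Xv' _] h] e e0].
  exact: (pullback_Cc hG (@quo_haus _ _ a) (@qmap_cont _ _ a) (@qmap_proper _ _ a)).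
have Xv := proj1 cv.
have XBa f g : Cc f -> Cc g -> Cc (f - g : quo a -> R[i]) by exact: (CcB (@quo_haus _ _ a)).
have N0a (e' : R) : 0 < e' -> (max_norm (nu a) 0%R < e'%:E)%E.
  exact: (max_norm0 (@quo_haus _ _ a) (@quo_locally_compact _ _ lcG _ a) eL (gfam_haar hmu a)).
have NBa f g (e1 e' : R) : Cc f -> Cc g -> (max_norm (nu a) f < e1%:E)%E ->
    (max_norm (nu a) g < e'%:E)%E -> (max_norm (nu a) (f - g)%R < (e1 + e')%:E)%E.
  exact: (max_normB (@quo_haus _ _ a) (@quo_locally_compact _ _ lcG _ a) eL (gfam_haar hmu a)).
have [n0 hn] := null_diff_sym XBa N0a NBa Xv Xv' h e0.
exists n0 => n n0n; apply: le_lt_trans (hn n n0n).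
exact: (max_norm_qmap lcG eK MR hmu (XBa _ _ (Xv' n) (Xv n))).
Qed.

Lemma g_Cstar : Cstar_max mu =
  \bigcup_(a in [set: A]) (pullback_Cstar mu (qmap (gi_gpm a)) @` Cstar_max (nu a)).
Proof.
apply/seteqP; split => [_ [u cu <-]|_ [a _ [_ [v cv <-] <-]]].
  have [a fa cd] := ncauchy_descend cu; exists a => //.
  have uE : (fun n => pullback (qmap a) (descend a (u n))) = u.
    by apply/funext => n; exact: descendK.
  have h := pullback_Cstar_nclass cd; rewrite uE in h.
  by exists (nclass (max_norm (nu a)) (@Cc R (quo a)) (fun n => descend a (u n))) => //;
    exists (fun n => descend a (u n)).
rewrite (pullback_Cstar_nclass cv); exists (fun n => pullback (qmap a) (v n)) => //.
exact: ncauchy_pullback.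
Qed.

End CstarUnion.

Lemma pullback_star_hom (R : realType) (G : ptopGroupoidType)
    (lcG : lc_groupoid G) (K : nat -> set G) (eK : exhaustion K)
    (M : nat -> G -> {measure set (borel G) -> \bar R})
    (MR : forall k x, units x -> radon (M k x)) (hmu : haar_system (M 0%N)) (a b : gidx M) :
  gle a b -> Cc_continuous_star_hom (gfam b) (gfam a) (@pullback R _ _ (gbond a b)).
Proof.
move=> ab; have [mb cb pb] := gbond_pc ab.
have ha := @quo_haus _ _ a; have hb := @quo_haus _ _ b.
have pC f : Cc f -> Cc (pullback (gbond a b) f) := @pullback_Cc R _ _ _ hb ha cb pb f.
split => //.
- move=> f g cf cg; apply: (pullback_convolution hb ha mb cb (gbond_push MR ab)) => //.
  by move=> y uy; apply: (haar_conc hb (gfam_haar hmu b)).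
- by move=> f _; exact: (pullback_involution mb).
(* The preimage of [W] under the linear map is again absolutely convex, and properness carries the
   condition on supports to the preimage of a compact set. *)
move=> U [W [WU Wconv Wnb]]; exists [set f | W (pullback (gbond a b) f)]; last first.
  by move=> f _ /WU.
exists [set f | W (pullback (gbond a b) f)]; split => //.
- by move=> f g z w zw Wf Wg; exact: (Wconv _ _ z w zw Wf Wg).
move=> L cL; have [e e0 he] := Wnb _ (pb L cL).
exists e => // f cf fL fe; apply: he.
- exact: pC.
- by move=> x nx; exact: fL.
- by move=> x; exact: fe.
Qed.

Theorem theorem5p25 (R : realType) (G : ptopGroupoidType)
    (mu : G -> {measure set (borel G) -> \bar R}) :
  lc_groupoid G -> sigma_compact G -> top_amenable R G -> haar_system mu ->
  exists (A : Type) (le : A -> A -> Prop)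
    (GA : A -> pmetricGroupoidType R)
    (p : forall a b : A, GA b -> GA a)
    (q : forall a : A, G -> GA a)
    (nu : forall a : A, GA a -> {measure set (borel (GA a)) -> \bar R}),
  [/\ inverse_approximation le p q,
      strong_approximation q,
      forall a : A,
        [/\ lc_groupoid (GA a), @second_countable (GA a),
            top_amenable R (GA a) & haar_system (nu a)],
      forall a : A, (forall y, exists x, q a x = y) /\
        haar_preserving mu (nu a) (q a) &
      [/\ forall a b : A, le a b ->
            Cc_continuous_star_hom (nu b) (nu a) (@pullback R _ _ (p a b)),
          @Cc R G = \bigcup_a (pullback (q a) @` @Cc R (GA a)) &
          Cstar_max mu =
            \bigcup_a (pullback_Cstar mu (q a) @` Cstar_max (nu a))]].
Proof.
move=> lcG scG [m [m1 m2 m3 m4]] hmu; have [hG lG _] := lcG.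
have [K eK] := exhaustion_exists lG scG.
pose M k := if k is n.+1 then m n else mu.
have MR k x : units x -> radon (M k x).
  by case: k => [|n] ux; [case: hmu => /(_ x ux)[]|case: (m1 n x ux)].
have MC k (f : G -> R[i]) : Cc f ->
    {within @units G, continuous (fun x => cintegral (M k x) setT f : R[i]^o)}.
  by case: k => [|n] cf; [case: hmu => _ h _; exact: h|exact: m2].
have hM : haar_system (M 0%N) := hmu.
exists (gidx M), (@gle R G M), (fun a => quo (gi_gpm a)), (@gbond R G M),
  (fun a => qmap (gi_gpm a)), (@gfam R G M).
split.
- by split; [exact: (g_inverse_system hG lG eK MR MC hM)|exact: (g_inverse_limit hG lG eK MR MC hM)].
- exact: (g_strong hG lG eK MR MC hM).
- move=> a; split; [exact: quo_lc|exact: (@quo_second_countable R G a K eK)| |exact: gfam_haar].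
  have minv n x y : units x -> units y -> a x y = 0 -> forall U : set G, open U ->
      (forall b c, a b c = 0 -> U b -> U c) -> m n x U = m n y U.
    (* Slot 0 of [M] holds the Haar system, so [m n] sits at [n.+1]. *)
    by move=> ux uy axy; exact: (good_meas (gi_good a) n.+1 ux uy axy).
  exact: (@quo_amenable R G a m minv m1 m2 m3 m4).
- move=> a; split; first exact: qmap_surj.
  split; first exact: qmap_pc.
  by move=> z x uz ux <- B mB; apply/esym; exact: (gfam_push MR).
- split; [|exact: (g_Cc hG lG eK MR MC hM)|exact: (g_Cstar lcG eK MR MC hM)].
  by move=> a b ab; exact: (pullback_star_hom lcG eK MR hM ab).
Qed.
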